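(* Let $E=(E_k)_{k\in\mathbb{N}_0}$ be one of the following two scale Banach spaces. (Morse case) $E_k=W^{k,p}_{\delta_k}(\mathbb{R},\mathbb{R}^n)$ for $k\in\mathbb{N}_0$, where $n\in\mathbb{N}$, $p\in(1,\infty)$ and $0=\delta_0<\delta_1<\delta_2<\dots$ is a sequence of reals. (Floer case) $E_k=\bigcap_{i=0}^k W^{i,p}_{\delta_k}(\mathbb{R},H_{k-i})$ for $k\in\mathbb{N}_0$, where $p\in(1,\infty)$, $0=\delta_0<\delta_1<\delta_2<\dots$ is a sequence of reals, and $H_j=\ell^2_{f^j}$ for a monotone unbounded function $f:\mathbb{N}\to(0,\infty)$. Then the shift map $$\Psi:\mathbb{R}\oplus E\to E,\qquad (\tau,v)\mapsto \tau_*v,\qquad (\tau_*v)(t):=v(t+\tau),$$ where $\mathbb{R}$ carries the constant scale structure, is sc-smooth.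
   Context: **Weighted sequence spaces.** For a monotone unbounded $f:\mathbb{N}\to(0,\infty)$ let $\ell^2_f=\{x=(x_\nu)_{\nu\in\mathbb{N}}\in\ell^2 : \sum_\nu f(\nu)x_\nu^2<\infty\}$ (real sequences) with inner product $\langle x,y\rangle_f=\sum_\nu f(\nu)x_\nu y_\nu$. $H_0=\ell^2$ and $H_j=\ell^2_{f^j}$, where $f^j$ is the $j$-th power of $f$. **Sobolev spaces.** For a separable real Hilbert space $H$ (possibly finite dimensional), $W^{0,p}(\mathbb{R},H)=L^p(\mathbb{R},H)$, and $W^{k,p}(\mathbb{R},H)$ is the space of $L^p$ functions whose weak derivatives up to order $k$ are in $L^p(\mathbb{R},H)$, with norm defined recursively by $\|v\|_{W^{k+1,p}}=\|v\|_{L^p}+\|\dot v\|_{W^{k,p}}$. Fix a monotone $\beta\in C^\infty(\mathbb{R},[-1,1])$ with $\beta(s)=-1$ for $s\le -1$ and $\beta(s)=1$ for $s\ge1$; for $\delta\ge0$ put $\gamma_\delta(s)=e^{\delta\beta(s)s}$. Define $W^{k,p}_\delta(\mathbb{R},H)=\{v\in W^{k,p}(\mathbb{R},H) : \gamma_\delta v\in W^{k,p}(\mathbb{R},H)\}$ with norm $\|v\|_{W^{k,p}_\delta}=\|\gamma_\delta v\|_{W^{k,p}}$. A finite intersection of Banach spaces carries the maximum of the individual norms. **Scale Banach spaces.** A scale Banach space $E$ is a nested sequence of Banach spaces $E=E_0\supset E_1\supset E_2\supset\cdots$ such that each inclusion $E_{i+1}\hookrightarrow E_i$ is compact and $E_\infty=\bigcap_i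 E_i$ is dense in each $E_i$. A finite dimensional space carries the constant scale structure (all levels equal). $E^m$ is the scale Banach space with levels $(E^m)_k=E_{k+m}$; $(E\oplus F)_k=E_k\oplus F_k$. For $U\subset E$ open, $U_k=U\cap E_k$, and $U^m$ has levels $(U^m)_k=U_{m+k}$. **Scale smoothness.** Let $E,F$ be scale Banach spaces and $U\subset E$ open. A map $f:U\to F$ is $\mathrm{sc}^0$ if for all $k\in\mathbb{N}_0$, $f(U_k)\subset F_k$ and $f|_{U_k}:U_k\to F_k$ is continuous. The tangent bundle is $TE=E^1\oplus E^0$, $TU=U^1\oplus E^0$, so $(TU)_k=U_{k+1}\oplus E_k$. An $\mathrm{sc}^0$ map $f$ is $\mathrm{sc}^1$ if for every $x\in U_1$ there is a bounded linear map $Df(x):E_0\to F_0$ such that (i) $f:U_1\to F_0$ is pointwise (Fréchet) differentiable in the usual sense and $Df(x)|_{E_1}=df(x)$, the usual differential; (ii) the tangent map $Tf:TU\to TF$, $Tf(x,h)=(f(x),Df(x)h)$, is $\mathrm{sc}^0$. For $m\ge2$, an $\mathrm{sc}^1$ map $f$ is $\mathrm{sc}^m$ iff $Tf$ is $\mathrm{sc}^{m-1}$. $f$ is sc-smooth if it is $\mathrm{sc}^m$ for every $m\in\mathbb{N}$. *)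

(* Defs.v *)
From HB Require Import structures.
From mathcomp Require Import all_boot all_order all_algebra.
From mathcomp Require Import all_classical all_reals all_analysis.

Set Implicit Arguments.
Unset Strict Implicit.
Unset Printing Implicit Defensive.

Import Order.TTheory GRing.Theory Num.Theory.
Import numFieldNormedType.Exports.

Local Open Scope classical_set_scope.
Local Open Scope ring_scope.

Section ae_classes.
Context (R : realType) (X : lmodType R).
Local Notation mu := (@lebesgue_measure R).

#[local] Instance lebesgue_ae_filter : Filter (almost_everywhere mu) :=
  ae_filter_ringOfSetsType mu.
#[local] Instance lebesgue_ae_nbhs_filter :
  Filter (nbhs (almost_everywhere mu)) := ae_filter_ringOfSetsType mu.

Definition fun_ae_eq (v w : R -> X) : bool :=
  `[< {ae mu, forall t, v t = w t} >].

Let fun_ae_eq_refl : reflexive fun_ae_eq.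
Proof. by move=> v; apply/asboolP; apply: aeW => t. Qed.

Let fun_ae_eq_sym : symmetric fun_ae_eq.
Proof.
move=> v w; apply/idP/idP => /asboolP vw; apply/asboolP.
  by apply: filterS vw => t ->.
by apply: filterS vw => t ->.
Qed.

Let fun_ae_eq_trans : transitive fun_ae_eq.
Proof.
move=> w v z /asboolP vw /asboolP wz; apply/asboolP.
by apply: filterS2 vw wz => t -> ->.
Qed.

Canonical fun_ae_eq_canonical :=
  EquivRel fun_ae_eq fun_ae_eq_refl fun_ae_eq_sym fun_ae_eq_trans.

Local Open Scope quotient_scope.

Definition aeFun : Type := {eq_quot fun_ae_eq}.
HB.instance Definition _ := Choice.on aeFun.
HB.instance Definition _ := EqQuotient.on aeFun.

Definition ae_class (v : R -> X) : aeFun := \pi_aeFun v.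

Lemma ae_classP (v w : R -> X) :
  {ae mu, forall t, v t = w t} <-> ae_class v = ae_class w.
Proof.
by split => [vw|/eqquotP/asboolP//]; apply/eqquotP; apply/asboolP.
Qed.

Lemma repr_ae_class (v : R -> X) :
  {ae mu, forall t, repr (ae_class v) t = v t}.
Proof. by apply/ae_classP; rewrite /ae_class reprK. Qed.

Definition ae_add (a b : aeFun) : aeFun := ae_class (fun t => repr a t + repr b t).
Definition ae_opp (a : aeFun) : aeFun := ae_class (fun t => - repr a t).
Definition ae_scale (c : R) (a : aeFun) : aeFun := ae_class (fun t => c *: repr a t).

Lemma ae_ext (a b : aeFun) : {ae mu, forall t, repr a t = repr b t} -> a = b.
Proof. by move=> /ae_classP; rewrite /ae_class !reprK. Qed.

Let ae_addA : associative ae_add.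
Proof.
move=> a b c; apply/ae_ext.
have h1 := repr_ae_class (fun t => repr a t + repr (ae_add b c) t).
have h2 := repr_ae_class (fun t => repr (ae_add a b) t + repr c t).
have h3 := repr_ae_class (fun t => repr b t + repr c t).
have h4 := repr_ae_class (fun t => repr a t + repr b t).
apply: filterS2 (filterI h1 h2) (filterI h3 h4) => t [e1 e2] [e3 e4].
by rewrite [LHS]e1 [RHS]e2 [repr (ae_add b c) t]e3 [repr (ae_add a b) t]e4 addrA.
Qed.

Let ae_addC : commutative ae_add.
Proof.
by move=> a b; apply/ae_classP; apply: aeW => t /=; rewrite addrC.
Qed.

Let ae_add0 : left_id (ae_class (fun=> 0)) ae_add.
Proof.
move=> a; apply/ae_ext.
apply: filterS2 (repr_ae_class (fun=> 0)) (repr_ae_class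
  (fun t => repr (ae_class (fun=> 0)) t + repr a t)) => t e1 e2.
by rewrite [LHS]e2 e1 add0r.
Qed.

Let ae_addN : left_inverse (ae_class (fun=> 0)) ae_opp ae_add.
Proof.
move=> a; apply/ae_classP.
apply: filterS (repr_ae_class (fun t => - repr a t)) => t e.
by rewrite [repr (ae_opp a) t]e addNr.
Qed.

HB.instance Definition _ :=
  GRing.isZmodule.Build aeFun ae_addA ae_addC ae_add0 ae_addN.

Let ae_scaleA (c d : R) (a : aeFun) :
  ae_scale c (ae_scale d a) = ae_scale (c * d) a.
Proof.
apply/ae_classP; apply: filterS (repr_ae_class (fun t => d *: repr a t)) => t e.
by rewrite [repr (ae_scale d a) t]e scalerA.
Qed.

Let ae_scale1 : left_id 1 ae_scale.
Proof.
move=> a; apply/ae_ext.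
apply: filterS (repr_ae_class (fun t => 1 *: repr a t)) => t e.
by rewrite [LHS]e scale1r.
Qed.

Let ae_scaleDr : right_distributive ae_scale +%R.
Proof.
move=> c a b; apply/ae_classP.
have h1 := repr_ae_class (fun t => repr a t + repr b t).
have h2 := repr_ae_class (fun t => c *: repr a t).
have h3 := repr_ae_class (fun t => c *: repr b t).
apply: filterS2 h1 (filterI h2 h3) => t e1 [e2 e3].
by rewrite [repr (ae_scale c a) t]e2 [repr (ae_scale c b) t]e3
  [repr (a + b) t]e1 scalerDr.
Qed.

Let ae_scaleDl (a : aeFun) : {morph ae_scale^~ a : c d / c + d}.
Proof.
move=> c d; apply/ae_classP.
have h1 := repr_ae_class (fun t => c *: repr a t).
have h2 := repr_ae_class (fun t => d *: repr a t).
apply: filterS2 h1 h2 => t e1 e2.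
by rewrite [repr (ae_scale c a) t]e1 [repr (ae_scale d a) t]e2 scalerDl.
Qed.

HB.instance Definition _ := GRing.Zmodule_isLmodule.Build R aeFun
  ae_scaleA ae_scale1 ae_scaleDr ae_scaleDl.

Definition shift_class (tau : R) (v : aeFun) : aeFun :=
  ae_class (fun t => repr v (t + tau)).

End ae_classes.

(* The Hilbert spaces H_0, H_1, ... of the Floer case are nested. So a Hilbert
   space is given here as a subset of an ambient vector space, with an inner
   product that is meaningful on this subset. *)
Record hilb (R : realType) (X : lmodType R) := Hilb {
  hset : set X;
  hip : X -> X -> R }.

Section hilbert_spaces.
Context (R : realType).

Definition hnorm (X : lmodType R) (H : hilb X) (x : X) : R :=
  Num.sqrt (hip H x x).

Definition euclidean (n : nat) : hilb 'rV[R]_n :=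
  Hilb [set: 'rV[R]_n] (fun x y => \sum_(i < n) x ord0 i * y ord0 i).

Definition summable_seq (u : nat -> R) : Prop := cvgn (series u).

Definition l2w (f : nat -> R) : hilb (nat -> R : lmodType R) :=
  Hilb [set x : nat -> R | summable_seq (fun nu => x nu ^+ 2) /\
                           summable_seq (fun nu => f nu * x nu ^+ 2)]
       (fun x y => limn (series (fun nu => f nu * x nu * y nu))).

Definition l2pow (f : nat -> R) (j : nat) : hilb (nat -> R : lmodType R) :=
  l2w (fun nu => f nu ^+ j).

End hilbert_spaces.

Section sobolev.
Context (R : realType) (X : lmodType R) (H : hilb X).
Local Notation mu := (@lebesgue_measure R).

Definition simple_fun (s : R -> X) : Prop :=
  exists (m : nat) (A : 'I_m -> set R) (x : 'I_m -> X),
    [/\ forall i, measurable (A i),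
        forall i, hset H (x i) &
        s = fun t => \sum_(i < m) (\1_(A i) t : R) *: x i].

Definition strongly_measurable (v : R -> X) : Prop :=
  {ae mu, forall t, hset H (v t)} /\
  exists s : nat -> R -> X,
    (forall j, simple_fun (s j)) /\
    {ae mu, forall t, hnorm H (v t - s j t) @[j --> \oo] --> (0 : R)}.

Definition eLp_norm (p : R) (v : R -> X) : \bar R :=
  Lnorm mu p%:E (fun t => (hnorm H (v t))%:E).

Definition Lp_norm (p : R) (v : R -> X) : R := fine (eLp_norm p v).

Definition in_Lp (p : R) (v : R -> X) : Prop :=
  strongly_measurable v /\ (eLp_norm p v < +oo)%E.

Definition has_hderiv (phi : R -> X) (t : R) (d : X) : Prop :=
  hnorm H (s^-1 *: (phi (t + s) - phi t) - d) @[s --> (0 : R)^'] --> (0 : R).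

(* [phi i] is the i-th derivative of the test function [phi 0], which lies in
   C_c^oo(R, H). *)
Definition test_fun (phi : nat -> R -> X) : Prop :=
  [/\ forall i t, hset H (phi i t),
      forall i t, has_hderiv (phi i) t (phi i.+1 t) &
      exists M : R, forall t, M < `|t| -> phi 0%N t = 0].

Definition is_weak_deriv (v w : R -> X) : Prop :=
  forall phi, test_fun phi ->
    \int[mu]_t hip H (v t) (phi 1%N t) = - \int[mu]_t hip H (w t) (phi 0%N t).

Definition Lp_weak_deriv (p : R) (v w : R -> X) : Prop :=
  in_Lp p w /\ is_weak_deriv v w.

Fixpoint in_sobolev (p : R) (k : nat) (v : R -> X) : Prop :=
  match k with
  | 0%N => in_Lp p v
  | k'.+1 => in_Lp p v /\
             exists w, Lp_weak_deriv p v w /\ in_sobolev p k' w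
  end.

(* Weak derivatives in L^p are unique almost everywhere, so the norm below does
   not depend on the choice made by [xget]. *)
Definition weak_deriv (p : R) (v : R -> X) : R -> X :=
  xget (fun=> 0) [set w | Lp_weak_deriv p v w].

Fixpoint sobolev_norm (p : R) (k : nat) (v : R -> X) : R :=
  match k with
  | 0%N => Lp_norm p v
  | k'.+1 => Lp_norm p v + sobolev_norm p k' (weak_deriv p v)
  end.

Variable beta : R -> R.

Definition gamma_weight (delta : R) (s : R) : R := expR (delta * beta s * s).

Definition weighted (delta : R) (v : R -> X) : R -> X :=
  fun s => gamma_weight delta s *: v s.

Definition in_wsobolev (p delta : R) (k : nat) (v : R -> X) : Prop :=
  in_sobolev p k v /\ in_sobolev p k (weighted delta v).

Definition wsobolev_norm (p delta : R) (k : nat) (v : R -> X) : R :=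
  sobolev_norm p k (weighted delta v).

End sobolev.

Definition cutoff (R : realType) (beta : R -> R) : Prop :=
  [/\ forall (k : nat) (s : R), derivable (derive1n k beta) s 1,
      {homo beta : s t / s <= t},
      forall s, s <= -1 -> beta s = -1 &
      forall s, 1 <= s -> beta s = 1].

(* The levels of a scale are subsets of one vector space, and [snorm k] is
   meaningful on [level k]. The definition of scale smoothness involves only the
   levels and their norms. It is therefore stated without the completeness,
   compactness and density axioms of scale Banach spaces. *)
Record scale (R : realType) := Scale {
  scar : lmodType R;
  level : nat -> set scar;
  snorm : nat -> scar -> R }.

Section sc_calculus.
Context (R : realType).
Implicit Types (E F : scale R).

Definition scale_const : scale R :=
  @Scale R (R^o : lmodType R) (fun=> setT) (fun _ x => `|x|).

Definition scale_shift (m : nat) E : scale R :=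
  Scale (fun k => @level R E (k + m)) (fun k => @snorm R E (k + m)).

Definition scale_sum E F : scale R :=
  @Scale R ((scar E * scar F)%type : lmodType R)
    (fun k x => level k x.1 /\ level k x.2)
    (fun k x => Num.max (snorm k x.1) (snorm k x.2)).

Definition sc0 E F (U : set (scar E)) (f : scar E -> scar F) : Prop :=
  forall k : nat,
    (forall x, U x -> level k x -> level k (f x)) /\
    (forall x, U x -> level k x -> forall e : R, 0 < e ->
       exists2 d : R, 0 < d & forall y, U y -> level k y ->
         snorm k (y - x) < d -> snorm k (f y - f x) < e).

Definition bounded_linear0 E F (L : scar E -> scar F) : Prop :=
  [/\ forall h, level 0 h -> level 0 (L h),
      forall (a : R) h h', level 0 h -> level 0 h' ->
        L (a *: h + h') = a *: L h + L h' &
      exists C : R, forall h, level 0 h -> snorm 0 (L h) <= C * snorm 0 h].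

(* [L], restricted to E_1, is the Fréchet differential at [x] of f : U_1 -> F_0. *)
Definition frechet10 E F (U : set (scar E)) (f : scar E -> scar F)
    (x : scar E) (L : scar E -> scar F) : Prop :=
  forall e : R, 0 < e -> exists2 d : R, 0 < d &
    forall h, level 1 h -> U (x + h) -> snorm 1 h < d ->
      snorm 0 (f (x + h) - f x - L h) <= e * snorm 1 h.

Definition sc_differential E F (U : set (scar E)) (f : scar E -> scar F)
    (Df : scar E -> scar E -> scar F) : Prop :=
  forall x, U x -> level 1 x ->
    bounded_linear0 (Df x) /\ frechet10 U f x (Df x).

Definition tangent E : scale R := scale_sum (scale_shift 1 E) E.

Definition tangent_dom E (U : set (scar E)) : set (scar (tangent E)) :=
  [set xh | [/\ U xh.1, level 1 xh.1 & level 0 xh.2]].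

Definition tangent_map E F (f : scar E -> scar F)
    (Df : scar E -> scar E -> scar F) (xh : scar (tangent E)) :
    scar (tangent F) :=
  (f xh.1, Df xh.1 xh.2).

Fixpoint scm (m : nat) E F (U : set (scar E)) (f : scar E -> scar F) : Prop :=
  match m with
  | 0%N => sc0 U f
  | m'.+1 => sc0 U f /\ exists Df, sc_differential U f Df /\
      @scm m' (tangent E) (tangent F) (tangent_dom U) (tangent_map f Df)
  end.

Definition sc_smooth E F (U : set (scar E)) (f : scar E -> scar F) : Prop :=
  forall m : nat, scm m U f.

End sc_calculus.

Section spaces.
Context (R : realType) (beta : R -> R) (p : R) (delta : nat -> R).

Definition morse_scale (n : nat) : scale R :=
  @Scale R (aeFun 'rV[R]_n)
    (fun k => [set v | in_wsobolev (euclidean R n) beta p (delta k) k (repr v)])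
    (fun k v => wsobolev_norm (euclidean R n) beta p (delta k) k (repr v)).

Definition floer_scale (f : nat -> R) : scale R :=
  @Scale R (aeFun (nat -> R : lmodType R))
    (fun k => [set v | forall i : nat, (i <= k)%N ->
       in_wsobolev (l2pow f (k - i)) beta p (delta k) i (repr v)])
    (fun k v => \big[Num.max/0]_(i < k.+1)
       wsobolev_norm (l2pow f (k - i)) beta p (delta k) i (repr v)).

End spaces.

Definition shift_map (R : realType) (X : lmodType R) (x : R * aeFun X) : aeFun X :=
  shift_class x.1 x.2.

(* Main.v *)
Require Import Defs.
From HB Require Import structures.
From mathcomp Require Import all_boot all_order all_algebra.
From mathcomp Require Import all_classical all_reals all_analysis.
From mathcomp Require Import measurable_realfun ring lra.
Set Implicit Arguments.
Unset Strict Implicit.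
Unset Printing Implicit Defensive.
Import Order.TTheory GRing.Theory Num.Theory.
Import numFieldNormedType.Exports.
Local Open Scope classical_set_scope.
Local Open Scope ring_scope.

(** The translations form a group of operators on each level [E_k], locally
bounded and strongly continuous, and their generator, the derivative, maps
[E_(k+1)] to [E_k]. These facts alone imply that the shift map is scale smooth.
Its differential at [(tau, v)] is [(T, h) |-> tau_* h + T tau_* v'], and its
tangent map, like all the iterated ones, is built by sums, pairs and products with
real coordinates from expressions [tau_* (D^j v)], where [tau] and [v] are linear
coordinates of the iterated tangent space. Each [D] costs one level, but is applied
only to a vector that has been the base point of a tangent vector, and so lies one
level higher. The class [translation_map] of such maps consists of sc^0 maps
([tm_near]) and is closed under passing to the tangent map ([tm_tangent]);
[translation_sc_smooth] is the conclusion.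

To verify the assumptions of this principle ([translation_scale]) both Euclidean
space and the weighted sequence spaces are treated as spaces of sequences with a
weighted norm ([coord_hilb]). Functions in L^p have representatives with measurable
coordinates, and translations are strongly continuous in L^p
([Lp_translation_continuous]). A weak derivative [w] of [v] is turned into the
identity [v (t + h) - v t = \int w] over [[t, t + h]] for almost every [t], by
testing with smoothed indicators of intervals ([weak_scalar_increment]). It has two
consequences. Derivatives are unique and can be chosen for all the Hilbert spaces
of a scale at once ([coord_derivative]). And the difference quotients converge: the
error [v (t + h) - v t - h w t] is an integral of [w (t + s) - w t] over [0 <= s <= h],
so that its norm is at most [h] times a modulus of continuity of the translations
of [w] ([difference_quotient_le]).

The weights enter through two bounds. The quotient of a weight and its translate
is bounded and tends to 1 uniformly ([weight_shift]), so translations remain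
strongly continuous with weights. The logarithmic derivative of a weight is bounded
together with all its derivatives ([exponent_bounded]), so the norm of [gamma v] in
W^(i,p) is equivalent to the sum of the weighted L^p norms of the derivatives of
[v] ([wsobolev_wderiv], [wderiv_wsobolev]), and these can be treated one by one.
Finally both scales are covered by one lemma, [sobolev_translation_scale], because
each component W^(i,p)(H) of a level is matched by W^(i+1,p)(H) on the next level,
with a larger weight. *)

(** * Maps built from a translation and linear coordinates are scale smooth *)

Fact subr_regroup (V : zmodType) (p q u d g : V) :
  p + q - u - (d + g) = p - u - g + (q - d).
Proof. by rewrite opprD [RHS]addrACA [- g - d]addrC [p - u + q]addrAC. Qed.

Fact addr_regroup (V : zmodType) (p q u d g h : V) :
  p + q - (u + d) - (g + h) = (p - u - g) + (q - d - h).
Proof. by rewrite !opprD [p + q + _]addrACA [LHS]addrACA. Qed.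

Section sc_normed.
Context (R : realType).
Implicit Types (E F G : scale R).

Record normed_scale E : Prop := NormedScale {
  lvl0 : forall k, @level R E k 0;
  lvlD : forall k (a : R) (x y : scar E), level k x -> level k y -> level k (a *: x + y);
  lvlS : forall k (x : scar E), level k.+1 x -> level k x;
  sn_ge0 : forall k (x : scar E), 0 <= snorm k x;
  snZ : forall k (a : R) (x : scar E), level k x -> snorm k (a *: x) <= `|a| * snorm k x;
  snD : forall k (x y : scar E), level k x -> level k y ->
    snorm k (x + y) <= snorm k x + snorm k y;
  snS : forall k, exists2 C : R, 0 <= C &
    forall x : scar E, level k.+1 x -> snorm k x <= C * snorm k.+1 x }.

Section normed_scale_theory.
Context E (nE : normed_scale E).

Lemma lvl_add k (x y : scar E) : level k x -> level k y -> level k (x + y).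
Proof. by move=> hx hy; rewrite -[x]scale1r; apply: lvlD. Qed.

Lemma lvl_scale k (a : R) (x : scar E) : level k x -> level k (a *: x).
Proof. by move=> hx; rewrite -[_ *: _]addr0; apply: lvlD => //; exact: lvl0. Qed.

Lemma lvl_sub k (x y : scar E) : level k x -> level k y -> level k (x - y).
Proof. by move=> hx hy; rewrite -scaleN1r addrC; apply: lvlD. Qed.

Lemma lvl_drop0 k (x : scar E) : level k x -> level 0 x.
Proof. by elim: k => // k IH /(lvlS nE) /IH. Qed.

Lemma snN k (x : scar E) : level k x -> snorm k (- x) <= snorm k x.
Proof. by move=> hx; have := snZ nE (-1) hx; rewrite scaleN1r normrN1 mul1r. Qed.

End normed_scale_theory.

Lemma normed_const : normed_scale (scale_const R).
Proof.
split => //=.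
- by move=> k a x _; rewrite normrM.
- by move=> k x y _ _; exact: ler_normD.
- by move=> k; exists 1 => // x _; rewrite mul1r.
Qed.

Lemma normed_shift m E : normed_scale E -> normed_scale (scale_shift m E).
Proof.
move=> nE; split => /=.
- by move=> k; apply: lvl0.
- by move=> k a x y; apply: lvlD.
- by move=> k x; rewrite addSn; apply: lvlS.
- by move=> k x; apply: sn_ge0.
- by move=> k a x; apply: snZ.
- by move=> k x y; apply: snD.
- by move=> k; have [C C0 hC] := snS nE (k + m); exists C => // x; rewrite addSn; apply: hC.
Qed.

Lemma normed_sum E F :
  normed_scale E -> normed_scale F -> normed_scale (scale_sum E F).
Proof.
move=> nE nF; split => /=.
- by move=> k; split; apply: lvl0.
- by move=> k a x y [? ?] [? ?]; split; apply: lvlD.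
- by move=> k x [? ?]; split; apply: lvlS.
- by move=> k x; rewrite le_max sn_ge0.
- move=> k a x [hx hy]; rewrite maxr_pMr// ge_max !le_max.
  by rewrite snZ//= snZ//= orbT.
- move=> k x y [x1 x2] [y1 y2]; rewrite ge_max; apply/andP; split.
    by apply: le_trans (snD nE x1 y1) _; apply: lerD; rewrite le_max lexx.
  by apply: le_trans (snD nF x2 y2) _; apply: lerD; rewrite le_max lexx orbT.
- move=> k; have [C C0 hC] := snS nE k; have [C' C'0 hC'] := snS nF k.
  exists (C + C'); first exact: addr_ge0.
  move=> x [x1 x2]; rewrite ge_max; apply/andP; split.
    apply: le_trans (hC _ x1) _; apply: ler_pM => //; first exact: sn_ge0.
      by rewrite lerDl.
    by rewrite le_max lexx.
  apply: le_trans (hC' _ x2) _; apply: ler_pM => //; first exact: sn_ge0.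
    by rewrite lerDr.
  by rewrite le_max lexx orbT.
Qed.

(** Small increments of the given level; every estimate below is an eventual
one along this filter. *)
Definition near0 G (k : nat) : set_system (scar G) :=
  [set P | exists2 d : R, 0 < d & forall h, level k h -> snorm k h < d -> P h].

Lemma near0_and G k (P Q : scar G -> Prop) :
  near0 k P -> near0 k Q -> near0 k (fun h => P h /\ Q h).
Proof.
move=> [d d0 hP] [d' d'0 hQ]; exists (Num.min d d'); first by rewrite lt_min d0.
by move=> h hh; rewrite lt_min => /andP[h1 h2]; split; [apply: hP|apply: hQ].
Qed.

Lemma near0S G k (P Q : scar G -> Prop) :
  (forall h, level k h -> P h -> Q h) -> near0 k P -> near0 k Q.
Proof. by move=> PQ [d d0 hP]; exists d => // h hh hd; apply: PQ => //; apply: hP. Qed.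

Lemma near0_small G k (C e : R) : 0 <= C -> 0 < e ->
  near0 k (fun h : scar G => C * snorm k h < e).
Proof.
move=> C0 e0; exists (e / (C + 1)); first by rewrite divr_gt0// ltr_wpDl.
move=> h _; rewrite ltr_pdivlMr ?ltr_wpDl// => hd.
have [h0|h0] := leP 0 (snorm k h).
  by apply: le_lt_trans hd; rewrite mulrC ler_wpM2l// lerDl.
by apply: le_lt_trans e0; rewrite mulr_ge0_le0// ltW.
Qed.

(** The linear coordinates of an iterated tangent space of [R + E] are real
numbers and vectors of [E]. The number [r] counts the tangent spaces in which a
vector has been a base point: each of them raised its level by one, and this pays
for one application of the generator. *)
Definition rcoord G (a : scar G -> R) : Prop :=
  (forall c x y, a (c *: x + y) = c * a x + a y) /\
  forall k, exists2 C : R, 0 <= C & forall x, level k x -> `|a x| <= C * snorm k x.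

Definition vcoord G E (r : nat) (b : scar G -> scar E) : Prop :=
  [/\ forall c x y, level 0 x -> level 0 y -> b (c *: x + y) = c *: b x + b y,
      forall k x, level k x -> level (k + r) (b x) &
      forall k, exists2 C : R, 0 <= C &
        forall x, level k x -> snorm (k + r) (b x) <= C * snorm k x].

Lemma rcoordD G (a : scar G -> R) x y : rcoord a -> a (x + y) = a x + a y.
Proof. by move=> [al _]; rewrite -[x]scale1r al mul1r scale1r. Qed.

Lemma rcoord_fst G (a : scar G -> R) : rcoord a ->
  rcoord (fun xh : scar (tangent G) => a xh.1).
Proof.
move=> [al ab]; split => [c x y|k]; first by rewrite al.
have [C C0 hC] := ab k.+1; exists C => // x [/=]; rewrite addn1 => x1 _.
by apply: le_trans (hC _ x1) _; rewrite ler_wpM2l// le_max lexx.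
Qed.

Lemma rcoord_snd G (a : scar G -> R) : rcoord a ->
  rcoord (fun xh : scar (tangent G) => a xh.2).
Proof.
move=> [al ab]; split => [c x y|k]; first by rewrite al.
have [C C0 hC] := ab k; exists C => // x [/= _ x2].
by apply: le_trans (hC _ x2) _; rewrite ler_wpM2l// le_max lexx orbT.
Qed.

Section vcoord_theory.
Context G E (nG : normed_scale G) (r : nat) (b : scar G -> scar E).
Hypothesis hb : vcoord r b.

Lemma vcoordD x y : level 0 x -> level 0 y -> b (x + y) = b x + b y.
Proof.
by case: hb => bl _ _ x0 y0; rewrite -[x]scale1r bl// !scale1r.
Qed.

Lemma vcoord_fst : vcoord r.+1 (fun xh : scar (tangent G) => b xh.1).
Proof.
case: hb => bl bv bn; split => [c x y [x0 _] [y0 _]|k x [x1 _]|k].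
- by rewrite bl//; apply: (lvl_drop0 nG (k := 0 + 1)).
- by have := bv _ _ x1; rewrite addn1 addSnnS.
- have [C C0 hC] := bn k.+1; exists C => // x [/=]; rewrite addn1 => x1 _.
  rewrite -addSnnS; apply: le_trans (hC _ x1) _.
  by rewrite ler_wpM2l// le_max lexx.
Qed.

Lemma vcoord_snd : vcoord r (fun xh : scar (tangent G) => b xh.2).
Proof.
case: hb => bl bv bn; split => [c x y [_ x0] [_ y0]|k x [_ x1]|k].
- by rewrite bl.
- exact: bv.
- have [C C0 hC] := bn k; exists C => // x [/= _ x2].
  by apply: le_trans (hC _ x2) _; rewrite ler_wpM2l// le_max lexx orbT.
Qed.

End vcoord_theory.
End sc_normed.

(** A strongly continuous group on every level, whose generator loses one level.
The generator condition asks for positive increments; the group law provides the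
negative ones ([ts_gen2]). *)
Record translation_scale (R : realType) (E : scale R)
    (S : R -> scar E -> scar E) (D : scar E -> scar E) : Prop := TranslationScale {
  ts_normed : normed_scale E;
  ts_0 : forall x, S 0 x = x;
  ts_D : forall s t x, S (s + t) x = S s (S t x);
  ts_lin : forall t a x y, S t (a *: x + y) = a *: S t x + S t y;
  ts_lvl : forall k t x, level k x -> level k (S t x);
  ts_bd : forall k r, exists2 C : R, 0 <= C & forall t x, `|t| <= r -> level k x ->
    snorm k (S t x) <= C * snorm k x;
  ts_cont : forall k x, level k x -> forall e : R, 0 < e -> exists2 d : R, 0 < d &
    forall h, `|h| < d -> snorm k (S h x - x) < e;
  gen_lvl : forall k x, level k.+1 x -> level k (D x);
  gen_lin : forall a x y, level 1 x -> level 1 y -> D (a *: x + y) = a *: D x + D y;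
  gen_bd : forall k, exists2 C : R, 0 <= C & forall x, level k.+1 x ->
    snorm k (D x) <= C * snorm k.+1 x;
  ts_gen : forall k x, level k.+1 x -> forall e : R, 0 < e -> exists2 d : R, 0 < d &
    forall h, 0 < h < d -> snorm k (S h x - x - h *: D x) <= e * h }.

Section translation_smooth.
Context (R : realType) (E : scale R) (S : R -> scar E -> scar E)
  (D : scar E -> scar E) (tsE : translation_scale S D).
Implicit Types (F G : scale R).

Let nE : normed_scale E := ts_normed tsE.

Lemma tsB t x y : S t (x - y) = S t x - S t y.
Proof. by rewrite addrC -scaleN1r (ts_lin tsE) scaleN1r addrC. Qed.

Lemma tsDr t x y : S t (x + y) = S t x + S t y.
Proof. by rewrite -[x]scale1r (ts_lin tsE) !scale1r. Qed.

Lemma tsZ t a x : S t (a *: x) = a *: S t x.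
Proof.
have S0 : S t 0 = 0 by rewrite -[X in S t X](subrr 0) tsB subrr.
by rewrite -[a *: x]addr0 (ts_lin tsE) S0 addr0.
Qed.

(** For [h < 0] and [a = - h], the difference [S h x - x - h *: D x] is
[- S h (S a x - x - a *: D x) - a *: (S h (D x) - D x)]. *)
Lemma ts_gen2 k x : level k.+1 x -> forall e : R, 0 < e -> exists2 d : R, 0 < d &
  forall h, `|h| < d -> snorm k (S h x - x - h *: D x) <= e * `|h|.
Proof.
move=> x1 e e0; have x0 := lvlS nE x1; have Dx := gen_lvl tsE x1.
have [C C0 hC] := ts_bd tsE k 1.
have c1 : 0 < C + 1 by rewrite ltr_wpDl.
have e1 : 0 < e / 2 / (C + 1) by rewrite !divr_gt0.
have eC : C * (e / 2 / (C + 1)) <= e / 2.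
  rewrite mulrCA ler_piMr ?divr_ge0 ?ltW// ltr_pdivrMr// mul1r ltrDl//.
have [d d0 hd] := ts_gen tsE x1 e1.
have [d' d'0 hd'] := ts_cont tsE Dx (divr_gt0 e0 (ltr0Sn R 1)).
exists (Num.min 1 (Num.min d d')); first by rewrite !lt_min ltr01 d0.
move=> h; rewrite !lt_min => /and3P[h1 hhd hhd'].
have [h0|h0|<-] := ltgtP 0 h; last first.
- by rewrite (ts_0 tsE) scale0r subr0 subrr normr0 mulr0 -(scale0r 0) (le_trans (snZ nE _ (lvl0 nE k)))// normr0 mul0r.
- pose a := - h; have a0 : 0 < a by rewrite oppr_gt0.
  have ah : `|h| = a by rewrite ltr0_norm.
  have -> : S h x - x - h *: D x =
      - (S h (S a x - x - a *: D x)) - a *: (S h (D x) - D x).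
    have Sha : S h (S a x) = x by rewrite -(ts_D tsE) subrr (ts_0 tsE).
    rewrite !tsB Sha tsZ scalerBr !opprB [RHS]addrC addrA subrK addrC.
    by rewrite /a scaleNr.
  have l1 : level k (S a x - x - a *: D x).
    apply: (lvl_sub nE); last exact: (lvl_scale nE).
    by apply: (lvl_sub nE) => //; exact: (ts_lvl tsE).
  have l2 : level k (S h (D x) - D x) by apply: (lvl_sub nE) => //; exact: (ts_lvl tsE).
  have l3 := ts_lvl tsE h l1.
  apply: le_trans (snD nE _ _) _.
  + by rewrite -scaleN1r; apply: (lvl_scale nE).
  + by rewrite -scaleN1r; do 2 apply: (lvl_scale nE).
  rewrite ah (splitr e) mulrDl; apply: lerD.
    apply: le_trans (snN nE l3) _; apply: le_trans (hC _ _ (ltW h1) l1) _.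
    apply: le_trans (ler_wpM2l C0 (hd a _)) _; first by rewrite a0 -ah.
    by rewrite mulrA ler_wpM2r ?(ltW a0).
  apply: le_trans (snN nE (lvl_scale nE a l2)) _.
  apply: le_trans (snZ nE _ l2) _; rewrite (gtr0_norm a0) mulrC ler_wpM2r ?(ltW a0)//.
  by apply/ltW/hd'.
- move: hhd; rewrite gtr0_norm// => hhd.
  have hh : 0 < h < d by rewrite h0.
  apply: le_trans (hd h hh) _; rewrite ler_wpM2r ?(ltW h0)//.
  rewrite ler_pdivrMr//; have : 0 <= e * C by rewrite mulr_ge0// ltW.
  by lra.
Qed.

(** Splitting a translation into many short ones turns the infinitesimal bound
given by the generator into a Lipschitz bound. *)
Lemma ts_lip k : exists2 C : R, 0 <= C & forall h x, `|h| <= 1 -> level k.+1 x ->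
  snorm k (S h x - x) <= C * `|h| * snorm k.+1 x.
Proof.
have [M M0 hM] := ts_bd tsE k 1; have [C C0 hC] := gen_bd tsE k.
exists (M * C) => [|h x h1 x1]; first exact: mulr_ge0.
have x0 := lvlS nE x1; have Dx := gen_lvl tsE x1.
have step (s q : R) m : level k (S s x - x) -> snorm k (S s x - x) <= q ->
    m%:R * `|s| <= 1 -> snorm k (S (m%:R * s) x - x) <= m%:R * (M * q).
  move=> ls sq; elim: m => [_|m IH hm].
    rewrite !mul0r (ts_0 tsE) subrr -(scale0r 0).
    by rewrite (le_trans (snZ nE _ (lvl0 nE k)))// normr0 mul0r.
  have hm' : m%:R * `|s| <= 1.
    by apply: le_trans hm; rewrite ler_wpM2r// ler_nat.
  have -> : S (m.+1%:R * s) x - x = S (m%:R * s) (S s x - x) + (S (m%:R * s) x - x).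
    by rewrite tsB -(ts_D tsE) addrA subrK -[m.+1%:R]natr1 mulrDl mul1r.
  apply: le_trans (snD nE _ _) _; first exact: (ts_lvl tsE).
    by apply: (lvl_sub nE) => //; exact: (ts_lvl tsE).
  rewrite -[m.+1%:R]natr1 mulrDl mul1r [leRHS]addrC lerD ?IH//.
  apply: le_trans (hM _ _ _ ls) _; first by rewrite normrM ger0_norm.
  by rewrite ler_wpM2l.
apply/ler_addgt0Pr => e e0.
have b1 : 0 < M * `|h| + 1 by rewrite ltr_wpDl// mulr_ge0.
have [d d0 hd] := ts_gen2 x1 (divr_gt0 e0 b1).
pose m := (Num.truncn (`|h| / d)).+1.
have m0 : 0 < m%:R :> R by rewrite ltr0n.
have mh : m%:R * (h / m%:R) = h by rewrite mulrC divfK// gt_eqF.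
have hmd : `|h / m%:R| < d.
  rewrite normrM normfV (gtr0_norm m0) ltr_pdivrMr// mulrC -ltr_pdivrMr//.
  by apply: truncnS_gt.
have hm1 : m%:R * `|h / m%:R| = `|h|.
  by rewrite -{1}(gtr0_norm m0) -normrM mh.
rewrite -{1}mh.
apply: le_trans (step _ (`|h / m%:R| * (C * snorm k.+1 x + e / (M * `|h| + 1))) _ _ _ _) _.
- by apply: (lvl_sub nE) => //; exact: (ts_lvl tsE).
- rewrite -[S _ x - x](subrK ((h / m%:R) *: D x)).
  apply: le_trans (snD nE _ _) _.
  + by apply: lvl_sub; [|apply: (lvl_sub nE) => //; exact: (ts_lvl tsE)|exact: (lvl_scale nE)].
  + exact: (lvl_scale nE).
  rewrite addrC mulrDr lerD//.
    by apply: le_trans (snZ nE _ Dx) _; rewrite ler_wpM2l// hC.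
  by rewrite [leRHS]mulrC hd.
- by rewrite hm1.
- rewrite [m%:R * _]mulrCA [m%:R * _]mulrA hm1 !mulrDr mulrCA lerD//.
    by rewrite le_eqVlt; apply/orP; left; apply/eqP; ring.
  rewrite [leLHS](_ : _ = e * (M * `|h|) / (M * `|h| + 1)); last by ring.
  by rewrite ler_pdivrMr// ler_wpM2l ?(ltW e0)// lerDl.
Qed.

(** The targets of the components of iterated tangent maps. A function [sh] on the
levels, and not only a shift, lets one constructor below produce [E] and all its
iterated shifts, whose levels are equal but not convertible. *)
Definition reindexed (sh : nat -> nat) : scale R :=
  @Scale R (scar E) (fun k => @level R E (sh k)) (fun k => @snorm R E (sh k)).

(** The smallest class that contains the translation map and, by [tm_tangent], the
tangent map of each of its members. *)
Inductive translation_map G : forall F, (scar G -> scar F) -> Prop :=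
| tm_leaf sh r tau (b : scar G -> scar E) :
    (forall k, sh k = k + r)%N -> rcoord tau -> vcoord r b ->
    translation_map (F := reindexed sh) (fun x => S (tau x) (b x))
| tm_add F (f g : scar G -> scar F) :
    translation_map f -> translation_map g ->
    translation_map (fun x => f x + g x)
| tm_scale F a (f : scar G -> scar F) : rcoord a -> translation_map f ->
    translation_map (fun x => a x *: f x)
| tm_pair F1 F2 (f1 : scar G -> scar F1) (f2 : scar G -> scar F2) :
    translation_map f1 -> translation_map f2 ->
    translation_map (F := scale_sum F1 F2) (fun x => (f1 x, f2 x)).

Lemma normed_reindexed sh r : (forall k, sh k = k + r)%N ->
  normed_scale (reindexed sh).
Proof.
move=> hsh; split => /=.
- by move=> k; apply: lvl0.
- by move=> k a x y; apply: lvlD.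
- by move=> k x; rewrite !hsh addSn; apply: lvlS.
- by move=> k x; apply: sn_ge0.
- by move=> k a x; apply: snZ.
- by move=> k x y; apply: snD.
- by move=> k; have [C C0 hC] := snS nE (k + r); exists C => // x; rewrite !hsh addSn; apply: hC.
Qed.

Lemma tm_normed G F (f : scar G -> scar F) : translation_map f -> normed_scale F.
Proof.
by elim=> {F f} //= [sh r tau b hsh _ _|F1 F2 _ _ _ ? _ ?];
  [exact: normed_reindexed hsh|exact: normed_sum].
Qed.

Lemma tm_level G F (f : scar G -> scar F) : translation_map f ->
  forall k x, level k x -> level k (f x).
Proof.
elim=> {F f} /=.
- by move=> sh r tau b hsh _ [_ bv _] k x hx /=; rewrite hsh; apply: (ts_lvl tsE); apply: bv.
- by move=> F f g hf IHf hg IHg k x hx; apply: lvl_add; [exact: tm_normed hf| |]; auto.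
- by move=> F a f ha hf IHf k x hx; apply: lvl_scale; [exact: tm_normed hf|]; auto.
- by move=> F1 F2 f1 f2 _ IH1 _ IH2 k x hx; split; auto.
Qed.

Lemma le_half (C a e : R) : 0 <= C -> 0 <= a -> a <= e / 2 / (C + 1) -> C * a <= e / 2.
Proof.
move=> C0 a0; rewrite ler_pdivlMr ?ltr_wpDl// => h; apply: le_trans h.
by rewrite mulrC ler_wpM2l// lerDl.
Qed.

Lemma tm_near G F (f : scar G -> scar F) : normed_scale G -> translation_map f ->
  forall k x, level k x -> forall e : R, 0 < e ->
    near0 k (fun h => snorm k (f (x + h) - f x) < e).
Proof.
move=> nG; elim=> {F f} /=.
- move=> sh r tau b hsh [taul taub] hb k x hx e e0 /=; rewrite hsh.
  have x0 := lvl_drop0 nG hx; case: (hb) => bl bv bn.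
  have bx := bv _ _ hx.
  have [Ct Ct0 hCt] := taub k; have [Cb Cb0 hCb] := bn k.
  have [M M0 hM] := ts_bd tsE (k + r) (`|tau x| + 1).
  have M1 : 0 < M + 1 by rewrite ltr_wpDl.
  have e1 : 0 < e / 2 / (M + 1) by rewrite !divr_gt0.
  have [d d0 hd] := ts_cont tsE bx e1.
  have := near0_and (near0_and (near0_small G k Ct0 d0)
    (near0_small G k Ct0 ltr01)) (near0_small G k Cb0 e1).
  apply: near0S => h hh [[h1 h2] h3].
  have th : `|tau h| < d by apply: le_lt_trans (hCt _ hh) h1.
  have th1 : `|tau h| < 1 by apply: le_lt_trans (hCt _ hh) h2.
  have bh := bv _ _ hh.
  have -> : S (tau (x + h)) (b (x + h)) - S (tau x) (b x) =
      S (tau x) (S (tau h) (b x) - b x) + S (tau (x + h)) (b h).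
    rewrite (vcoordD hb x0 (lvl_drop0 nG hh)) tsDr tsB -(ts_D tsE).
    by rewrite (rcoordD _ _ (conj taul taub)) addrAC.
  have l1 : level (k + r) (S (tau h) (b x) - b x).
    by apply: (lvl_sub nE) => //; exact: (ts_lvl tsE).
  apply: le_lt_trans (snD nE _ _) _; [exact: (ts_lvl tsE)|exact: (ts_lvl tsE)|].
  apply: (@le_lt_trans _ _ (M * snorm (k + r) (S (tau h) (b x) - b x) + M * snorm (k + r) (b h))).
    apply: lerD; apply: hM => //; first by rewrite lerDl.
    by rewrite (rcoordD _ _ (conj taul taub)); apply: le_trans (ler_normD _ _) _; rewrite lerD2l ltW.
  have small (u : R) : 0 <= u -> u < e / 2 / (M + 1) -> M * u < e / 2.
    move=> u0; rewrite ltr_pdivlMr// mulrDr mulr1 mulrC => H; apply: le_lt_trans H.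
    by rewrite lerDl.
  rewrite (splitr e); apply: ltrD; apply: small; rewrite ?(sn_ge0 nE) ?hd//.
  exact: le_lt_trans (hCb _ hh) h3.
- move=> F f g hf IHf hg IHg k x hx e e0; have nF := tm_normed hf.
  have e2 : 0 < e / 2 by rewrite divr_gt0.
  apply: near0S (near0_and (IHf _ _ hx _ e2) (IHg _ _ hx _ e2)) => h hh [h1 h2].
  have xh := lvl_add nG hx hh.
  rewrite opprD addrACA (splitr e); apply: le_lt_trans (snD nF _ _) (ltrD h1 h2);
    by apply: lvl_sub => //; apply: tm_level.
- move=> F a f ha hf IHf k x hx e e0; have nF := tm_normed hf.
  have [C C0 hC] := ha.2 k.
  have b0 : 0 < `|a x| + 1 by rewrite ltr_wpDl.
  have b1 : 0 < snorm k (f x) + 1 by rewrite ltr_wpDl// sn_ge0.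
  have e1 : 0 < e / 2 / (`|a x| + 1) by rewrite !divr_gt0.
  have e2 : 0 < e / 2 / (snorm k (f x) + 1) by rewrite !divr_gt0.
  have := near0_and (near0_and (IHf _ _ hx _ e1) (near0_small G k C0 ltr01))
    (near0_small G k C0 e2).
  apply: near0S => h hh [[h1 h2] h3].
  have xh := lvl_add nG hx hh.
  have fx := tm_level hf hx; have fxh := tm_level hf xh.
  have -> : a (x + h) *: f (x + h) - a x *: f x =
      a (x + h) *: (f (x + h) - f x) + a h *: f x.
    by rewrite scalerBr -addrA; congr (_ + _); rewrite (rcoordD _ _ ha) scalerDl opprD subrK.
  have l1 : level k (f (x + h) - f x) by apply: lvl_sub.
  apply: le_lt_trans (snD nF (lvl_scale nF _ l1) (lvl_scale nF _ fx)) _.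
  rewrite (splitr e); apply: ltrD.
    apply: le_lt_trans (snZ nF _ l1) _; rewrite ltr_pdivlMr// in h1.
    apply: le_lt_trans h1; rewrite mulrC ler_wpM2l ?(sn_ge0 nF)//.
    rewrite (rcoordD _ _ ha); apply: le_trans (ler_normD _ _) _; rewrite lerD2l.
    by apply: ltW; apply: le_lt_trans (hC _ hh) h2.
  apply: le_lt_trans (snZ nF _ fx) _; rewrite ltr_pdivlMr// in h3.
  apply: le_lt_trans h3; apply: ler_pM; rewrite ?(sn_ge0 nF) ?hC//.
  by rewrite lerDl.
- move=> F1 F2 f1 f2 _ IH1 _ IH2 k x hx e e0.
  apply: near0S (near0_and (IH1 _ _ hx _ e0) (IH2 _ _ hx _ e0)) => h hh [h1 h2] /=.
  by rewrite gt_max h1.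
Qed.

Lemma vcoord_gen G r (b : scar G -> scar E) : normed_scale G ->
  vcoord r.+1 b -> vcoord r (fun x => D (b x)).
Proof.
move=> nG [bl bv bn]; split => [c x y x0 y0|k x hx|k].
- have lev1 z : level 0 z -> level 1 (b z).
    move=> /bv; rewrite add0n; elim: (r) => // n IH /(lvlS nE); exact: IH.
  by rewrite bl// (gen_lin tsE) //; exact: lev1.
- by apply: (gen_lvl tsE); rewrite -addnS; exact: bv.
- have [C C0 hC] := bn k; have [C' C'0 hC'] := gen_bd tsE (k + r).
  exists (C' * C) => [|x hx]; first exact: mulr_ge0.
  have bx := bv _ _ hx; have bn' := hC _ hx; rewrite addnS in bx bn'.
  by apply: le_trans (hC' _ bx) _; rewrite -mulrA ler_wpM2l.
Qed.

Definition differentiable_with G F (f : scar G -> scar F)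
    (Df : scar G -> scar G -> scar F) : Prop :=
  forall x, level 1 x -> bounded_linear0 (Df x) /\
    forall e : R, 0 < e -> near0 1 (fun h =>
      snorm 0 (f (x + h) - f x - Df x h) <= e * snorm 1 h).

(** By the group law the remainder at an increment [h] is [S (tau x)] applied to
the generator remainder of [b x] at time [tau h], plus [S (tau h) (b h) - b h]. The
last term is quadratic in [h] by the Lipschitz bound, since [b h] has a level to
spare. *)
Lemma tm_leaf_diff G sh r tau (b : scar G -> scar E) : normed_scale G ->
  (forall k, sh k = k + r)%N -> rcoord tau -> vcoord r b ->
  differentiable_with (F := reindexed sh) (fun x => S (tau x) (b x))
    (fun x h => S (tau x) (b h) + tau h *: S (tau x) (D (b x))).
Proof.
move=> nG hsh htau hb x hx; have nF := normed_reindexed hsh.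
have [taul taub] := htau; have [bl bv bn] := hb.
have x0 := lvl_drop0 nG hx; have bx := bv _ _ hx; rewrite add1n in bx.
have Dbx := gen_lvl tsE bx.
have [Ct Ct0 hCt] := taub 0; have [Ct' Ct'0 hCt'] := taub 1.
have [Cb Cb0 hCb] := bn 0; have [Cb' Cb'0 hCb'] := bn 1.
rewrite add1n in hCb'; rewrite add0n in hCb.
have [M M0 hM] := ts_bd tsE r `|tau x|.
have lvb h : level 0 h -> level r (b h) by move=> /bv.
split.
  split => [h hh|a h h' hh hh'|].
  - rewrite /= hsh add0n; apply: (lvl_add nE); first exact/(ts_lvl tsE)/lvb.
    exact/(lvl_scale nE)/(ts_lvl tsE).
  - by rewrite bl// (ts_lin tsE) taul scalerDr scalerDl scalerA addrACA.
  - pose N := snorm r (S (tau x) (D (b x))).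
    exists (M * Cb + Ct * N) => h hh; rewrite /= hsh add0n.
    have bh := lvb _ hh.
    apply: le_trans (snD nE _ _) _; [exact: (ts_lvl tsE)| |].
      by apply/(lvl_scale nE)/(ts_lvl tsE).
    rewrite mulrDl; apply: lerD.
      apply: le_trans (hM _ _ (lexx _) bh) _.
      by rewrite -mulrA ler_wpM2l// hCb.
    apply: le_trans (snZ nE _ (ts_lvl tsE _ Dbx)) _.
    by rewrite mulrAC; apply: ler_wpM2r; [exact: sn_ge0 nE _ _|exact: hCt].
move=> e e0; have [L L0 hL] := ts_lip r.
have MCt : 0 <= M * Ct' by exact: mulr_ge0.
have p1 : 0 < M * Ct' + 1 by rewrite ltr_wpDl.
have e1 : 0 < e / 2 / (M * Ct' + 1) by rewrite !divr_gt0.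
have [d d0 hd] := ts_gen2 bx e1.
have := near0_and (near0_and (near0_small G 1 Ct'0 d0)
    (near0_small G 1 Ct'0 ltr01))
    (near0_small G 1 (mulr_ge0 (mulr_ge0 M0 L0) (mulr_ge0 Ct'0 Cb'0)) (divr_gt0 e0 (ltr0Sn R 1))).
apply: near0S => h hh [[h1 h2] h3]; rewrite /= hsh add0n.
have h0 := lvl_drop0 nG hh; have bh := lvb _ h0.
have bh1 := bv _ _ hh; rewrite add1n in bh1.
have nh : 0 <= snorm 1 h := sn_ge0 nG 1 h.
have th := hCt' _ hh.
have thd : `|tau h| < d by exact: le_lt_trans th h1.
have th1 : `|tau h| <= 1 by exact: ltW (le_lt_trans th h2).
have -> : S (tau (x + h)) (b (x + h)) - S (tau x) (b x) -
    (S (tau x) (b h) + tau h *: S (tau x) (D (b x))) =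
  S (tau x) (S (tau h) (b x) - b x - tau h *: D (b x)) +
  S (tau x) (S (tau h) (b h) - b h).
  rewrite (vcoordD hb x0 h0) (rcoordD _ _ htau) !tsB tsDr -!(ts_D tsE) tsZ.
  exact: subr_regroup.
have l1 : level r (S (tau h) (b x) - b x - tau h *: D (b x)).
  apply: (lvl_sub nE); last exact: (lvl_scale nE).
  apply: (lvl_sub nE); [apply: (ts_lvl tsE)|]; exact: (lvlS nE).
have l2 : level r (S (tau h) (b h) - b h).
  by apply: (lvl_sub nE) => //; exact: (ts_lvl tsE).
apply: le_trans (snD nE (ts_lvl tsE _ l1) (ts_lvl tsE _ l2)) _.
rewrite (splitr e) mulrDl; apply: lerD.
  apply: le_trans (hM _ _ (lexx _) l1) _.
  apply: le_trans (ler_wpM2l M0 (hd _ thd)) _.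
  apply: (@le_trans _ _ (M * (e / 2 / (M * Ct' + 1) * (Ct' * snorm 1 h)))).
    by do 2 (apply: ler_wpM2l; rewrite ?(ltW e1)//).
  rewrite [leLHS](_ : _ = (M * Ct' * (e / 2 / (M * Ct' + 1))) * snorm 1 h); last by ring.
  by apply: ler_wpM2r => //; apply: le_half => //; exact: ltW.
apply: le_trans (hM _ _ (lexx _) l2) _.
apply: le_trans (ler_wpM2l M0 (hL _ _ th1 bh1)) _.
apply: (@le_trans _ _ (M * (L * (Ct' * snorm 1 h) * (Cb' * snorm 1 h)))).
  apply: ler_wpM2l => //; apply: ler_pM => //.
  - exact: mulr_ge0.
  - exact: sn_ge0 nE _ _.
  - exact: ler_wpM2l.
  - exact: hCb'.
rewrite [leLHS](_ : _ = (M * L * (Ct' * Cb') * snorm 1 h) * snorm 1 h); last by ring.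
by apply: ler_wpM2r => //; exact: ltW.
Qed.

Lemma tm_fst G F (f : scar G -> scar F) : normed_scale G -> translation_map f ->
  translation_map (fun xh : scar (tangent G) => f xh.1).
Proof.
move=> nG; elim=> {F f} /=.
- move=> sh r tau b hsh htau hb.
  apply: (tm_leaf hsh (rcoord_fst htau)); have [bl bv bn] := vcoord_fst nG hb.
  split=> // [k x /bv|k]; first by rewrite addnS => /(lvlS nE).
  have [C C0 hC] := bn k; have [C' C'0 hC'] := snS nE (k + r).
  exists (C' * C) => [|x hx]; first exact: mulr_ge0.
  have bx := bv _ _ hx; have bn' := hC _ hx; rewrite addnS in bx bn'.
  by apply: le_trans (hC' _ bx) _; rewrite -mulrA ler_wpM2l.
- by move=> F f g _ IHf _ IHg; exact: tm_add.
- by move=> F a f ha _ IHf; exact: (tm_scale (rcoord_fst ha)).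
- by move=> F1 F2 f1 f2 _ IH1 _ IH2; exact: tm_pair.
Qed.

(** The class of maps is closed under differentiation. The tangent map of a
product or of a translated coordinate again consists of such expressions, over
the coordinates of the tangent space; the generator costs one level, and this
level is provided by the base point of the tangent vector. *)
Lemma tm_tangent G F (f : scar G -> scar F) : normed_scale G ->
  translation_map f -> exists Df : scar G -> scar G -> scar F,
  [/\ differentiable_with f Df,
      translation_map (fun xh : scar (tangent G) => Df xh.1 xh.2) &
      translation_map (F := scale_shift 1 F) (fun xh : scar (tangent G) => f xh.1)].
Proof.
move=> nG; elim=> {F f} /=.
- move=> sh r tau b hsh htau hb.
  exists (fun x h => S (tau x) (b h) + tau h *: S (tau x) (D (b x))); split.
  + exact: tm_leaf_diff.
  + apply: tm_add; last apply: (tm_scale (rcoord_snd htau)).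
      exact: (tm_leaf hsh (rcoord_fst htau) (vcoord_snd hb)).
    apply: (tm_leaf hsh (rcoord_fst htau)); apply: vcoord_gen (vcoord_fst nG hb).
    exact/normed_sum/nG/normed_shift.
  + have hsh1 k : sh (k + 1)%N = (k + r.+1)%N by rewrite hsh addn1 addSnnS.
    exact: (tm_leaf hsh1 (rcoord_fst htau) (vcoord_fst nG hb)).
- move=> F f g hf [Df [Df1 Df2 Df3]] hg [Dg [Dg1 Dg2 Dg3]].
  have nF := tm_normed hf.
  exists (fun x h => Df x h + Dg x h); split.
  + move=> x hx; have [[Df1v Df1l [C hC]] Df1f] := Df1 _ hx.
    have [[Dg1v Dg1l [C' hC']] Dg1f] := Dg1 _ hx; split.
      split => [h hh|a h h' hh hh'|].
      * by apply: (lvl_add nF); [exact: Df1v|exact: Dg1v].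
      * by rewrite Df1l// Dg1l// scalerDr addrACA.
      * exists (C + C') => h hh; rewrite mulrDl.
        apply: le_trans (snD nF _ _) _; [exact: Df1v|exact: Dg1v|].
        by apply: lerD; [exact: hC|exact: hC'].
    move=> e e0; have e2 : 0 < e / 2 by rewrite divr_gt0.
    apply: near0S (near0_and (Df1f _ e2) (Dg1f _ e2)) => h hh [h1 h2].
    have h0 := lvl_drop0 nG hh; have x0 := lvl_drop0 nG hx.
    have xh0 := lvl_add nG x0 h0.
    rewrite addr_regroup (splitr e) mulrDl; apply: le_trans (snD nF _ _) (lerD h1 h2).
    * by apply: (lvl_sub nF); [apply: (lvl_sub nF); exact: tm_level|exact: Df1v].
    * by apply: (lvl_sub nF); [apply: (lvl_sub nF); exact: tm_level|exact: Dg1v].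
  + exact: tm_add.
  + exact: (tm_add (F := scale_shift 1 F)).
- move=> F a f ha hf [Df [Df1 Df2 Df3]]; have nF := tm_normed hf.
  exists (fun x h => a x *: Df x h + a h *: f x); split.
  + move=> x hx; have [[Dfv Dfl [C hC]] Dff] := Df1 _ hx.
    have h1x := tm_level hf hx; have x0 := lvl_drop0 nG hx; have fx := tm_level hf x0.
    split.
      split => [h hh|c h h' hh hh'|].
      * by apply: (lvl_add nF); apply: (lvl_scale nF) => //; exact: Dfv.
      * by rewrite Dfl// ha.1 !scalerDr scalerDl addrACA !scalerA [c * a x]mulrC.
      * have [Ca Ca0 hCa] := ha.2 0.
        exists (`|a x| * C + Ca * snorm 0 (f x)) => h hh; rewrite mulrDl.
        apply: le_trans (snD nF _ _) _; [apply/(lvl_scale nF)/Dfv => //|exact: (lvl_scale nF)|].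
        apply: lerD.
          apply: le_trans (snZ nF _ (Dfv _ hh)) _.
          by rewrite -mulrA ler_wpM2l// hC.
        apply: le_trans (snZ nF _ fx) _.
        by rewrite mulrAC ler_wpM2r ?(sn_ge0 nF)// hCa.
    move=> e e0; have [Ca Ca0 hCa] := ha.2 1; have [K K0 hK] := snS nF 0.
    have p1 : 0 < `|a x| + 1 by rewrite ltr_wpDl.
    have p2 : 0 < Ca * K + 1 by rewrite ltr_wpDl// mulr_ge0.
    have e1 : 0 < e / 2 / (`|a x| + 1) by rewrite !divr_gt0.
    have e2 : 0 < e / 2 / (Ca * K + 1) by rewrite !divr_gt0.
    apply: near0S (near0_and (Dff _ e1) (tm_near nG hf hx e2)) => h hh [h1 h2].
    have nh : 0 <= snorm 1 h := sn_ge0 nG 1 h.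
    have h0 := lvl_drop0 nG hh; have xh := lvl_add nG hx hh.
    have xh0 := lvl_add nG x0 h0; have fxh := tm_level hf xh.
    have -> : a (x + h) *: f (x + h) - a x *: f x - (a x *: Df x h + a h *: f x) =
        a x *: (f (x + h) - f x - Df x h) + a h *: (f (x + h) - f x).
      by rewrite (rcoordD _ _ ha) scalerDl !scalerBr [_ *: Df x h + _]addrC subr_regroup.
    have l1 : level 0 (f (x + h) - f x - Df x h).
      by apply: (lvl_sub nF); [apply: (lvl_sub nF); exact: tm_level|exact: Dfv].
    have l2 : level 1 (f (x + h) - f x) by exact: (lvl_sub nF).
    have l2' := lvl_drop0 nF l2.
    apply: le_trans (snD nF (lvl_scale nF _ l1) (lvl_scale nF _ l2')) _.
    rewrite (splitr e) mulrDl; apply: lerD.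
      apply: le_trans (snZ nF _ l1) _.
      apply: le_trans (ler_wpM2l (normr_ge0 _) h1) _.
      by rewrite mulrA ler_wpM2r//; apply: le_half => //; exact: ltW.
    apply: le_trans (snZ nF _ l2') _.
    apply: (@le_trans _ _ ((Ca * snorm 1 h) * (K * (e / 2 / (Ca * K + 1))))).
      apply: ler_pM => //; [exact: sn_ge0 nF _ _|exact: hCa|].
      by apply: le_trans (hK _ l2) _; rewrite ler_wpM2l// ltW.
    rewrite [leLHS](_ : _ = (Ca * K * (e / 2 / (Ca * K + 1))) * snorm 1 h); last by ring.
    by rewrite ler_wpM2r//; apply: le_half => //; [exact: mulr_ge0|exact: ltW].
  + apply: tm_add; first exact: (tm_scale (rcoord_fst ha)).
    by apply: (tm_scale (rcoord_snd ha)); exact: tm_fst.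
  + exact: (tm_scale (F := scale_shift 1 F) (rcoord_fst ha)).
- move=> F1 F2 f1 f2 hf1 [D1 [D11 D12 D13]] hf2 [D2 [D21 D22 D23]].
  exists (fun x h => (D1 x h, D2 x h)); split.
  + move=> x hx; have [[D1v D1l [C hC]] D1f] := D11 _ hx.
    have [[D2v D2l [C' hC']] D2f] := D21 _ hx; split.
      split => [h hh|a h h' hh hh'|].
      * by split; [exact: D1v|exact: D2v].
      * by rewrite D1l// D2l.
      * exists (Num.max C C') => h hh /=; rewrite ge_max; apply/andP; split.
          apply: le_trans (hC _ hh) _.
          by rewrite ler_wpM2r ?(sn_ge0 nG)// le_max lexx.
        apply: le_trans (hC' _ hh) _.
        by rewrite ler_wpM2r ?(sn_ge0 nG)// le_max lexx orbT.
    move=> e e0; apply: near0S (near0_and (D1f _ e0) (D2f _ e0)) => h hh [h1 h2] /=.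
    by rewrite ge_max h1.
  + exact: tm_pair.
  + exact: (tm_pair (F1 := scale_shift 1 F1) (F2 := scale_shift 1 F2)).
Qed.

Theorem tm_scm m G F (U : set (scar G)) (f : scar G -> scar F) :
  normed_scale G -> translation_map f -> scm m U f.
Proof.
have sc0_tm G' F' (V : set (scar G')) (g : scar G' -> scar F') :
    normed_scale G' -> translation_map g -> sc0 V g.
  move=> nG hg k; split=> [x _|x _ hx e e0]; first exact: tm_level.
  have [d d0 hd] := tm_near nG hg hx e0; exists d => // y _ hy hyx.
  rewrite -[y](subrK x) [_ - x + x]addrC; apply: hd => //; exact: (lvl_sub nG).
elim: m G F U f => [|m IH] G F U f nG hf /=; first exact: sc0_tm.
split; first exact: sc0_tm.
have [Df [hDf tD tf]] := tm_tangent nG hf; exists Df; split.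
  move=> x _ hx; have [Df1 Df2] := hDf _ hx; split => // e e0.
  by have [d d0 hd] := Df2 _ e0; exists d => // h hh _ hn; exact: hd.
apply: IH; first exact/normed_sum/nG/normed_shift.
exact: (tm_pair tf tD).
Qed.

(** The translation map itself is the simplest of these maps: the group element
and the vector are the two coordinates of its argument. *)
Theorem translation_sc_smooth (U : set (scar (scale_sum (scale_const R) E))) :
  sc_smooth (E := scale_sum (scale_const R) E) (F := reindexed id) U
    (fun x => S x.1 x.2).
Proof.
move=> m; apply: tm_scm; first exact (normed_sum (normed_const R) nE).
apply: (tm_leaf (G := scale_sum (scale_const R) E) (sh := id) (r := 0%N)
  (tau := fun x => x.1) (b := fun x => x.2)).
- by move=> k; rewrite addn0.
- split=> // k; exists 1 => // x _; rewrite mul1r; by rewrite le_max lexx.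
- split=> //.
  + by move=> k x [_]; rewrite addn0.
  + by move=> k; exists 1 => // x _; rewrite mul1r addn0 le_max lexx orbT.
Qed.

End translation_smooth.

(** * Integrals of arbitrary functions over the line *)

#[local] Existing Instances lebesgue_ae_filter lebesgue_ae_nbhs_filter.

Section integral_ae.
Context (R : realType).
Local Notation mu := (@lebesgue_measure R).
Local Open Scope ereal_scope.
Import HBNNSimple.

(** The integral of a nonnegative function is a supremum over the simple
functions below it; cutting these simple functions off on a null set shows that
it is monotone without any measurability. *)
Lemma le_integral_ae (f g : R -> \bar R) :
  (forall t, 0 <= f t) -> (forall t, 0 <= g t) ->
  {ae mu, forall t, f t <= g t} -> \int[mu]_t f t <= \int[mu]_t g t.
Proof.
move=> f0 g0 [N [mN N0 fgN]]; rewrite !ge0_integralTE//.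
apply: ge_ereal_sup => _ /= [h hf <-].
have mNC : measurable (~` N) by exact: measurableC.
rewrite -(@integralT_nnsfun _ _ _ mu h).
have -> : \int[mu]_x (h x)%:E = \int[mu]_x (proj_nnsfun h mNC x)%:E.
  apply: ge0_ae_eq_integral => //.
  - by apply/measurable_EFinP.
  - by apply/measurable_EFinP.
  - by move=> x _; rewrite lee_fin.
  - by move=> x _; rewrite lee_fin.
  - exists N; split => // x /= xN; apply: contrapT => nN; apply: xN => _.
    by rewrite /= mindicE mem_set //= mulr1.
rewrite integralT_nnsfun; apply: ereal_sup_ubound => /=.
exists (proj_nnsfun h mNC) => // x.
rewrite /= mindicE; have [xN|xN] := pselect (N x).
  by rewrite memNset ?mulr0//=; apply.
rewrite mem_set//= mulr1 (le_trans (hf x))//; apply: contrapT => fg.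
by apply: xN; apply: fgN.
Qed.

Lemma integral_ae (f g : R -> \bar R) :
  {ae mu, forall t, f t = g t} -> \int[mu]_t f t = \int[mu]_t g t.
Proof.
have ge0 (f1 g1 : R -> \bar R) : (forall t, 0 <= f1 t) -> (forall t, 0 <= g1 t) ->
    {ae mu, forall t, f1 t = g1 t} -> \int[mu]_t f1 t = \int[mu]_t g1 t.
  move=> f0 g0 fg; apply/eqP; rewrite eq_le.
  by rewrite !le_integral_ae//; apply: filterS fg => t ->.
move=> fg; rewrite integralE [RHS]integralE; congr (_ - _); apply: ge0 => //;
  by apply: filterS fg => t fgt; rewrite ?funeposE ?funenegE fgt.
Qed.

Lemma Rintegral_ae (f g : R -> R) :
  {ae mu, forall t, f t = g t} -> (\int[mu]_t f t = \int[mu]_t g t)%R.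
Proof.
by move=> fg; congr fine; apply: integral_ae; apply: filterS fg => t ->.
Qed.

End integral_ae.

Section translation.
Context (R : realType).
Local Notation mu := (@lebesgue_measure R).
Local Open Scope ereal_scope.
Import HBNNSimple.

Lemma measurable_shift (tau : R) :
  measurable_fun setT (fun t : measurableTypeR R => (t + tau)%R : measurableTypeR R).
Proof. exact: measurable_funD. Qed.

Lemma lebesgue_measure_shift (tau : R) (A : set R) : measurable A ->
  mu ((fun t : R => t + tau)%R @^-1` A) = mu A.
Proof.
pose T : measurableTypeR R -> measurableTypeR R := fun t => (t + tau)%R.
have mT : measurable_fun setT T := @measurable_shift tau.
move=> mA; apply/esym.
rewrite -[RHS]/(pushforward mu T A).
pose HT := isMeasurableFun.Build _ _ _ _ T mT.
pose T' : {mfun measurableTypeR R >-> measurableTypeR R} := HB.pack T HT.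
apply: (@lebesgue_measure_unique R (pushforward mu T')) mA => _ [[a b]] _ <-.
rewrite /pushforward /= [X in _ = lebesgue_stieltjes_measure _ X](_ : _ = `](a - tau)%R, (b - tau)%R]%classic); last first.
  by apply/seteqP; split => x; rewrite /T /= !in_itv /= ltrBlDr lerBrDr.
rewrite -[RHS]/(mu _) !lebesgue_measure_itv/= !lte_fin ltrD2r.
by case: ifP => // _; rewrite -!EFinD; congr EFin; lra.
Qed.

Lemma ae_shift (tau : R) (P : R -> Prop) :
  {ae mu, forall t, P t} -> {ae mu, forall t, P (t + tau)%R}.
Proof.
move=> [N [mN N0 PN]]; exists ((fun t : R => t + tau)%R @^-1` N); split.
- by rewrite -[X in measurable X]setTI; exact: measurable_shift.
- by rewrite /= lebesgue_measure_shift.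
- by move=> t /= nP; apply: PN.
Qed.

Lemma ge0_integral_shift_meas (tau : R) (f : R -> \bar R) :
  measurable_fun setT f -> (forall t, 0 <= f t) ->
  \int[mu]_t f (t + tau)%R = \int[mu]_t f t.
Proof.
move=> mf f0.
pose T : measurableTypeR R -> measurableTypeR R := fun t => (t + tau)%R.
have mT : measurable_fun setT T := @measurable_shift tau.
rewrite -[LHS]/(\int[mu]_(t in T @^-1` setT) (f \o T) t).
rewrite -(ge0_integral_pushforward mT)//.
by apply: eq_measure_integral => A mA _; exact: lebesgue_measure_shift.
Qed.

(** The simple functions below [f] are measurable, so that the change of variables
applies to them even if [f] is not. *)
Lemma ge0_integral_shift (tau : R) (f : R -> \bar R) : (forall t, 0 <= f t) ->
  \int[mu]_t f (t + tau)%R = \int[mu]_t f t.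
Proof.
have le (s : R) (g : R -> \bar R) : (forall t, 0 <= g t) ->
    \int[mu]_t g t <= \int[mu]_t g (t + s)%R.
  move=> g0; rewrite [leLHS]ge0_integralTE//.
  apply: ge_ereal_sup => _ /= [h hg <-].
  have mh : measurable_fun setT (EFin \o h) by exact/measurable_EFinP.
  have h0 t : 0 <= (h t)%:E by rewrite lee_fin.
  rewrite -integralT_nnsfun -(ge0_integral_shift_meas s mh h0).
  apply: le_integral_ae => //.
  - by move=> t; exact: h0.
  - by apply: aeW => t; exact: hg.
move=> f0; apply/eqP; rewrite eq_le le// andbT.
rewrite (le_trans (le (- tau)%R _ _))//.
by under eq_integral do rewrite subrK.
Qed.

Lemma integral_shift (tau : R) (f : R -> \bar R) :
  \int[mu]_t f (t + tau)%R = \int[mu]_t f t.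
Proof.
have hp := ge0_integral_shift tau (funepos_ge0 f).
have hn := ge0_integral_shift tau (funeneg_ge0 f).
rewrite integralE [RHS]integralE -hp -hn.
by congr (_ - _); apply: eq_integral => t _; rewrite ?funeposE ?funenegE.
Qed.

Lemma Rintegral_shift (tau : R) (f : R -> R) :
  (\int[mu]_t f (t + tau) = \int[mu]_t f t)%R.
Proof. by rewrite /Rintegral (integral_shift tau (EFin \o f)). Qed.

End translation.

(** * Hilbert spaces given by weighted coordinates *)

(** Both Euclidean space and the weighted sequence spaces are spaces of real
sequences with a weighted sum of squares as squared norm. The vectors [e nu] are
the unit vectors; they vanish beyond the dimension in the Euclidean case. *)
Record coord_hilb (R : realType) (X : lmodType R) (H : hilb X)
    (c : nat -> X -> R) (wt : nat -> R) (e : nat -> X) : Prop := CoordHilb {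
  ch_lin : forall nu a x y, c nu (a *: x + y) = a * c nu x + c nu y;
  ch_inj : forall x y, (forall nu, c nu x = c nu y) -> x = y;
  ch_wt : forall nu, 0 < wt nu;
  ch_e0 : forall nu m, m != nu -> c m (e nu) = 0;
  ch_e1 : forall nu x, c nu (e nu) * c nu x = c nu x;
  ch_set : forall x, hset H x <-> cvgn (series (fun nu => wt nu * c nu x ^+ 2));
  ch_ip : forall x y, hset H x -> hset H y ->
    hip H x y = limn (series (fun nu => wt nu * c nu x * c nu y)) }.

Section hilb_theory.
Context (R : realType) (X : lmodType R) (H : hilb X).
Context (c : nat -> X -> R) (wt : nat -> R) (e : nat -> X).
Hypothesis cH : coord_hilb H c wt e.
Implicit Types (x y z : X) (a : R).

Lemma coord0 nu : c nu 0 = 0.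
Proof. by have := ch_lin cH nu (-1) 0 0; rewrite scaler0 addr0 mulN1r addNr. Qed.

Lemma coordD nu x y : c nu (x + y) = c nu x + c nu y.
Proof. by rewrite -[x]scale1r (ch_lin cH) mul1r scale1r. Qed.

Lemma coordZ nu a x : c nu (a *: x) = a * c nu x.
Proof. by rewrite -[a *: x]addr0 (ch_lin cH) coord0 addr0. Qed.

Lemma coordN nu x : c nu (- x) = - c nu x.
Proof. by rewrite -scaleN1r coordZ mulN1r. Qed.

Lemma coordB nu x y : c nu (x - y) = c nu x - c nu y.
Proof. by rewrite coordD coordN. Qed.

Lemma coord_sum nu I (s : seq I) (F : I -> X) :
  c nu (\sum_(i <- s) F i) = \sum_(i <- s) c nu (F i).
Proof. by elim: s => [|i s IH]; rewrite ?big_nil ?coord0// !big_cons coordD IH. Qed.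

Definition psum x y (N : nat) : R := \sum_(0 <= nu < N) wt nu * c nu x * c nu y.

Let sqE x : (fun nu => wt nu * c nu x ^+ 2) = (fun nu => wt nu * c nu x * c nu x).
Proof. by apply/funext => nu; rewrite expr2 mulrA. Qed.

Lemma psum_ge0 x N : 0 <= psum x x N.
Proof. by apply: sumr_ge0 => nu _; rewrite -mulrA -expr2 mulr_ge0 ?sqr_ge0// ltW// (ch_wt cH). Qed.

Lemma psum_nd x : nondecreasing_seq (psum x x).
Proof.
apply/nondecreasing_seqP => N; rewrite /psum big_nat_recr//= lerDl.
by rewrite -mulrA -expr2 mulr_ge0 ?sqr_ge0// ltW// (ch_wt cH).
Qed.

Lemma psumDl x y z N : psum (x + y) z N = psum x z N + psum y z N.
Proof. by rewrite /psum -big_split; apply: eq_bigr => i _ /=; rewrite coordD; ring. Qed.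

Lemma psumZl a x z N : psum (a *: x) z N = a * psum x z N.
Proof. by rewrite /psum big_distrr; apply: eq_bigr => i _ /=; rewrite coordZ; ring. Qed.

Lemma psumC x y N : psum x y N = psum y x N.
Proof. by apply: eq_bigr => i _; ring. Qed.

Lemma hsetP x : hset H x <-> exists M, forall N, psum x x N <= M.
Proof.
rewrite (ch_set cH) sqE; split=> [cx|[M hM]].
  exists (limn (psum x x)) => N; apply: nondecreasing_cvgn_le => //.
  exact: psum_nd.
by apply: nondecreasing_is_cvgn; [exact: psum_nd|exists M => _ [N _ <-]; exact: hM].
Qed.

Lemma hset0 : hset H 0.
Proof.
by apply/hsetP; exists 0 => N; rewrite /psum big1// => i _; rewrite coord0 mulr0.
Qed.

Lemma hsetZ a x : hset H x -> hset H (a *: x).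
Proof.
move=> /hsetP [M hM]; apply/hsetP; exists (a ^+ 2 * M) => N.
by rewrite psumZl psumC psumZl mulrA -expr2 ler_wpM2l// sqr_ge0.
Qed.

Lemma psum_parallelogram x y N :
  psum (x + y) (x + y) N + psum (x - y) (x - y) N = 2 * psum x x N + 2 * psum y y N.
Proof.
rewrite -scaleN1r !psumDl !psumZl ![psum _ (_ + _) N]psumC !psumDl !psumZl.
by rewrite [psum y x N]psumC; ring.
Qed.

Lemma hsetD x y : hset H x -> hset H y -> hset H (x + y).
Proof.
move=> /hsetP [M hM] /hsetP [M' hM']; apply/hsetP; exists (2 * M + 2 * M') => N.
apply: (@le_trans _ _ (2 * psum x x N + 2 * psum y y N)); last first.
  by rewrite lerD// ler_wpM2l.
by rewrite -psum_parallelogram lerDl psum_ge0.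
Qed.

Lemma hsetB x y : hset H x -> hset H y -> hset H (x - y).
Proof. by move=> hx hy; apply: hsetD => //; rewrite -scaleN1r; exact: hsetZ. Qed.

Lemma hset_sum I (s : seq I) (F : I -> X) :
  (forall i, hset H (F i)) -> hset H (\sum_(i <- s) F i).
Proof.
move=> hF; elim: s => [|i s IH]; first by rewrite big_nil; exact: hset0.
by rewrite big_cons; exact: hsetD.
Qed.

Lemma cvg_psum_sq x : hset H x -> psum x x @ \oo --> hip H x x.
Proof. by move=> hx; rewrite (ch_ip cH)//; move/(ch_set cH): hx; rewrite sqE. Qed.

Lemma cvg_psum x y : hset H x -> hset H y -> psum x y @ \oo --> hip H x y.
Proof.
move=> hx hy.
have hD := cvg_psum_sq (hsetD hx hy); have hB := cvg_psum_sq (hsetB hx hy).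
suff : cvgn (psum x y) by rewrite (ch_ip cH).
have -> : psum x y = (fun N => 4^-1 * (psum (x + y) (x + y) N - psum (x - y) (x - y) N)).
  apply/funext => N; rewrite -scaleN1r !psumDl !psumZl ![psum _ (_ + _) N]psumC !psumDl !psumZl.
  by rewrite [psum y x N]psumC; field.
by apply: is_cvgM; [exact: is_cvg_cst|apply: is_cvgB; apply: cvgP; [exact: hD|exact: hB]].
Qed.

Lemma hip_ge0 x : hset H x -> 0 <= hip H x x.
Proof.
move=> hx; have h := cvg_psum_sq hx; rewrite -(cvg_lim _ h)//.
by apply: limr_ge; [exact: cvgP h|apply: nearW => N; exact: psum_ge0].
Qed.

Lemma hnorm_ge0 x : 0 <= hnorm H x. Proof. exact: sqrtr_ge0. Qed.

Lemma hnorm_sq x : hset H x -> hnorm H x ^+ 2 = hip H x x.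
Proof. by move=> hx; rewrite sqr_sqrtr// hip_ge0. Qed.

Lemma psum_le x N : hset H x -> psum x x N <= hnorm H x ^+ 2.
Proof.
move=> hx; rewrite hnorm_sq//; have h := cvg_psum_sq hx; rewrite -(cvg_lim _ h)//.
by apply: nondecreasing_cvgn_le; [exact: psum_nd|exact: cvgP h].
Qed.

Lemma hnorm_le x M : hset H x -> 0 <= M -> (forall N, psum x x N <= M ^+ 2) ->
  hnorm H x <= M.
Proof.
move=> hx M0 hM; rewrite -(ler_pXn2r (n := 2))// ?nnegrE ?hnorm_ge0// hnorm_sq//.
have h := cvg_psum_sq hx; rewrite -(cvg_lim _ h)//.
by apply: limr_le; [exact: cvgP h|apply: nearW => N; exact: hM].
Qed.

Lemma psum_CS x y N : psum x y N ^+ 2 <= psum x x N * psum y y N.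
Proof.
set A := psum x x N; set B := psum y y N; set b := psum x y N.
have A0 : 0 <= A := psum_ge0 x N.
have key (s r : R) : 0 <= s ^+ 2 * A + 2 * s * r * b + r ^+ 2 * B.
  have := psum_ge0 (s *: x + r *: y) N.
  rewrite psumDl !psumZl ![psum _ (_ + _) N]psumC !psumDl !psumZl.
  by rewrite [psum y x N]psumC -/A -/B -/b => h; apply: le_trans h _; lra.
have [A1|A1] := eqVneq A 0.
  have b0 : b = 0.
    have [->//|bn] := eqVneq b 0.
    have := key (- (B + 1) / (2 * b)) 1; rewrite A1 mulr0 add0r mulr1 expr1n mul1r.
    rewrite (_ : 2 * (- (B + 1) / (2 * b)) * b = - (B + 1)); last by field.
    by lra.
  by rewrite b0 expr0n /= A1 mul0r.
have Ap : 0 < A by rewrite lt_neqAle eq_sym A1.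
have := key (- b) A; rewrite sqrrN.
rewrite (_ : _ + _ = A * (A * B - b ^+ 2)); last by ring.
by rewrite pmulr_rge0// subr_ge0.
Qed.

Lemma psum_CS_hnorm x y N : hset H x -> hset H y ->
  `|psum x y N| <= hnorm H x * hnorm H y.
Proof.
move=> hx hy; rewrite -(ler_pXn2r (n := 2))// ?nnegrE ?mulr_ge0 ?hnorm_ge0//.
rewrite real_normK ?num_real// exprMn; apply: le_trans (psum_CS _ _ _) _.
by apply: ler_pM; rewrite ?psum_ge0 ?psum_le.
Qed.

Lemma hip_CS x y : hset H x -> hset H y -> `|hip H x y| <= hnorm H x * hnorm H y.
Proof.
move=> hx hy.
have h : `|psum x y N| @[N --> \oo] --> `|hip H x y|.
  by apply: cvg_norm; exact: cvg_psum.
rewrite -(cvg_lim _ h)//.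
by apply: limr_le; [exact: cvgP h|apply: nearW => N; exact: psum_CS_hnorm].
Qed.

Lemma hipC x y : hset H x -> hset H y -> hip H x y = hip H y x.
Proof.
move=> hx hy; rewrite !(ch_ip cH)//; congr (limn _); apply/funext => N.
exact: psumC.
Qed.

Lemma hipDl x y z : hset H x -> hset H y -> hset H z ->
  hip H (x + y) z = hip H x z + hip H y z.
Proof.
move=> hx hy hz; apply: cvg_unique (cvg_psum (hsetD hx hy) hz) _ => //.
rewrite (_ : psum _ _ = psum x z \+ psum y z); last first.
  by apply/funext => N; exact: psumDl.
by apply: cvgD; exact: cvg_psum.
Qed.

Lemma hipZl a x z : hset H x -> hset H z -> hip H (a *: x) z = a * hip H x z.
Proof.
move=> hx hz; apply: cvg_unique (cvg_psum (hsetZ a hx) hz) _ => //.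
rewrite (_ : psum _ _ = (fun N => a * psum x z N)); last first.
  by apply/funext => N; exact: psumZl.
by apply: cvgM; [exact: cvg_cst|exact: cvg_psum].
Qed.

Lemma hipDr x y z : hset H x -> hset H y -> hset H z ->
  hip H z (x + y) = hip H z x + hip H z y.
Proof. by move=> hx hy hz; rewrite hipC ?hipDl ?(hipC hz)//; exact: hsetD. Qed.

Lemma hipZr a x z : hset H x -> hset H z -> hip H z (a *: x) = a * hip H z x.
Proof. by move=> hx hz; rewrite hipC ?hipZl ?(hipC hz)//; exact: hsetZ. Qed.

Lemma hnormZ a x : hset H x -> hnorm H (a *: x) = `|a| * hnorm H x.
Proof.
move=> hx; rewrite /hnorm hipZl ?hipZr//; last exact: hsetZ.
by rewrite mulrA -expr2 sqrtrM ?sqr_ge0// sqrtr_sqr.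
Qed.

Lemma hnorm0 : hnorm H 0 = 0.
Proof. by rewrite -(scale0r 0) hnormZ ?normr0 ?mul0r//; exact: hset0. Qed.

Lemma hnormN x : hset H x -> hnorm H (- x) = hnorm H x.
Proof. by move=> hx; rewrite -scaleN1r hnormZ// normrN1 mul1r. Qed.

Lemma hnormD x y : hset H x -> hset H y ->
  hnorm H (x + y) <= hnorm H x + hnorm H y.
Proof.
move=> hx hy; rewrite -(ler_pXn2r (n := 2))// ?nnegrE ?addr_ge0 ?hnorm_ge0//.
have hxy := hsetD hx hy.
rewrite hnorm_sq// hipDl// !hipDr// (hipC hy hx) sqrrD !hnorm_sq//.
have := hip_CS hx hy; have := ler_norm (hip H x y); lra.
Qed.

Lemma hnorm_distl x y : hset H x -> hset H y ->
  `|hnorm H x - hnorm H y| <= hnorm H (x - y).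
Proof.
move=> hx hy; have h1 := hnormD (hsetB hx hy) hy; have h2 := hnormD (hsetB hy hx) hx.
have h3 : hnorm H (y - x) = hnorm H (x - y).
  by rewrite -(hnormN (hsetB hx hy)) opprB.
rewrite subrK in h1; rewrite subrK in h2.
by rewrite ler_norml; apply/andP; split; lra.
Qed.

Lemma coord_le_hnorm nu x : hset H x -> Num.sqrt (wt nu) * `|c nu x| <= hnorm H x.
Proof.
move=> hx; rewrite -(ler_pXn2r (n := 2))// ?nnegrE ?mulr_ge0 ?sqrtr_ge0 ?hnorm_ge0//.
rewrite exprMn sqr_sqrtr ?(ltW (ch_wt cH nu))// real_normK ?num_real//.
apply: le_trans (psum_le nu.+1 hx); rewrite /psum big_nat_recr//= expr2 mulrA lerDr.
exact: psum_ge0.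
Qed.

Lemma hset_e nu : hset H (e nu).
Proof.
apply/hsetP; exists (wt nu * c nu (e nu) * c nu (e nu)) => N.
have h m : 0 <= wt m * c m (e nu) * c m (e nu).
  by rewrite -mulrA -expr2 mulr_ge0 ?sqr_ge0// ltW// (ch_wt cH).
elim: N => [|N IH]; first by rewrite /psum big_nil.
have [NN|NN] := eqVneq N nu; last by rewrite /psum big_nat_recr//= (ch_e0 cH NN) mulr0 addr0.
rewrite /psum big_nat_recr//= NN [X in X + _]big1_seq ?add0r// => m.
by rewrite mem_index_iota /= => /ltn_eqF mn; rewrite (ch_e0 cH) ?mulr0// mn.
Qed.

Lemma hip_e x nu : hset H x -> hip H x (e nu) = wt nu * c nu x.
Proof.
move=> hx; apply: cvg_unique (cvg_psum hx (hset_e nu)) _ => //.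
apply: cvg_near_cst; exists nu.+1 => // N /= nuN.
rewrite /psum (bigD1_seq nu) ?mem_index_iota ?iota_uniq//= big1 ?addr0.
  by rewrite -mulrA [c nu x * _]mulrC (ch_e1 cH).
by move=> m mnu; rewrite (ch_e0 cH mnu) mulr0.
Qed.

Lemma coord_comb (N : nat) (a : nat -> R) m :
  c m (\sum_(0 <= nu < N) a nu *: e nu) = if (m < N)%N then a m * c m (e m) else 0.
Proof.
rewrite coord_sum; case: ifP => mN.
  rewrite (bigD1_seq m) ?mem_index_iota ?iota_uniq//= big1 ?addr0 ?coordZ//.
  by move=> nu mnu; rewrite coordZ (ch_e0 cH) ?mulr0// eq_sym.
rewrite big_seq big1// => nu; rewrite mem_index_iota /= => nuN.
rewrite coordZ (ch_e0 cH) ?mulr0//; apply/eqP => mnu.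
by rewrite mnu nuN in mN.
Qed.

(** Dominated convergence for the series of squares: coordinatewise
approximation of finitely many coordinates converges as soon as it never
increases the size of the error. *)
Lemma hnorm_approx x (a : nat -> nat -> R) : hset H x ->
  (forall nu, a j nu @[j --> \oo] --> c nu x) ->
  (forall j nu, `|c nu x - a j nu| <= `|c nu x|) ->
  hnorm H (x - \sum_(0 <= nu < j) a j nu *: e nu) @[j --> \oo] --> (0 : R).
Proof.
move=> hx ax dom.
pose s j := \sum_(0 <= nu < j) a j nu *: e nu.
have hs j : hset H (s j) by apply: hset_sum => i; apply: hsetZ; exact: hset_e.
have ce1 m j : a j m * c m (e m) = a j m.
  have [cm0|cm0] := eqVneq (c m x) 0.
    have := dom j m; rewrite cm0 sub0r normrN normr0 normr_le0 => /eqP ->.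
    by rewrite mul0r.
  by have := ch_e1 cH m x => /eqP; rewrite -subr_eq0 -{2}[c m x]mul1r -mulrBl mulf_eq0 (negPf cm0) orbF subr_eq0 => /eqP ->; rewrite mulr1.
have cs j m : `|c m (x - s j)| <= `|c m x|.
  by rewrite coordB coord_comb; case: ifP => _; rewrite ?ce1// subr0.
have term j m : wt m * c m (x - s j) * c m (x - s j) <= wt m * c m x * c m x.
  rewrite -!mulrA ler_wpM2l ?(ltW (ch_wt cH m))//.
  rewrite -!expr2 -[leLHS]real_normK ?num_real// -[leRHS]real_normK ?num_real//.
  by rewrite ler_pXn2r ?nnegrE.
apply/cvgrPdist_le => eps eps0.
have e2 : 0 < eps ^+ 2 / 2 by rewrite divr_gt0// exprn_gt0.
have [M _ hM] : \forall M \near \oo, `|hip H x x - psum x x M| <= eps ^+ 2 / 2.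
  by have /cvgrPdist_le := cvg_psum_sq hx; apply.
have cM : psum (x - s j) (x - s j) M @[j --> \oo] --> (0 : R).
  rewrite /psum -[X in _ --> X](_ : \sum_(0 <= nu < M) (wt nu * 0 * 0) = 0); last first.
    by rewrite big1// => i _; rewrite mulr0.
  apply: cvg_big => [|m _]; first exact: add_continuous.
  have cm : c m (x - s j) @[j --> \oo] --> (0 : R).
    have : (c m x - a j m) @[j --> \oo] --> (0 : R).
      by rewrite -[X in _ --> X](subrr (c m x)); apply: cvgB => //; exact: cvg_cst.
    apply: cvg_trans; apply: near_eq_cvg; exists m.+1 => // j /= mj.
    by rewrite coordB coord_comb mj ce1.
  by apply: cvgM => //; apply: cvgM => //; exact: cvg_cst.
have /cvgrPdist_le /(_ _ e2) cM' := cM.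
near=> j; rewrite sub0r normrN ger0_norm ?hnorm_ge0//.
have hxs := hsetB hx (hs j).
apply: hnorm_le => //; first exact: ltW.
move=> N; have [NM|MN] := leP N M.
  apply: (@le_trans _ _ (psum (x - s j) (x - s j) M)); first exact: psum_nd.
  apply: (@le_trans _ _ (eps ^+ 2 / 2)); last by lra.
  have : `|0 - psum (x - s j) (x - s j) M| <= eps ^+ 2 / 2 by near: j.
  by rewrite sub0r normrN ger0_norm// psum_ge0.
rewrite /psum (big_cat_nat (n := M))//= ?(ltnW MN)//.
have h1 : psum (x - s j) (x - s j) M <= eps ^+ 2 / 2.
  have : `|0 - psum (x - s j) (x - s j) M| <= eps ^+ 2 / 2 by near: j.
  by rewrite sub0r normrN ger0_norm// psum_ge0.
have h2 : \sum_(M <= nu < N) wt nu * c nu (x - s j) * c nu (x - s j) <= eps ^+ 2 / 2.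
  apply: le_trans (ler_sum _ _) _; first by move=> m _; exact: term.
  have := hM M (leqnn M); rewrite /= ger0_norm; last first.
    by rewrite subr_ge0 -hnorm_sq// psum_le.
  apply: le_trans; rewrite lerBrDl -hnorm_sq//; apply: le_trans (psum_le N hx).
  by rewrite -/(psum _ _ _) [psum x x N](big_cat_nat (n := M))//= ltnW.
by rewrite (splitr (eps ^+ 2)); exact: lerD.
Unshelve. all: by end_near. Qed.

End hilb_theory.

(** * Bochner spaces in coordinates *)

Section simple_approximation.
Context (R : realType).
Import HBNNSimple.

Definition real_simple (g : R -> R) : Prop :=
  exists m (A : 'I_m -> set R) (y : 'I_m -> R),
    (forall i, measurable (A i)) /\ forall t, g t = \sum_(i < m) y i * \1_(A i) t.

Lemma nnsfun_simple (h : {nnsfun R >-> R}) : real_simple h.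
Proof.
pose s := finmap.enum_fset (fset_set (range h)); exists (size s), (fun i => h @^-1` [set s`_i]), (fun i => s`_i).
by split=> [i|t]; [rewrite -[_ @^-1` _]setTI; apply: (@measurable_funP _ _ _ _ _ h) |exact: fimfunEord].
Qed.

Lemma real_simpleB (g h : R -> R) :
  real_simple g -> real_simple h -> real_simple (fun t => g t - h t).
Proof.
move=> [m [A [y [mA hg]]]] [n [B [z [mB hh]]]].
exists (m + n)%N, (fun i => match fintype.split i with inl j => A j | inr j => B j end),
  (fun i => match fintype.split i with inl j => y j | inr j => - z j end).
split=> [i|t]; first by case: (fintype.split i).
rewrite big_split_ord /= hg hh; congr (_ + _); first apply: eq_bigr => i _.
  by rewrite -[lshift n i]/(unsplit (inl i)) unsplitK.
rewrite -sumrN; apply: eq_bigr => i _.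
by rewrite -[rshift m i]/(unsplit (inr i)) unsplitK mulNr.
Qed.

Lemma simple_approx (u : R -> R) : measurable_fun setT u ->
  exists a : nat -> R -> R, [/\ forall j, real_simple (a j),
    forall t, a j t @[j --> \oo] --> u t &
    forall j t, `|u t - a j t| <= `|u t|].
Proof.
have half (v : R -> R) : measurable_fun setT v -> (forall t, 0 <= v t) ->
    exists a : nat -> {nnsfun R >-> R},
      (forall t, a j t @[j --> \oo] --> v t) /\ forall j t, a j t <= v t.
  move=> mv v0; have mv' : measurable_fun setT (EFin \o v) by exact/measurable_EFinP.
  pose a := nnsfun_approx measurableT mv'.
  have av t : a j t @[j --> \oo] --> v t.
    have h := @cvg_nnsfun_approx _ _ _ _ measurableT _ mv' (fun x _ => v0 x) t I.
    by have /fine_cvgP[_] := h.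
  exists a; split=> // j t.
  have nd : nondecreasing_seq (fun j => a j t).
    by move=> m n mn; have /lefP := nd_nnsfun_approx measurableT mv' mn; exact.
  by rewrite -(cvg_lim _ (av t))//; apply: nondecreasing_cvgn_le => //; exact: cvgP (av t).
move=> mu.
have mp : measurable_fun setT (fun t => Num.max (u t) 0) by exact: measurable_maxr.
have mn : measurable_fun setT (fun t => Num.max (- u t) 0).
  by apply: measurable_maxr => //; exact: measurableT_comp.
have [|a [a1 a2]] := half _ mp; first by move=> t; rewrite le_max lexx orbT.
have [|b [b1 b2]] := half _ mn; first by move=> t; rewrite le_max lexx orbT.
have mx t : (0 <= u t /\ Num.max (u t) 0 = u t /\ Num.max (- u t) 0 = 0) \/
    (u t <= 0 /\ Num.max (u t) 0 = 0 /\ Num.max (- u t) 0 = - u t).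
  have [h|/ltW h] := leP 0 (u t); [left|right]; split=> //; split.
  - by [].
  - by rewrite Order.POrderTheory.max_r// oppr_le0.
  - by [].
  - by rewrite Order.POrderTheory.max_l// oppr_ge0.
exists (fun j t => a j t - b j t); split=> [j|t|j t].
- exact: real_simpleB (nnsfun_simple _) (nnsfun_simple _).
- have -> : u t = Num.max (u t) 0 - Num.max (- u t) 0.
    by case: (mx t) => [[_ [-> ->]]|[_ [-> ->]]]; rewrite ?subr0 ?sub0r ?opprK.
  exact: cvgB (a1 t) (b1 t).
- have := a2 j t; have := b2 j t.
  have : 0 <= a j t by []. have : 0 <= b j t by [].
  case: (mx t) => [[h [-> ->]]|[h [-> ->]]] b0 a0 hb ha.
  + by rewrite !ger0_norm; lra.
  + by rewrite !ler0_norm; lra.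
Qed.

End simple_approximation.

Section bochner.
Context (R : realType) (X : lmodType R) (H : hilb X).
Context (c : nat -> X -> R) (wt : nat -> R) (e : nat -> X).
Hypothesis cH : coord_hilb H c wt e.
Local Notation mu := (@lebesgue_measure R).

Lemma simple_fun0 : simple_fun H (fun=> 0).
Proof.
exists 0%N, (fun=> set0), (fun=> 0); split=> //; first by case.
by apply/funext => t; rewrite big_ord0.
Qed.

Lemma simple_funD (s s' : R -> X) :
  simple_fun H s -> simple_fun H s' -> simple_fun H (fun t => s t + s' t).
Proof.
move=> [m [A [y [mA hy ->]]]] [n [B [z [mB hz ->]]]].
exists (m + n)%N, (fun i => match fintype.split i with inl j => A j | inr j => B j end),
  (fun i => match fintype.split i with inl j => y j | inr j => z j end).
split=> [i|i|]; [by case: (fintype.split i)|by case: (fintype.split i)|].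
apply/funext => t; rewrite big_split_ord /=; congr (_ + _); apply: eq_bigr => i _.
  by rewrite -[lshift n i]/(unsplit (inl i)) unsplitK.
by rewrite -[rshift m i]/(unsplit (inr i)) unsplitK.
Qed.

Lemma simple_fun_scale (g : R -> R) x : real_simple g -> hset H x ->
  simple_fun H (fun t => g t *: x).
Proof.
move=> [m [A [y [mA hg]]]] hx; exists m, A, (fun i => y i *: x); split=> //.
  by move=> i; exact: (hsetZ cH).
apply/funext => t; rewrite hg scaler_suml; apply: eq_bigr => i _.
by rewrite scalerA mulrC.
Qed.

Lemma simple_fun_sum (a : nat -> R -> R) N : (forall nu, real_simple (a nu)) ->
  simple_fun H (fun t => \sum_(0 <= nu < N) a nu t *: e nu).
Proof.
move=> ha; elim: N => [|N IH].
  by under eq_fun do rewrite big_nil; exact: simple_fun0.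
under eq_fun do rewrite big_nat_recr//=.
by apply: simple_funD => //; apply: simple_fun_scale => //; exact: hset_e cH N.
Qed.

(** The representatives used for functions in L^p: they are defined everywhere, and
their measurability is a statement about real functions. *)
Definition coord_measurable (v : R -> X) : Prop :=
  (forall t, hset H (v t)) /\
  forall nu, measurable_fun setT (fun t : measurableTypeR R => c nu (v t)).

(** Pettis' theorem: approximating each coordinate by simple functions, and keeping
the first [j] coordinates of the [j]-th approximation, gives simple functions that
converge by [hnorm_approx]. *)
Lemma coord_measurable_strongly_measurable v : coord_measurable v -> strongly_measurable H v.
Proof.
move=> [hv mv]; split; first by apply: aeW => t; exact: hv.
have /choice [a ha] : forall nu, exists a : nat -> R -> R, [/\ forall j, real_simple (a j),
    forall t, a j t @[j --> \oo] --> c nu (v t) &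
    forall j t, `|c nu (v t) - a j t| <= `|c nu (v t)|].
  by move=> nu; apply: simple_approx; exact: mv.
exists (fun j t => \sum_(0 <= nu < j) a nu j t *: e nu); split.
  by move=> j; apply: simple_fun_sum => nu; have [] := ha nu.
apply: aeW => t; apply: (hnorm_approx cH (a := fun j nu => a nu j t)) => //.
  by move=> nu; have [_ + _] := ha nu; apply.
by move=> j nu; have [_ _ +] := ha nu; apply.
Qed.

(** The representative is set to zero on a null set that contains all the points
where the value leaves the space or the simple functions do not converge. *)
Lemma strongly_measurable_coord_measurable v : strongly_measurable H v ->
  exists2 w, coord_measurable w & {ae mu, forall t, v t = w t}.
Proof.
move=> [hv [s [ss sv]]].
have [N [mN N0 hN]] := filterI hv sv.
pose w t := if `[< N t >] then 0 else v t.
have good t : ~ N t -> hset H (v t) /\ hnorm H (v t - s j t) @[j --> \oo] --> (0 : R).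
  by move=> nN; apply: contrapT => hh; apply: nN; apply: hN.
have wt' t : ~ N t -> w t = v t by move=> nN; rewrite /w asboolF.
have wN t : N t -> w t = 0 by move=> nN; rewrite /w asboolT.
have hs j t : hset H (s j t).
  have [m [A [x [mA hx ->]]]] := ss j; apply: (hset_sum cH) => i.
  exact: (hsetZ cH).
exists w; last first.
  exists N; split=> // t /= ht; apply: contrapT => nN; apply: ht.
  by rewrite wt'.
split=> [t|nu].
  have [Nt|Nt] := pselect (N t); first by rewrite wN//; exact: hset0 cH.
  by rewrite wt'//; have [] := good _ Nt.
apply: (measurable_fun_cvg (h := fun j t => c nu (s j t) * \1_(~` N) t)).
  move=> j; apply: measurable_funM; last exact/measurable_indic/measurableC.
  have [m [A [x [mA hx ->]]]] := ss j.
  under eq_fun do rewrite (coord_sum cH).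
  apply: measurable_sum => i; under eq_fun do rewrite (coordZ cH).
  by apply: measurable_funM => //; exact/measurable_indic.
move=> t _; have [Nt|Nt] := pselect (N t).
  rewrite wN// (coord0 cH) indicE memNset//=.
  by under eq_fun do rewrite mulr0; exact: cvg_cst.
rewrite wt'// indicE mem_set//=; under eq_fun do rewrite mulr1.
have [hvt cvt] := good _ Nt.
have sw : 0 < Num.sqrt (wt nu) by rewrite sqrtr_gt0 (ch_wt cH).
apply/cvgrPdist_le => eps eps0.
have /cvgrPdist_le /(_ _ (mulr_gt0 sw eps0)) := cvt.
apply: filterS => j; rewrite sub0r normrN ger0_norm ?hnorm_ge0// => hj.
rewrite -(ler_pM2l sw) -(coordB cH).
by apply: le_trans (coord_le_hnorm cH nu (hsetB cH hvt (hs j t))) _.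
Qed.

Lemma strongly_measurable_ae v w : {ae mu, forall t, v t = w t} ->
  strongly_measurable H v -> strongly_measurable H w.
Proof.
move=> vw [hv [s [ss sv]]]; split; first by apply: filterS2 vw hv => t ->.
by exists s; split=> //; apply: filterS2 vw sv => t ->.
Qed.

Lemma measurable_hnorm d (T : measurableType d) (f : T -> X) :
  (forall x, hset H (f x)) -> (forall nu, measurable_fun setT (fun x => c nu (f x))) ->
  measurable_fun setT (fun x => hnorm H (f x)).
Proof.
move=> hf mf; apply: (measurable_fun_cvg
  (h := fun N x => Num.sqrt (psum c wt (f x) (f x) N))).
  move=> N; apply: measurableT_comp; first by apply: continuous_measurable_fun; exact: sqrt_continuous.
  rewrite /psum; apply: measurable_sum => nu.
  apply: measurable_funM; last exact: mf.
  by apply: measurable_funM; [exact: measurable_cst|exact: mf].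
move=> x _; apply: (continuous_cvg _ (@sqrt_continuous R _)).
exact: (cvg_psum_sq cH (hf x)).
Qed.

Lemma coord_measurable_hnorm v : coord_measurable v -> measurable_fun setT (fun t => hnorm H (v t)).
Proof. by move=> [hv mv]; exact: measurable_hnorm. Qed.

Lemma coord_measurableD v w : coord_measurable v -> coord_measurable w -> coord_measurable (fun t => v t + w t).
Proof.
move=> [hv mv] [hw mw]; split=> [t|nu]; first exact: (hsetD cH).
by under eq_fun do rewrite (coordD cH); exact: measurable_funD.
Qed.

Lemma coord_measurableM (g : R -> R) v : measurable_fun setT g -> coord_measurable v ->
  coord_measurable (fun t => g t *: v t).
Proof.
move=> mg [hv mv]; split=> [t|nu]; first exact: (hsetZ cH).
by under eq_fun do rewrite (coordZ cH); exact: measurable_funM.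
Qed.

Lemma coord_measurableB v w : coord_measurable v -> coord_measurable w -> coord_measurable (fun t => v t - w t).
Proof.
move=> [hv mv] [hw mw]; split=> [t|nu]; first exact: (hsetB cH).
by under eq_fun do rewrite (coordB cH); exact: measurable_funB.
Qed.

Lemma coord_measurable_shift tau v : coord_measurable v -> coord_measurable (fun t => v (t + tau)).
Proof.
move=> [hv mv]; split=> [t|nu] //.
by apply: (measurableT_comp (mv nu)); exact: measurable_shift.
Qed.

End bochner.

(** * Bochner spaces *)

Section Lp_theory.
Context (R : realType) (X : lmodType R) (H : hilb X).
Context (c : nat -> X -> R) (wt : nat -> R) (e : nat -> X).
Hypothesis cH : coord_hilb H c wt e.
Context (p : R) (hp : 1 < p).
Local Notation mu := (@lebesgue_measure R).
Implicit Types (v w : R -> X).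

Let p0 : 0 < p. Proof. exact: lt_trans ltr01 hp. Qed.
Let pn0 : p != 0. Proof. by rewrite gt_eqF. Qed.

Definition Lp_integral v : \bar R := \int[mu]_t (hnorm H (v t) `^ p)%:E.

Lemma Lp_integral_ge0 v : (0 <= Lp_integral v)%E.
Proof. by apply: integral_ge0 => t _; rewrite lee_fin powR_ge0. Qed.

Lemma eLp_normE v : eLp_norm H p v = (Lp_integral v `^ p^-1)%E.
Proof.
rewrite /eLp_norm unlock; congr (_ `^ _)%E; apply: eq_integral => t _.
by rewrite /= ger0_norm// hnorm_ge0.
Qed.

Lemma Lp_normE v : Lp_norm H p v = fine (Lp_integral v) `^ p^-1.
Proof. by rewrite /Lp_norm eLp_normE fine_poweR. Qed.

Lemma Lp_norm_ge0 v : 0 <= Lp_norm H p v.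
Proof. by rewrite Lp_normE powR_ge0. Qed.

Lemma eLp_norm_lty v : (eLp_norm H p v < +oo)%E <-> (Lp_integral v < +oo)%E.
Proof.
rewrite eLp_normE; split=> [|h]; last exact: poweR_lty.
by apply: lty_poweRy; rewrite invr_eq0.
Qed.

Lemma Lp_norm_le v M : (Lp_integral v < +oo)%E -> 0 <= M ->
  (Lp_integral v <= (M `^ p)%:E)%E <-> Lp_norm H p v <= M.
Proof.
move=> fv M0; rewrite Lp_normE.
have fn : Lp_integral v \is a fin_num by rewrite ge0_fin_numE// Lp_integral_ge0.
have f0 : 0 <= fine (Lp_integral v) by rewrite fine_ge0// Lp_integral_ge0.
rewrite -{1}(fineK fn) lee_fin; split=> h.
  rewrite -[leRHS](powRr1) // -[1 in leRHS](mulfV pn0) powRrM.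
  by rewrite ge0_ler_powR ?nnegrE ?powR_ge0// invr_ge0 ltW.
rewrite -[leLHS](powRr1)// -[1 in leLHS](mulVf pn0) powRrM.
by rewrite ge0_ler_powR ?nnegrE ?powR_ge0// ltW.
Qed.

Lemma Lp_integral_ae v w : {ae mu, forall t, v t = w t} ->
  Lp_integral v = Lp_integral w.
Proof. by move=> vw; apply: integral_ae; apply: filterS vw => t ->. Qed.

Lemma Lp_norm_ae v w : {ae mu, forall t, v t = w t} ->
  Lp_norm H p v = Lp_norm H p w.
Proof. by move=> vw; rewrite !Lp_normE (Lp_integral_ae vw). Qed.

Lemma in_Lp_ae v w : {ae mu, forall t, v t = w t} -> in_Lp H p v -> in_Lp H p w.
Proof.
move=> vw [sv fv]; split; first exact: strongly_measurable_ae vw sv.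
by move: fv; rewrite !eLp_norm_lty (Lp_integral_ae vw).
Qed.

Lemma coord_measurable_in_Lp v : coord_measurable H c v -> (Lp_integral v < +oo)%E -> in_Lp H p v.
Proof.
by move=> nv fv; split; [exact (coord_measurable_strongly_measurable cH nv)|exact/eLp_norm_lty].
Qed.

Lemma in_Lp_fin v : in_Lp H p v -> (Lp_integral v < +oo)%E.
Proof. by move=> [_ /eLp_norm_lty]. Qed.

Lemma in_Lp_coord_measurable v : in_Lp H p v ->
  exists w, [/\ coord_measurable H c w, {ae mu, forall t, v t = w t} & in_Lp H p w].
Proof.
move=> lv; have [w nw vw] := strongly_measurable_coord_measurable cH lv.1.
by exists w; split => //; exact: in_Lp_ae vw lv.
Qed.

Lemma coord_measurable_powR v : coord_measurable H c v ->
  measurable_fun setT (fun t => (hnorm H (v t) `^ p)%:E).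
Proof.
by move=> nv; apply/measurable_EFinP; apply: (measurableT_comp (measurable_powR p)); exact: (coord_measurable_hnorm cH nv).
Qed.

Lemma Lp_integral_dom v w K : coord_measurable H c w -> 0 <= K ->
  {ae mu, forall t, hnorm H (v t) <= K * hnorm H (w t)} ->
  (Lp_integral v <= (K `^ p)%:E * Lp_integral w)%E.
Proof.
move=> nw K0 vw; have mw := coord_measurable_powR nw.
have Kp : (0 <= (K `^ p)%:E)%E by rewrite lee_fin powR_ge0.
have w0 t : setT t -> (0 <= (hnorm H (w t) `^ p)%:E)%E by rewrite lee_fin powR_ge0.
rewrite /Lp_integral -(ge0_integralZl mu measurableT mw w0 Kp).
apply: le_integral_ae => [t|t|]; rewrite ?mule_ge0 ?lee_fin ?powR_ge0//.
apply: filterS vw => t vwt; rewrite -EFinM lee_fin -powRM ?hnorm_ge0//.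
by rewrite ge0_ler_powR ?nnegrE ?mulr_ge0 ?hnorm_ge0// ltW.
Qed.

Lemma in_Lp_dom v w K : strongly_measurable H v -> in_Lp H p w -> 0 <= K ->
  {ae mu, forall t, hnorm H (v t) <= K * hnorm H (w t)} ->
  in_Lp H p v /\ Lp_norm H p v <= K * Lp_norm H p w.
Proof.
move=> sv lw K0 vw; have [w' [nw ww' lw']] := in_Lp_coord_measurable lw.
have vw' : {ae mu, forall t, hnorm H (v t) <= K * hnorm H (w' t)}.
  by apply: filterS2 vw ww' => t h <-.
have h := Lp_integral_dom nw K0 vw'.
have fw := in_Lp_fin lw'.
have fv : (Lp_integral v < +oo)%E.
  by apply: le_lt_trans h _; rewrite lte_mul_pinfty// lee_fin powR_ge0.
split; first by split=> //; exact/eLp_norm_lty.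
rewrite (Lp_norm_ae ww'); apply/Lp_norm_le => //; first by rewrite mulr_ge0// Lp_norm_ge0.
apply: le_trans h _; rewrite powRM ?Lp_norm_ge0// EFinM; apply: lee_wpmul2l.
  by rewrite lee_fin powR_ge0.
by apply/Lp_norm_le => //; exact: Lp_norm_ge0.
Qed.

Lemma in_LpM (g : R -> R) v K : measurable_fun setT g -> (forall t, `|g t| <= K) ->
  in_Lp H p v -> in_Lp H p (fun t => g t *: v t) /\
  Lp_norm H p (fun t => g t *: v t) <= K * Lp_norm H p v.
Proof.
move=> mg gK lv; have [w [nw vw lw]] := in_Lp_coord_measurable lv.
have K0 : 0 <= K := le_trans (normr_ge0 _) (gK 0).
apply: in_Lp_dom => //; last first.
  apply: filterS lv.1.1 => t hv; rewrite (hnormZ cH)// ler_wpM2r// hnorm_ge0//.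
apply: strongly_measurable_ae (coord_measurable_strongly_measurable cH (coord_measurableM cH mg nw)).
by apply: filterS vw => t ->.
Qed.

Lemma in_LpZ a v : in_Lp H p v -> in_Lp H p (fun t => a *: v t) /\
  Lp_norm H p (fun t => a *: v t) <= `|a| * Lp_norm H p v.
Proof. by move=> lv; apply: in_LpM => //; exact: measurable_cst. Qed.

Lemma in_LpD v w : in_Lp H p v -> in_Lp H p w -> in_Lp H p (fun t => v t + w t) /\
  Lp_norm H p (fun t => v t + w t) <= Lp_norm H p v + Lp_norm H p w.
Proof.
move=> lv lw; have [v' [nv vv' lv']] := in_Lp_coord_measurable lv.
have [w' [nw ww' lw']] := in_Lp_coord_measurable lw.
have vw : {ae mu, forall t, v' t + w' t = v t + w t}.
  by apply: filterS2 vv' ww' => t -> ->.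
have nvw := coord_measurableD cH nv nw.
pose f t := hnorm H (v' t); pose g t := hnorm H (w' t).
have mf : measurable_fun setT f := coord_measurable_hnorm cH nv.
have mg : measurable_fun setT g := coord_measurable_hnorm cH nw.
have mink := minkowski_EFin mu mf mg (ltW hp).
pose s t := v' t + w' t.
have le : (eLp_norm H p s <= eLp_norm H p v' + eLp_norm H p w')%E.
  apply: le_trans _ mink; rewrite /eLp_norm unlock.
  apply: gt0_ler_poweR.
  - by rewrite invr_ge0 ltW.
  - by rewrite in_itv/= leey andbT; apply: integral_ge0 => t _; rewrite ?poweR_ge0 ?lee_fin ?powR_ge0.
  - by rewrite in_itv/= leey andbT; apply: integral_ge0 => t _; rewrite ?poweR_ge0 ?lee_fin ?powR_ge0.
  apply: le_integral_ae => [t|t|]; rewrite ?poweR_ge0 ?lee_fin ?powR_ge0//.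
  apply: aeW => t /=; rewrite lee_fin ge0_ler_powR ?nnegrE ?(ltW p0)//.
  rewrite !ger0_norm ?addr_ge0 ?hnorm_ge0//.
  by have := hnormD cH (nv.1 t) (nw.1 t).
have fin : (eLp_norm H p s < +oo)%E.
  by apply: le_lt_trans le _; rewrite lte_add_pinfty ?lv'.2 ?lw'.2.
split.
  by apply: in_Lp_ae vw _; split=> //; exact (coord_measurable_strongly_measurable cH nvw).
rewrite -(Lp_norm_ae vw) (Lp_norm_ae vv') (Lp_norm_ae ww') /Lp_norm -fineD.
- apply: fine_le => //; rewrite ge0_fin_numE ?lv'.2 ?lw'.2//.
  + exact: Lnorm_ge0.
  + by rewrite lte_add_pinfty ?lv'.2 ?lw'.2.
  + by rewrite adde_ge0 ?Lnorm_ge0.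
- by rewrite ge0_fin_numE ?lv'.2//; exact: Lnorm_ge0.
- by rewrite ge0_fin_numE ?lw'.2//; exact: Lnorm_ge0.
Qed.

Lemma in_LpB v w : in_Lp H p v -> in_Lp H p w -> in_Lp H p (fun t => v t - w t) /\
  Lp_norm H p (fun t => v t - w t) <= Lp_norm H p v + Lp_norm H p w.
Proof.
move=> lv lw; have [lN hN] := in_LpZ (-1) lw.
have [h1 h2] := in_LpD lv lN.
have E : (fun t => v t + -1 *: w t) = (fun t => v t - w t).
  by apply/funext => t; rewrite scaleN1r.
rewrite E in h1 h2; split=> //; apply: le_trans h2 _; rewrite lerD2l.
by move: hN; rewrite normrN1 mul1r.
Qed.

Lemma Lp_integral_shift tau v : Lp_integral (fun t => v (t + tau)) = Lp_integral v.
Proof. exact: (integral_shift tau (fun t => (hnorm H (v t) `^ p)%:E)). Qed.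

Lemma Lp_norm_shift tau v : Lp_norm H p (fun t => v (t + tau)) = Lp_norm H p v.
Proof. by rewrite !Lp_normE Lp_integral_shift. Qed.

Lemma in_Lp_shift tau v : in_Lp H p v -> in_Lp H p (fun t => v (t + tau)).
Proof.
move=> lv; have [w [nw vw lw]] := in_Lp_coord_measurable lv.
have h : {ae mu, forall t, w (t + tau) = v (t + tau)}.
  by apply: (ae_shift tau (P := fun t => w t = v t)); apply: filterS vw => t ->.
apply: in_Lp_ae h _; apply: coord_measurable_in_Lp; first exact: coord_measurable_shift.
by rewrite Lp_integral_shift; exact: in_Lp_fin.
Qed.

Lemma in_Lp0 : in_Lp H p (fun=> 0).
Proof.
apply: coord_measurable_in_Lp.
  split=> [t|nu]; first exact: (hset0 cH).
  by under eq_fun do rewrite (coord0 cH); exact: measurable_cst.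
rewrite /Lp_integral; under eq_integral do rewrite (hnorm0 cH) powR0//.
by rewrite integral0.
Qed.

End Lp_theory.

(** * Translations are strongly continuous on Bochner spaces *)

Section L1_translation.
Context (R : realType).
Local Notation mu := (@lebesgue_measure R).

Lemma heine_translation (f : R -> R) (a b eps : R) : continuous f -> 0 < eps ->
  exists2 d : R, 0 < d & forall h t, `|h| < d -> a <= t <= b -> `|f (t + h) - f t| < eps.
Proof.
move=> cf eps0; have /compact_near_coveringP cov := segment_compact (a := a) (b := b).
have loc : forall t : R, `[a, b]%classic t ->
    \forall t' \near t & h \near (0 : R), `|f (t' + h) - f t'| < eps.
  move=> t _.
  have cD : (fun z : R * R => f (z.1 + z.2) - f z.1) z @[z --> (t, 0 : R)] --> (0 : R).
    rewrite -[X in _ --> X](_ : f (t + 0) - f t = 0); last by rewrite addr0 subrr.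
    have h1 : (fun z : R * R => z.1) z @[z --> (t, 0 : R)] --> t by exact: cvg_fst.
    have h2 : (fun z : R * R => z.1 + z.2) z @[z --> (t, 0 : R)] --> t + 0.
      by apply: cvgD; [exact: cvg_fst|exact: cvg_snd].
    by apply: cvgB; [exact: cvg_comp h2 (cf _)|exact: cvg_comp h1 (cf _)].
  move/cvgrPdist_lt : cD => /(_ _ eps0); move=> hz.
  by apply: filterS hz => z; rewrite sub0r normrN.
have := cov _ (nbhs (0 : R)) (fun h t => `|f (t + h) - f t| < eps) (nbhs_filter (0 : R)) loc.
move=> [d /= d0 hd]; exists d => // h t hh ht.
apply: hd; rewrite ?in_itv//=.
by rewrite /ball/= sub0r normrN.
Qed.

(** Bounded functions of bounded support are approximated in mean by continuous
functions, for which the claim is uniform continuity. *)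
Lemma L1_translation (g : R -> R) (N M eps : R) : measurable_fun setT g ->
  (forall t, `|g t| <= M) -> (forall t, N < `|t| -> g t = 0) -> 0 <= N -> 0 < eps ->
  exists2 d : R, 0 < d & forall h, `|h| < d ->
    (\int[mu]_t `|g (t + h) - g t|%:E <= eps%:E)%E.
Proof.
move=> mg gM g0 N0 eps0.
pose E' : set R := `[- (N + 2), N + 2]%classic; pose E : set R := `[- (N + 1), N + 1]%classic.
have mE' : measurable E' by exact: measurable_itv.
have mE : measurable E by exact: measurable_itv.
have E'E t : E' t <-> `|t| <= N + 2 by rewrite ler_norml /E' /= in_itv.
have EE t : E t <-> `|t| <= N + 1 by rewrite ler_norml /E /= in_itv.
have muE' : (mu E' < +oo)%E by rewrite /E' lebesgue_measure_itv/=; case: ifP => _; rewrite -?EFinB ltry.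
have muE : mu E = (2 * (N + 1))%:E.
  rewrite /E lebesgue_measure_itv/= lte_fin ifT; last by lra.
  by rewrite -EFinB; congr EFin; ring.
have ig : mu.-integrable E' (EFin \o g).
  apply: measurable_bounded_integrable => //; first exact: measurable_funTS mg.
  exists M; split; first exact: num_real.
  by move=> x Mx t _ /=; apply: le_trans (gM t) (ltW Mx).
have [f_ [cf _ f_g]] := approximation_continuous_integrable mE' muE' ig.
have e4 : 0 < eps / 4 by rewrite divr_gt0.
have [f cf1 hf] : exists2 f : R -> R, continuous f &
    (\int[mu]_(z in E') `|(g z - f z)%:E| <= (eps / 4)%:E)%E.
  have /fine_cvgP[fin /cvgrPdist_le /(_ _ e4)] := f_g.
  move=> /(filterI fin) [n _ /(_ n (leqnn n)) [/= fn hn]].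
  exists (f_ n) => //; rewrite -(fineK fn) lee_fin.
  rewrite sub0r normrN in hn; exact: le_trans (ler_norm _) hn.
have q0 : 0 < 2 * (N + 1) by lra.
have e1 : 0 < eps / 4 / (2 * (N + 1)) by rewrite divr_gt0.
have [d d0 hd] := heine_translation (- (N + 1)) (N + 1) cf1 e1.
exists (Num.min d 1); first by rewrite lt_min d0 ltr01.
move=> h; rewrite lt_min => /andP[hh h1].
have mf : measurable_fun setT f by exact: continuous_measurable_fun.
pose A : R -> \bar R := (fun t => `|(g t - f t)%:E|%E) \_ E'.
have mA : measurable_fun setT A.
  apply/(measurable_restrictT _ _).1 => //; apply: measurableT_comp => //.
  by apply/measurable_EFinP; apply: measurable_funTS; exact: measurable_funB.
have A0 t : (0 <= A t)%E by rewrite /A patchE; case: ifP.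
have AE t : E' t -> A t = `|g t - f t|%:E by move=> h'; rewrite /A patchE mem_set.
pose B : R -> \bar R := fun t => (eps / 4 / (2 * (N + 1)) * \1_E t)%:E.
have mB : measurable_fun setT B.
  by apply/measurable_EFinP; apply: measurable_funM => //; exact: measurable_indic.
have B0 t : (0 <= B t)%E by rewrite lee_fin mulr_ge0 ?(ltW e1).
have mAh : measurable_fun setT (fun t : R => A (t + h)).
  by apply: (measurableT_comp mA); exact: measurable_shift.
have IA : (\int[mu]_t A t <= (eps / 4)%:E)%E by rewrite /A -integral_mkcond.
have IB : (\int[mu]_t B t = (eps / 4)%:E)%E.
  rewrite /B; under eq_integral do rewrite EFinM.
  rewrite ge0_integralZl//=; last 2 first.
  - by apply/measurable_EFinP; exact: measurable_indic.
  - by rewrite lee_fin ltW.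
  rewrite integral_indic// setIT [X in (_ * X)%E](_ : _ = mu E)// muE -EFinM; congr EFin; field.
  by rewrite gt_eqF//; lra.
apply: (@le_trans _ _ (\int[mu]_t (A (t + h)%R + (B t + A t)))%E).
  apply: le_integral_ae => [t|t|]; first by rewrite lee_fin.
    by rewrite !adde_ge0.
  apply: aeW => t.
  have [Et|nEt] := pselect (E t).
    have Et' : E' t by apply/E'E; move/EE : Et; lra.
    have Eth : E' (t + h).
      by apply/E'E; move/EE : Et => ?; apply: le_trans (ler_normD _ _) _; lra.
    rewrite !AE// /B indicE mem_set//= mulr1 -!EFinD lee_fin.
    have := hd h t hh; move/EE : (Et); rewrite ler_norml => Et1 /(_ Et1) hft.
    have -> : g (t + h) - g t = (g (t + h) - f (t + h)) + ((f (t + h) - f t) + (f t - g t)) by ring.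
    apply: le_trans (ler_normD _ _) _; rewrite lerD2l.
    by apply: le_trans (ler_normD _ _) _; rewrite (distrC (f t)) lerD2r ltW.
  have nt : N + 1 < `|t| by rewrite ltNge; apply/negP => /EE.
  rewrite (g0 t) ?(g0 (t + h)) ?subrr ?normr0 ?adde_ge0//.
    have := ler_normB (t + h) h; rewrite addrK; lra.
  lra.
have BA0 t : setT t -> (0 <= B t + A t)%E by move=> _; rewrite adde_ge0.
have mBA : measurable_fun setT (fun t => B t + A t)%E by exact: emeasurable_funD.
rewrite ge0_integralD//.
rewrite ge0_integralD// (ge0_integral_shift h A0) IB.
apply: le_trans (leeD IA (leeD (lexx _) IA)) _.
by rewrite -!EFinD lee_fin; lra.
Qed.

End L1_translation.

Section Lp_translation.
Context (R : realType) (X : lmodType R) (H : hilb X).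
Context (c : nat -> X -> R) (wt : nat -> R) (e : nat -> X).
Hypothesis cH : coord_hilb H c wt e.
Context (p : R) (hp : 1 < p).
Local Notation mu := (@lebesgue_measure R).
Implicit Types (v w : R -> X).

Let p0 : 0 < p. Proof. exact: lt_trans ltr01 hp. Qed.

Lemma hnorm_mono x y : hset H x -> hset H y -> (forall nu, `|c nu x| <= `|c nu y|) ->
  hnorm H x <= hnorm H y.
Proof.
move=> hx hy xy; apply: (hnorm_le cH) => //; first exact: hnorm_ge0.
move=> N; apply: le_trans (psum_le cH N hy); apply: ler_sum => nu _.
rewrite -!mulrA ler_wpM2l ?(ltW (ch_wt cH nu))//.
rewrite -!expr2 -[leLHS]real_normK ?num_real// -[leRHS]real_normK ?num_real//.
by rewrite ler_pXn2r ?nnegrE.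
Qed.

(** Compares the p-th power of a bounded function with the function, which reduces
continuity in L^p to continuity in mean. *)
Lemma powR_le_lin (x M : R) : 0 <= x -> x <= M -> x `^ p <= M `^ (p - 1) * x.
Proof.
move=> x0 xM; rewrite -(mulr_powRB1 x0 p0) mulrC ler_wpM2r//.
by rewrite ge0_ler_powR ?nnegrE ?subr_ge0 ?(ltW hp)// (le_trans x0).
Qed.

Definition Lp_continuous v := forall eps : R, 0 < eps -> exists2 d : R, 0 < d &
  forall h, `|h| < d -> Lp_norm H p (fun t => v (t + h) - v t) < eps.

Lemma Lp_continuous_elem (g : R -> R) (N M : R) nu : measurable_fun setT g ->
  (forall t, `|g t| <= M) -> (forall t, N < `|t| -> g t = 0) -> 0 <= N ->
  in_Lp H p (fun t => g t *: e nu) /\ Lp_continuous (fun t => g t *: e nu).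
Proof.
move=> mg gM g0 N0; have M0 : 0 <= M := le_trans (normr_ge0 _) (gM 0).
pose K := hnorm H (e nu); have K0 : 0 <= K by exact: hnorm_ge0.
have he := hset_e cH nu.
have meas_g (k : R -> R) : measurable_fun setT k -> coord_measurable H c (fun t => k t *: e nu).
  move=> mk; apply: (coord_measurableM cH) => //; split=> // m; exact: measurable_cst.
pose C := K `^ p * (2 * M) `^ (p - 1).
have C0 : 0 <= C by rewrite mulr_ge0 ?powR_ge0.
have bound (k : R -> R) : measurable_fun setT k -> (forall t, `|k t| <= 2 * M) ->
    (Lp_integral H p (fun t => k t *: e nu) <= C%:E * \int[mu]_t `|k t|%:E)%E.
  move=> mk k2; rewrite -ge0_integralZl_EFin//; last first.
    by apply/measurable_EFinP; exact: measurableT_comp.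
  apply: le_integral_ae => [t|t|]; rewrite ?mule_ge0 ?lee_fin ?powR_ge0//.
  apply: aeW => t; rewrite (hnormZ cH)// -EFinM lee_fin powRM// /C mulrC -mulrA.
  by rewrite ler_wpM2l ?powR_ge0//; exact: powR_le_lin.
split.
  apply: (coord_measurable_in_Lp cH hp (meas_g _ mg)); apply: le_lt_trans (bound _ mg _) _.
    by move=> t; apply: le_trans (gM t) _; lra.
  rewrite lte_mul_pinfty ?lee_fin//.
  have : mu.-integrable setT (EFin \o (g \_ `[- N, N])).
    rewrite (_ : EFin \o _ = (EFin \o g) \_ `[- N, N]); last first.
      by apply/funext => t /=; rewrite !patchE; case: ifP.
    pose J : set (measurableTypeR R) := `[- N, N]%classic.
    have mI : measurable J by exact: measurable_itv.
    suff h : mu.-integrable J (EFin \o g)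
      by exact: ((integrable_mkcond _ mI).1 h).
    have fI : (mu J < +oo)%E.
      by rewrite /J lebesgue_measure_itv/=; case: ifP => _; rewrite -?EFinB ltry.
    apply: measurable_bounded_integrable => //; first exact: measurable_funTS mg.
    by exists M; split; [exact: num_real|move=> x Mx t _ /=; apply: le_trans (gM t) (ltW Mx)].
  have -> : g \_ `[- N, N] = g.
    apply/funext => t; rewrite patchE; case: ifPn => //.
    rewrite notin_setE /= in_itv/= -ler_norml => /negP; rewrite -ltNge => /g0 ->.
    by [].
  by case/integrableP.
move=> eps eps0.
have eC : 0 < (eps / 2) `^ p / (C + 1) by rewrite divr_gt0 ?powR_gt0 ?divr_gt0 ?ltr_wpDl.
have [d d0 hd] := L1_translation mg gM g0 N0 eC.
exists d => // h hh.
pose k t := g (t + h) - g t.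
have mk : measurable_fun setT k.
  by apply: measurable_funB => //; apply: (measurableT_comp mg); exact: measurable_shift.
have k2 t : `|k t| <= 2 * M.
  by apply: le_trans (ler_normB _ _) _; have := gM t; have := gM (t + h); lra.
have -> : (fun t => g (t + h) *: e nu - g t *: e nu) = (fun t => k t *: e nu).
  by apply/funext => t; rewrite scalerBl.
have I : (Lp_integral H p (fun t => k t *: e nu) <= ((eps / 2) `^ p)%:E)%E.
  apply: le_trans (bound _ mk k2) _.
  apply: le_trans (lee_wpmul2l _ (hd _ hh)) _; first by rewrite lee_fin.
  rewrite -EFinM lee_fin mulrA ler_pdivrMr ?ltr_wpDl// mulrC ler_wpM2l ?powR_ge0//.
  by rewrite lerDl.
apply: (@le_lt_trans _ _ (eps / 2)); last by lra.
by apply/(Lp_norm_le hp) => //; [apply: le_lt_trans I _; exact: ltry|rewrite divr_ge0// ltW].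
Qed.

Lemma Lp_continuousD v w : in_Lp H p v -> in_Lp H p w ->
  Lp_continuous v -> Lp_continuous w -> Lp_continuous (fun t => v t + w t).
Proof.
move=> lv lw cv cw eps eps0; have e2 : 0 < eps / 2 by rewrite divr_gt0.
have [d d0 hd] := cv _ e2; have [d' d'0 hd'] := cw _ e2.
exists (Num.min d d'); first by rewrite lt_min d0.
move=> h; rewrite lt_min => /andP[h1 h2].
have -> : (fun t => v (t + h) + w (t + h) - (v t + w t)) =
    (fun t => (v (t + h) - v t) + (w (t + h) - w t)).
  by apply/funext => t; rewrite opprD addrACA.
have [l1 _] := in_LpB cH hp (in_Lp_shift cH hp h lv) lv.
have [l2 _] := in_LpB cH hp (in_Lp_shift cH hp h lw) lw.
have [_] := in_LpD cH hp l1 l2; move/le_lt_trans; apply.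
by rewrite (splitr eps) ltrD ?hd ?hd'.
Qed.

(** Strong continuity passes to limits because translations are isometries. *)
Lemma Lp_continuous_lim v : in_Lp H p v ->
  (forall eps : R, 0 < eps -> exists w, [/\ in_Lp H p w, Lp_continuous w &
     Lp_norm H p (fun t => v t - w t) < eps]) -> Lp_continuous v.
Proof.
move=> lv happ eps eps0; have e3 : 0 < eps / 3 by rewrite divr_gt0.
have [w [lw cw vw]] := happ _ e3; have [d d0 hd] := cw _ e3.
exists d => // h hh.
have [l1 _] := in_LpB cH hp lv lw.
have [l2 _] := in_LpB cH hp (in_Lp_shift cH hp h lw) lw.
have lh := in_Lp_shift cH hp h l1.
have -> : (fun t => v (t + h) - v t) = (fun t => (v (t + h) - w (t + h)) +
    ((w (t + h) - w t) - (v t - w t))).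
  by apply/funext => t; rewrite opprB !addrA !subrK.
have [l3 n3] := in_LpB cH hp l2 l1; have [_ n4] := in_LpD cH hp lh l3.
apply: le_lt_trans n4 _; have := hd _ hh.
rewrite (Lp_norm_shift H p h (fun t => v t - w t)); lra.
Qed.

(** Truncating the values, the arguments and the number of the coordinates gives
finite sums of bounded functions of bounded support times unit vectors, for which
continuity in mean suffices. They converge in L^p by dominated convergence. *)
Theorem Lp_translation_continuous v : in_Lp H p v -> Lp_continuous v.
Proof.
suff case_meas w : coord_measurable H c w -> in_Lp H p w -> Lp_continuous w.
  move=> lv eps eps0; have [w [nw vw lw]] := in_Lp_coord_measurable cH hp lv.
  have [d d0 hd] := case_meas _ nw lw _ eps0; exists d => // h hh.
  rewrite (Lp_norm_ae H p (w := fun t => w (t + h) - w t)) ?hd//.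
  have vwh := ae_shift h (P := fun t => v t = w t) vw.
  by apply: filterS2 vw vwh => t -> ->.
move=> [hw mw] lw; have nw : coord_measurable H c w by [].
pose I N nu t : R := `[< `|t| <= N%:R /\ `|c nu (w t)| <= N%:R >]%:R.
pose g N nu t := c nu (w t) * I N nu t.
pose s N t := \sum_(0 <= nu < N) g N nu t *: e nu.
have mI N nu : measurable_fun setT (fun t : R => I N nu t).
  have mD : measurable ((fun t : R => `|t|) @^-1` `]-oo, N%:R] `&`
      (fun t : R => `|c nu (w t)|) @^-1` `]-oo, N%:R]).
    have m1 : measurable_fun setT (fun t : R => `|t|) by exact: measurableT_comp.
    have m2 : measurable_fun setT (fun t : R => `|c nu (w t)|) by apply: measurableT_comp => //; exact: mw.
    apply: measurableI; rewrite -[X in measurable X]setTI.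
      by apply: m1 => //; exact: measurable_itv.
    by apply: m2 => //; exact: measurable_itv.
  have -> : (fun t : R => I N nu t) = \1_((fun t : R => `|t|) @^-1` `]-oo, N%:R] `&`
      (fun t : R => `|c nu (w t)|) @^-1` `]-oo, N%:R]).
    apply/funext => t; rewrite /I indicE; case: asboolP => ht.
      by rewrite mem_set//= !in_itv/=.
    by rewrite memNset//= !in_itv/=.
  exact: measurable_indic.
have mg N nu : measurable_fun setT (fun t : R => g N nu t).
  by apply: measurable_funM; [exact: mw|exact: mI].
have I01 N nu t : 0 <= I N nu t <= 1.
  by rewrite /I; case: asboolP => _; rewrite ?lexx ?ler01.
have gc N nu t : `|g N nu t| <= `|c nu (w t)|.
  rewrite /g normrM ler_piMr//; case/andP: (I01 N nu t) => h0 h1.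
  by rewrite ger0_norm.
have gN N nu t : `|g N nu t| <= N%:R.
  by rewrite /g /I; case: asboolP => [[_ h]|_]; rewrite ?mulr1// mulr0 normr0.
have g0 N nu t : N%:R < `|t| -> g N nu t = 0.
  by move=> h; rewrite /g /I; case: asboolP => [[h' _]|_]; rewrite ?mulr0//; lra.
have elem N nu := Lp_continuous_elem nu (mg N nu) (gN N nu) (g0 N nu) (ler0n _ N).
have csk N k : in_Lp H p (fun t => \sum_(0 <= nu < k) g N nu t *: e nu) /\
    Lp_continuous (fun t => \sum_(0 <= nu < k) g N nu t *: e nu).
  elim: k => [|k [IH1 IH2]].
    rewrite (_ : (fun t => _) = (fun=> 0)); last by apply/funext => t; rewrite big_nil.
    split; first exact (in_Lp0 cH hp).
    move=> eps eps0; exists 1 => // h _; under eq_fun do rewrite subrr.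
    have [_] := in_LpZ cH hp 0 (in_Lp0 cH hp); rewrite normr0 mul0r.
    by under eq_fun do rewrite scaler0; move/le_lt_trans; apply.
  rewrite (_ : (fun t => _) = (fun t => \sum_(0 <= nu < k) g N nu t *: e nu + g N k t *: e k)).
    have [E1 E2] := elem N k; split; first exact (in_LpD cH hp IH1 E1).1.
    exact: Lp_continuousD.
  by apply/funext => t; rewrite big_nat_recr.
have cs N : in_Lp H p (s N) /\ Lp_continuous (s N) by exact: csk.
apply: Lp_continuous_lim => // eps eps0.
have hs N t : hset H (s N t).
  by apply: (hset_sum cH) => nu; apply: (hsetZ cH); exact (hset_e cH nu).
have ns N : coord_measurable H c (s N).
  split=> // nu; rewrite /s; under eq_fun do rewrite (coord_sum cH).
  apply: measurable_sum => m; under eq_fun do rewrite (coordZ cH).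
  by apply: measurable_funM; [exact: mg|exact: measurable_cst].
have dom N t : hnorm H (w t - s N t) <= hnorm H (w t).
  apply: hnorm_mono => //; first exact (hsetB cH (hw t) (hs N t)).
  move=> nu; rewrite (coordB cH) (coord_comb cH N (fun m => g N m t)).
  case: ifP => _; last by rewrite subr0.
  rewrite /g mulrAC [c nu (w t) * _]mulrC (ch_e1 cH) -{1}[c nu (w t)]mulr1 -mulrBr normrM.
  rewrite ler_piMr//; case/andP: (I01 N nu t) => h0 h1.
  by rewrite ger0_norm; lra.
have cvg_t t : hnorm H (w t - s N t) @[N --> \oo] --> (0 : R).
  apply: (hnorm_approx cH (a := fun N nu => g N nu t)) => //.
    move=> nu; apply: cvg_near_cst.
    exists (maxn (Num.truncn `|t|).+1 (Num.truncn `|c nu (w t)|).+1) => // N /=.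
    rewrite geq_max => /andP[N1 N2]; rewrite /g /I asboolT ?mulr1//; split.
      by apply: ltW; apply: lt_le_trans (truncnS_gt _) _; rewrite ler_nat.
    by apply: ltW; apply: lt_le_trans (truncnS_gt _) _; rewrite ler_nat.
  move=> N nu; rewrite /g -{1}[c nu (w t)]mulr1 -mulrBr normrM ler_piMr//.
  by case/andP: (I01 N nu t) => h0 h1; rewrite ger0_norm; lra.
pose df N t := w t - s N t.
have cvg_I : (Lp_integral H p (df N) @[N --> \oo] --> 0)%E.
  have [] := @dominated_convergence _ _ R mu setT measurableT
    (fun N t => (hnorm H (df N t) `^ p)%:E) (fun=> 0%E)
    (fun t => (hnorm H (w t) `^ p)%:E).
  - by move=> N; apply: (coord_measurable_powR cH p); exact: (coord_measurableB cH).
  - exact: measurable_cst.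
  - apply: aeW => t _; apply/fine_cvgP; split; first exact: nearW.
    apply: (@squeeze_cvgr _ _ _ _ (fun=> 0) (fun N => hnorm H (w t) `^ (p - 1) * hnorm H (w t - s N t))).
    + apply: nearW => N /=; rewrite powR_ge0 /=.
      by apply: powR_le_lin; [exact: hnorm_ge0|exact: dom].
    + exact: cvg_cst.
    + by rewrite -[X in _ --> X](mulr0 (hnorm H (w t) `^ (p - 1))); apply: cvgM => //; exact: cvg_cst.
  - apply/integrableP; split; first exact (coord_measurable_powR cH p nw).
    apply: le_lt_trans (in_Lp_fin hp lw); rewrite /Lp_integral le_eqVlt; apply/orP; left; apply/eqP.
    by apply: eq_integral => t _; rewrite gee0_abs// lee_fin powR_ge0.
  - apply: aeW => t N _; rewrite gee0_abs ?lee_fin ?powR_ge0//.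
    rewrite ge0_ler_powR ?nnegrE ?hnorm_ge0 ?(ltW p0)//; exact: dom.
  by move=> _ _; rewrite integral0.
have e2 : 0 < (eps / 2) `^ p by apply: powR_gt0; rewrite divr_gt0.
have /fine_cvgP[fin /cvgrPdist_le /(_ _ e2)] := cvg_I.
move=> /(filterI fin) [N _ /(_ N (leqnn N)) [/= fN hN]].
have [c1 c2] := cs N; exists (s N); split=> //.
apply: (@le_lt_trans _ _ (eps / 2)); last by lra.
apply/(Lp_norm_le hp); [by rewrite -ge0_fin_numE ?Lp_integral_ge0|by rewrite divr_ge0// ltW|].
rewrite -(fineK fN) lee_fin; rewrite sub0r normrN in hN.
exact: le_trans (ler_norm _) hN.
Qed.

End Lp_translation.

(** * Test functions and weak derivatives *)

Section test_functions.
Context (R : realType) (X : lmodType R) (H : hilb X).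
Context (c : nat -> X -> R) (wt : nat -> R) (e : nat -> X).
Hypothesis cH : coord_hilb H c wt e.
Local Notation mu := (@lebesgue_measure R).
Implicit Types (phi psi : R -> X) (x d : X).

Lemma is_derive_cvg (g : R -> R) (t d : R) : is_derive t 1 g d ->
  (s^-1 * (g (t + s) - g t)) @[s --> (0 : R)^'] --> d.
Proof.
move=> [dg <-]; have := dg; rewrite /derivable => /cvg_ex[l hl].
have -> : 'D_1 g t = l by exact: cvg_lim hl.
apply: cvg_trans hl; apply: near_eq_cvg; near=> s.
by rewrite /= -[s *: 1]/(s * 1) mulr1 [s + t]addrC.
Unshelve. all: by end_near. Qed.

Lemma hnorm_eq0 x : hset H x -> hnorm H x = 0 -> x = 0.
Proof.
move=> hx x0; apply: (ch_inj cH) => nu; rewrite (coord0 cH).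
have := coord_le_hnorm cH nu hx; rewrite x0 pmulr_rle0 ?sqrtr_gt0 ?(ch_wt cH)//.
by rewrite normr_le0 => /eqP.
Qed.

Section hderiv.
Variables (phi : R -> X) (t : R) (d : X).
Hypotheses (hphi : forall s, hset H (phi s)) (hd : hset H d)
  (dphi : has_hderiv H phi t d).

Lemma hderiv_continuous : hnorm H (phi (t + s) - phi t) @[s --> (0 : R)^'] --> (0 : R).
Proof.
have h0 : (`|s| * (hnorm H (s^-1 *: (phi (t + s) - phi t) - d) + hnorm H d))
    @[s --> (0 : R)^'] --> (0 : R).
  rewrite -[X in _ --> X](mul0r (0 + hnorm H d)); apply: cvgM.
    by have /continuous_withinNx := @norm_continuous _ R (0 : R); rewrite normr0.
  by apply: cvgD => //; exact: cvg_cst.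
apply: (squeeze_cvgr _ (cvg_cst 0) h0).
near=> s; rewrite hnorm_ge0/=.
have s0 : s != 0 by near: s; exact: nbhs_dnbhs_neq.
have hp := hsetB cH (hphi (t + s)) (hphi t).
have hq := hsetZ cH s^-1 hp.
have E : phi (t + s) - phi t = s *: (s^-1 *: (phi (t + s) - phi t)).
  by rewrite scalerA mulfV// scale1r.
rewrite {1}E (hnormZ cH _ hq) ler_wpM2l//.
by have := hnormD cH (hsetB cH hq hd) hd; rewrite subrK.
Unshelve. all: by end_near. Qed.

Lemma hderiv_scale (g : R -> R) (g' : R) : is_derive t 1 g g' ->
  has_hderiv H (fun s => g s *: phi s) t (g' *: phi t + g t *: d).
Proof.
move=> /is_derive_cvg dg.
pose q s := `|s^-1 * (g (t + s) - g t) - g'|.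
pose r s := hnorm H (phi (t + s) - phi t).
pose z s := hnorm H (s^-1 *: (phi (t + s) - phi t) - d).
have q0 : q s @[s --> (0 : R)^'] --> (0 : R).
  rewrite -[X in _ --> X](_ : `|g' - g'| = 0); last by rewrite subrr normr0.
  by apply: cvg_norm; apply: cvgB; [exact: dg|exact: cvg_cst].
have h0 : (q s * (r s + hnorm H (phi t)) + (`|g'| * r s + `|g t| * z s))
    @[s --> (0 : R)^'] --> (0 : R).
  rewrite -[X in _ --> X](_ : 0 * (0 + hnorm H (phi t)) + (`|g'| * 0 + `|g t| * 0) = 0); last by ring.
  apply: cvgD; first by apply: cvgM; [exact: q0|apply: cvgD; [exact: hderiv_continuous|exact: cvg_cst]].
  by apply: cvgD; (apply: cvgM; first exact: cvg_cst); [exact: hderiv_continuous|exact: dphi].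
apply: (squeeze_cvgr _ (cvg_cst 0) h0).
near=> s; rewrite hnorm_ge0/=.
have hp := hsetB cH (hphi (t + s)) (hphi t).
have hq := hsetZ cH s^-1 hp.
set a := s^-1 * (g (t + s) - g t) - g'.
have -> : s^-1 *: (g (t + s) *: phi (t + s) - g t *: phi t) - (g' *: phi t + g t *: d) =
    a *: phi (t + s) + (g' *: (phi (t + s) - phi t) +
     g t *: (s^-1 *: (phi (t + s) - phi t) - d)).
  by apply: (ch_inj cH) => nu; rewrite !(coordD cH, coordN cH, coordZ cH) /a; ring.
apply: le_trans (hnormD cH _ _) _.
- exact: (hsetZ cH).
- by apply: (hsetD cH); apply: (hsetZ cH) => //; exact: (hsetB cH).
apply: lerD.
  rewrite (hnormZ cH)// ler_wpM2l//.
  by have := hnormD cH hp (hphi t); rewrite subrK.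
apply: le_trans (hnormD cH _ _) _; try (by apply: (hsetZ cH) => //; exact: (hsetB cH)).
by rewrite !(hnormZ cH)//; exact: (hsetB cH).
Unshelve. all: by end_near. Qed.

End hderiv.

Lemma hderivD phi psi t d d' : (forall s, hset H (phi s)) -> (forall s, hset H (psi s)) ->
  hset H d -> hset H d' -> has_hderiv H phi t d -> has_hderiv H psi t d' ->
  has_hderiv H (fun s => phi s + psi s) t (d + d').
Proof.
move=> hphi hpsi hd hd' dphi dpsi.
have h0 : (hnorm H (s^-1 *: (phi (t + s) - phi t) - d) +
    hnorm H (s^-1 *: (psi (t + s) - psi t) - d')) @[s --> (0 : R)^'] --> (0 : R).
  by rewrite -[X in _ --> X](addr0 0); exact: cvgD.
apply: (squeeze_cvgr _ (cvg_cst 0) h0).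
near=> s; rewrite hnorm_ge0/=.
have -> : s^-1 *: (phi (t + s) + psi (t + s) - (phi t + psi t)) - (d + d') =
   (s^-1 *: (phi (t + s) - phi t) - d) + (s^-1 *: (psi (t + s) - psi t) - d').
  by rewrite !opprD addrACA scalerDr addrACA.
by apply: (hnormD cH); apply: (hsetB cH) => //; apply: (hsetZ cH); exact: (hsetB cH).
Unshelve. all: by end_near. Qed.

Lemma hderiv0 t : has_hderiv H (fun=> 0) t 0.
Proof.
rewrite /has_hderiv; under eq_fun do rewrite subrr scaler0 subrr (hnorm0 cH).
exact: cvg_cst.
Qed.

Lemma hderiv_shift phi t tau d : has_hderiv H phi (t + tau) d ->
  has_hderiv H (fun s => phi (s + tau)) t d.
Proof.
rewrite /has_hderiv => h.
rewrite (_ : (fun s => _) = (fun s => hnorm H (s^-1 *: (phi (t + tau + s) - phi (t + tau)) - d)))//.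
by apply/funext => s; rewrite (addrAC t s tau).
Qed.

(** Test functions and their products with smooth functions are of this kind, and
their pairing with a function in L^p is integrable. *)
Definition bounded_test phi : Prop :=
  coord_measurable H c phi /\ exists M K : R, (forall t, hnorm H (phi t) <= K) /\
    forall t, M < `|t| -> phi t = 0.

(** The difference quotients vanish outside the support, hence so do the
derivatives. *)
Lemma test_fun_support (phi : nat -> R -> X) : test_fun H phi ->
  exists M, forall i t, M < `|t| -> phi i t = 0.
Proof.
move=> [hphi dphi [M hM]]; exists M; elim=> // i IH t ht.
apply: hnorm_eq0 => //.
have c1 : hnorm H (phi i.+1 t) @[s --> (0 : R)^'] --> (0 : R).
  apply: cvg_trans (dphi i t); apply: near_eq_cvg.
  have d0 : 0 < `|t| - M by rewrite subr_gt0.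
  apply: nbhs_dnbhs; exists (`|t| - M) => //= s /=; rewrite sub0r normrN => hs.
  rewrite (IH t)// (IH (t + s)) ?subrr ?scaler0 ?sub0r ?(hnormN cH)//.
  by have := ler_normB (t + s) s; rewrite addrK; lra.
by apply: cvg_unique c1 => //; exact: cvg_cst.
Qed.

Lemma hderiv_near phi t : (forall s, hset H (phi s)) ->
  (exists2 d, hset H d & has_hderiv H phi t d) ->
  hnorm H (phi s - phi t) @[s --> t] --> (0 : R).
Proof.
move=> hphi [d hd dphi]; have h := hderiv_continuous hphi hd dphi.
apply/cvgrPdist_lt => eps eps0.
have /cvgrPdist_lt /(_ _ eps0) [r /= r0 hr] := h.
exists r => //= s; rewrite /ball_ /= => ts.
have [->|st] := eqVneq s t; first by rewrite subrr (hnorm0 cH) subrr normr0.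
have := hr (s - t); rewrite /ball_ /= sub0r normrN distrC => /(_ ts).
by rewrite subr_eq0 => /(_ st); rewrite (addrC t) subrK.
Qed.

Lemma test_fun_bounded (phi : nat -> R -> X) i : test_fun H phi -> bounded_test (phi i).
Proof.
move=> tphi; have [M hM] := test_fun_support tphi; case: tphi => hphi dphi _.
have near0 t : hnorm H (phi i s - phi i t) @[s --> t] --> (0 : R).
  by apply: hderiv_near => //; exists (phi i.+1 t).
have cn : continuous (fun t => hnorm H (phi i t) : R).
  move=> t; apply/cvgrPdist_lt => eps eps0.
  have /cvgrPdist_lt /(_ _ eps0) := near0 t; apply: filterS => s.
  rewrite sub0r normrN ger0_norm ?hnorm_ge0//; apply: le_lt_trans.
  by rewrite distrC; exact: (hnorm_distl cH).
have cc nu : continuous (fun t => c nu (phi i t) : R).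
  move=> t; apply/cvgrPdist_lt => eps eps0.
  have sw : 0 < Num.sqrt (wt nu) by rewrite sqrtr_gt0 (ch_wt cH).
  have /cvgrPdist_lt /(_ _ (mulr_gt0 sw eps0)) := near0 t; apply: filterS => s.
  rewrite sub0r normrN ger0_norm ?hnorm_ge0// => hs.
  rewrite -(ltr_pM2l sw) distrC -(coordB cH); apply: le_lt_trans hs.
  by apply: (coord_le_hnorm cH); exact: (hsetB cH).
split.
  by split=> // nu; exact: continuous_measurable_fun (cc nu).
have [K hK] : exists K, forall t, t \in `[- M, M] -> hnorm H (phi i t) <= K.
  have [M0|M0] := leP (- M) M; last first.
    by exists 0 => t; rewrite in_itv/= => /andP[h1 h2]; lra.
  have [t0 _ ht0] := EVT_max M0 (@continuous_subspaceT _ _ _ _ cn).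
  by exists (hnorm H (phi i t0)).
exists M, (Num.max K 0); split=> [t|t]; last exact: hM.
rewrite le_max; have [tM|tM] := ltP M `|t|.
  by rewrite hM// (hnorm0 cH) lexx orbT.
by rewrite hK// in_itv/= -ler_norml.
Qed.

Lemma test_fun_shift tau (phi : nat -> R -> X) : test_fun H phi ->
  test_fun H (fun i t => phi i (t + tau)).
Proof.
move=> [hphi dphi [M hM]]; split=> [i t|i t|] //.
  exact: (hderiv_shift (phi := phi i)).
exists (M + `|tau|) => t ht; apply: hM.
by have := ler_normB (t + tau) tau; rewrite addrK; lra.
Qed.

(** Leibniz' rule without binomial coefficients: the summands of the [i]-th
derivative of a product, as pairs of orders of differentiation. *)
Fixpoint leibniz (i : nat) : seq (nat * nat) :=
  if i is j.+1 then [seq (ab.1.+1, ab.2) | ab <- leibniz j] ++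
                    [seq (ab.1, ab.2.+1) | ab <- leibniz j]
  else [:: (0, 0)]%N.

Lemma test_fun_mul (g : nat -> R -> R) (phi : nat -> R -> X) :
  (forall i (t : R), is_derive t (1 : R) (g i) (g i.+1 t)) -> test_fun H phi ->
  test_fun H (fun i t => \sum_(ab <- leibniz i) g ab.1 t *: phi ab.2 t).
Proof.
move=> dg tphi; have [M hM] := test_fun_support tphi; case: (tphi) => hphi dphi _.
split=> [i t|i t|].
- by apply: (hset_sum cH) => ab; exact: (hsetZ cH).
- rewrite /= big_cat /= !big_map /= -big_split /=.
  elim: (leibniz i) => [|ab s IH].
    by rewrite big_nil; under eq_fun do rewrite big_nil; exact: hderiv0.
  rewrite big_cons; under eq_fun do rewrite big_cons.
  have hm : hset H (\sum_(j <- s) (g j.1.+1 t *: phi j.2 t + g j.1 t *: phi j.2.+1 t)).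
    by apply: (hset_sum cH) => j; apply: (hsetD cH); exact: (hsetZ cH).
  apply: (hderivD (phi := fun r => g ab.1 r *: phi ab.2 r)
    (psi := fun r => \sum_(j <- s) g j.1 r *: phi j.2 r)) => //.
  + by move=> r; exact: (hsetZ cH).
  + by move=> r; apply: (hset_sum cH) => j; exact: (hsetZ cH).
  + by apply: (hsetD cH); exact: (hsetZ cH).
  + exact (hderiv_scale (hphi ab.2) (hphi ab.2.+1 t) (dphi ab.2 t) (dg ab.1 t)).
- by exists M => t ht; rewrite big_seq1 hM// scaler0.
Qed.

Lemma test_fun_e (g : nat -> R -> R) M nu :
  (forall i (t : R), is_derive t (1 : R) (g i) (g i.+1 t)) -> (forall t, M < `|t| -> g 0%N t = 0) ->
  test_fun H (fun i t => g i t *: e nu).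
Proof.
move=> dg g0; have he := hset_e cH nu; split=> [i t|i t|].
- exact: (hsetZ cH).
- have d0 : has_hderiv H (fun=> e nu) t 0.
    rewrite /has_hderiv; under eq_fun do rewrite subrr scaler0 subrr (hnorm0 cH).
    exact: cvg_cst.
  have := hderiv_scale (fun=> he) (hset0 cH) d0 (dg i t).
  by rewrite scaler0 addr0.
- by exists M => t ht; rewrite g0// scale0r.
Qed.

End test_functions.

Section weak_derivatives.
Context (R : realType) (X : lmodType R) (H : hilb X).
Context (c : nat -> X -> R) (wt : nat -> R) (e : nat -> X).
Hypothesis cH : coord_hilb H c wt e.
Context (p : R) (hp : 1 < p).
Local Notation mu := (@lebesgue_measure R).
Implicit Types (v w chi : R -> X).

Lemma le_one_powR (x : R) : 0 <= x -> x <= 1 + x `^ p.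
Proof.
move=> x0; have [x1|/ltW x1] := leP 1 x.
  by apply: le_trans (le1r_powR x1 (ltW hp)) _; rewrite lerDr.
by apply: le_trans x1 _; rewrite lerDl powR_ge0.
Qed.

Lemma pairing_measurable v chi : coord_measurable H c v -> coord_measurable H c chi ->
  measurable_fun setT (fun t : R => hip H (v t) (chi t)).
Proof.
move=> [hv mv] [hchi mchi].
apply: (measurable_fun_cvg (h := fun N t => psum c wt (v t) (chi t) N)).
  move=> N; rewrite /psum; apply: measurable_sum => nu.
  apply: measurable_funM; last exact: mchi.
  by apply: measurable_funM; [exact: measurable_cst|exact: mv].
by move=> t _; exact (cvg_psum cH (hv t) (hchi t)).
Qed.

Lemma hnorm_powR_integrable v : coord_measurable H c v -> in_Lp H p v ->
  mu.-integrable setT (fun t => (hnorm H (v t) `^ p)%:E).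
Proof.
move=> nv lv; apply/integrableP; split; first exact (coord_measurable_powR cH p nv).
apply: le_lt_trans (in_Lp_fin hp lv); rewrite le_eqVlt; apply/orP; left; apply/eqP.
by apply: eq_integral => t _; rewrite gee0_abs// lee_fin powR_ge0.
Qed.

Lemma pairing_integrable v chi : coord_measurable H c v -> in_Lp H p v -> bounded_test H c chi ->
  mu.-integrable setT (EFin \o (fun t => hip H (v t) (chi t))).
Proof.
move=> nv lv [nchi [M [K [hK hM]]]].
have K0 : 0 <= K := le_trans (hnorm_ge0 _ _) (hK 0).
pose J : set (measurableTypeR R) := `[- M, M]%classic.
have mJ : measurable J by exact: measurable_itv.
have i1 : mu.-integrable setT (fun t => (\1_J t)%:E : \bar R).
  exact: integrable_indic_itv.
have i2 := hnorm_powR_integrable nv lv.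
apply: le_integrable (integrableZl measurableT K (integrableD measurableT i1 i2)) => //.
  by apply/measurable_EFinP; exact: pairing_measurable.
move=> t _ /=; rewrite lee_fin [leRHS]ger0_norm; last first.
  by rewrite mulr_ge0// addr_ge0// powR_ge0.
have [tM|tM] := ltP M `|t|.
  rewrite hM// -(scale0r 0) (hipZr cH) ?mul0r ?normr0 ?mulr_ge0 ?addr_ge0 ?powR_ge0//.
    exact (hset0 cH).
  exact: nv.1.
apply: le_trans (hip_CS cH (nv.1 t) (nchi.1 t)) _; rewrite mulrC.
apply: ler_pM; rewrite ?hnorm_ge0 ?hK//.
have Jt : J t by rewrite /J /= in_itv /= -ler_norml.
by rewrite indicE (mem_set Jt) le_one_powR ?hnorm_ge0.
Qed.

Definition pairing v chi : R := \int[mu]_t hip H (v t) (chi t).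

Lemma pairing_ae v w chi : {ae mu, forall t, v t = w t} -> pairing v chi = pairing w chi.
Proof. by move=> vw; apply: Rintegral_ae; apply: filterS vw => t ->. Qed.

Lemma pairingDl v w chi : in_Lp H p v -> in_Lp H p w -> bounded_test H c chi ->
  pairing (fun t => v t + w t) chi = pairing v chi + pairing w chi.
Proof.
move=> lv lw bchi; have [v' [nv vv' lv']] := in_Lp_coord_measurable cH hp lv.
have [w' [nw ww' lw']] := in_Lp_coord_measurable cH hp lw.
rewrite (pairing_ae chi vv') (pairing_ae chi ww').
rewrite (pairing_ae chi (w := fun t => v' t + w' t)); last first.
  by apply: filterS2 vv' ww' => t -> ->.
rewrite /pairing -RintegralD//; [|exact: pairing_integrable..].
by apply: eq_Rintegral => t _; exact (hipDl cH (nv.1 t) (nw.1 t) (bchi.1.1 t)).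
Qed.

Lemma pairingDr v chi chi' : in_Lp H p v -> bounded_test H c chi -> bounded_test H c chi' ->
  pairing v (fun t => chi t + chi' t) = pairing v chi + pairing v chi'.
Proof.
move=> lv b b'; have [v' [nv vv' lv']] := in_Lp_coord_measurable cH hp lv.
rewrite !(pairing_ae _ vv') /pairing -RintegralD//; [|exact: pairing_integrable..].
by apply: eq_Rintegral => t _; exact (hipDr cH (b.1.1 t) (b'.1.1 t) (nv.1 t)).
Qed.

Lemma pairingZl a v chi : in_Lp H p v -> bounded_test H c chi ->
  pairing (fun t => a *: v t) chi = a * pairing v chi.
Proof.
move=> lv b; have [v' [nv vv' lv']] := in_Lp_coord_measurable cH hp lv.
rewrite (pairing_ae chi vv') (pairing_ae chi (w := fun t => a *: v' t)); last first.
  by apply: filterS vv' => t ->.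
rewrite /pairing -RintegralZl//; last exact: pairing_integrable.
by apply: eq_Rintegral => t _; exact (hipZl cH _ (nv.1 t) (b.1.1 t)).
Qed.

Lemma pairingM (g : R -> R) v chi : {ae mu, forall t, hset H (v t)} ->
  (forall t, hset H (chi t)) ->
  pairing (fun t => g t *: v t) chi = pairing v (fun t => g t *: chi t).
Proof.
move=> hv hchi; apply: Rintegral_ae; apply: filterS hv => t hvt.
by rewrite (hipZl cH)// (hipZr cH).
Qed.

Lemma pairing_shift tau v chi :
  pairing (fun t => v (t + tau)) chi = pairing v (fun t => chi (t - tau)).
Proof.
rewrite /pairing -(Rintegral_shift tau (fun t => hip H (v t) (chi (t - tau)))).
by apply: eq_Rintegral => t _; rewrite addrK.
Qed.

Lemma weak_deriv_ae v v' w w' : {ae mu, forall t, v t = v' t} -> {ae mu, forall t, w t = w' t} ->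
  is_weak_deriv H v w -> is_weak_deriv H v' w'.
Proof.
move=> vv ww h phi tphi.
have := h _ tphi; rewrite -[LHS]/(pairing v (phi 1%N)) -[X in - X]/(pairing w (phi 0%N)).
by rewrite (pairing_ae _ vv) (pairing_ae _ ww).
Qed.

Lemma weak_deriv_lin a v v' w w' : in_Lp H p v -> in_Lp H p v' -> in_Lp H p w -> in_Lp H p w' ->
  is_weak_deriv H v w -> is_weak_deriv H v' w' ->
  is_weak_deriv H (fun t => a *: v t + v' t) (fun t => a *: w t + w' t).
Proof.
move=> lv lv' lw lw' h h' phi tphi.
have b0 := test_fun_bounded cH 0 tphi; have b1 := test_fun_bounded cH 1 tphi.
rewrite -[LHS]/(pairing _ (phi 1%N)) -[X in - X]/(pairing _ (phi 0%N)).
have [lav _] := in_LpZ cH hp a lv; have [law _] := in_LpZ cH hp a lw.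
rewrite !pairingDl// !pairingZl//.
by rewrite [pairing v _]h// [pairing v' _]h'// /pairing; ring.
Qed.

Lemma weak_deriv_shift tau v w : is_weak_deriv H v w ->
  is_weak_deriv H (fun t => v (t + tau)) (fun t => w (t + tau)).
Proof.
move=> h phi tphi; rewrite -[LHS]/(pairing _ (phi 1%N)) -[X in - X]/(pairing _ (phi 0%N)).
by rewrite !pairing_shift; exact: h _ (test_fun_shift (- tau) tphi).
Qed.

(** The product of [g 0] with a test function is a test function, by Leibniz' rule,
so the factor can be moved from [v] to the test function. *)
Lemma weak_deriv_mul (g : nat -> R -> R) v w :
  (forall i (t : R), is_derive t (1 : R) (g i) (g i.+1 t)) ->
  in_Lp H p v -> in_Lp H p w -> is_weak_deriv H v w ->
  is_weak_deriv H (fun t => g 0%N t *: v t) (fun t => g 1%N t *: v t + g 0%N t *: w t).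
Proof.
move=> dg lv lw h phi tphi; have tpsi := test_fun_mul cH dg tphi.
have := h _ tpsi; rewrite -[LHS]/(pairing v _) -[X in - X]/(pairing w _).
have tphi1 : test_fun H (fun i => phi i.+1).
  have [M hM] := test_fun_support cH tphi; case: tphi => h1 h2 _.
  by split=> [i t|i t|] //; exists M => t; exact: hM.
have E (k : nat -> R -> R) (ph : nat -> R -> X) :
    (fun t => \sum_(ab <- leibniz 0) k ab.1 t *: ph ab.2 t) = (fun t => k 0%N t *: ph 0%N t).
  by apply/funext => t; rewrite big_seq1.
have b10 : bounded_test H c (fun t => g 1%N t *: phi 0%N t).
  rewrite -(E (fun i => g i.+1) phi).
  exact (test_fun_bounded cH 0 (test_fun_mul cH (g := fun i => g i.+1) (fun i => dg i.+1) tphi)).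
have b01 : bounded_test H c (fun t => g 0%N t *: phi 1%N t).
  rewrite -(E g (fun i => phi i.+1)).
  exact (test_fun_bounded cH 0 (test_fun_mul cH dg tphi1)).
have b00 : bounded_test H c (fun t => g 0%N t *: phi 0%N t).
  by rewrite -(E g phi); exact (test_fun_bounded cH 0 tpsi).
rewrite (E g phi).
have -> : (fun t => \sum_(ab <- leibniz 1) g ab.1 t *: phi ab.2 t) =
    (fun t => g 1%N t *: phi 0%N t + g 0%N t *: phi 1%N t).
  by apply/funext => t; rewrite big_cons big_seq1.
rewrite pairingDr// => hh.
have hphi := (let: And3 h0 _ _ := tphi in h0).
rewrite -[LHS]/(pairing _ (phi 1%N)) pairingM//; last exact: lv.1.1.
have -> : \int[mu]_t hip H (g 1%N t *: v t + g 0%N t *: w t) (phi 0%N t) =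
    pairing v (fun t => g 1%N t *: phi 0%N t) + pairing w (fun t => g 0%N t *: phi 0%N t).
  have [v' [nv vv' lv']] := in_Lp_coord_measurable cH hp lv.
  have [w' [nw ww' lw']] := in_Lp_coord_measurable cH hp lw.
  rewrite (pairing_ae _ vv') (pairing_ae _ ww') /pairing -RintegralD//; [|exact: pairing_integrable..].
  apply: Rintegral_ae; apply: filterS2 vv' ww' => t -> ->.
  have hv' := nv.1 t; have hw' := nw.1 t.
  rewrite (hipDl cH) ?(hipZl cH) ?(hipZr cH)//; exact: (hsetZ cH).
by rewrite opprD -hh addrA addNr add0r.
Qed.

(** Each coordinate is bounded by a multiple of the norm, and [x <= 1 + x `^ p]. *)
Lemma coord_locally_integrable v nu : coord_measurable H c v -> in_Lp H p v ->
  locally_integrable setT (fun t => c nu (v t)).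
Proof.
move=> nv lv; split; [exact: nv.2|exact: openT|move=> K _ cK].
have mK : measurable (K : set (measurableTypeR R)) by exact: compact_measurable.
have fK : (mu K < +oo)%E by exact: compact_finite_measure.
have sw : 0 < Num.sqrt (wt nu) by rewrite sqrtr_gt0 (ch_wt cH).
pose k := (Num.sqrt (wt nu))^-1; have k0 : 0 <= k by rewrite invr_ge0 ltW.
have i1 : mu.-integrable K (EFin \o (fun=> 1 : R)).
  apply: measurable_bounded_integrable => //; exists 1; split; first exact: num_real.
  by move=> x x1 t _ /=; rewrite normr1 ltW.
have i2 : mu.-integrable K (fun t => (hnorm H (v t) `^ p)%:E).
  apply: integrableS (hnorm_powR_integrable nv lv) => //; exact: measurableT.
suff : mu.-integrable K (EFin \o (fun t => c nu (v t))) by case/integrableP.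
apply: le_integrable (integrableZl mK k (integrableD mK i1 i2)) => //.
  by apply/measurable_EFinP; apply: measurable_funTS; exact: nv.2.
move=> t _ /=; rewrite lee_fin [leRHS]ger0_norm; last first.
  by rewrite mulr_ge0// addr_ge0// powR_ge0.
rewrite /k -(ler_pM2l sw) mulrA mulfV ?gt_eqF// mul1r.
by apply: le_trans (coord_le_hnorm cH nu (nv.1 t)) _; exact/le_one_powR/hnorm_ge0.
Qed.

End weak_derivatives.

(** * Weak derivatives are almost everywhere derivatives of primitives *)

Section cutoff_theory.
Context (R : realType) (beta : R -> R) (hbeta : cutoff beta).
Local Notation bd i := (derive1n i beta).

Lemma bd_deriv i (t : R) : is_derive t (1 : R) (bd i) (bd i.+1 t).
Proof.
case: hbeta => db _ _ _; rewrite derive1nS derive1E.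
by apply: DeriveDef => //; exact: db.
Qed.

Lemma is_derive_continuous (f f' : R -> R) :
  (forall t : R, is_derive t (1 : R) f (f' t)) -> continuous f.
Proof. by move=> df t; apply/differentiable_continuous/derivable1_diffP; have [] := df t. Qed.

Lemma is_derive_locally_cst (f : R -> R) (s d r : R) : is_derive s (1 : R) f d -> 0 < r ->
  (forall h, `|h| < r -> f (s + h) = f s) -> d = 0.
Proof.
move=> /is_derive_cvg df r0 hf.
suff h0 : (h^-1 * (f (s + h) - f s)) @[h --> (0 : R)^'] --> (0 : R) by exact: cvg_unique df h0.
apply: cvg_near_cst; near=> h; rewrite hf ?subrr ?mulr0//.
by near: h; exact: dnbhs0_lt.
Unshelve. all: by end_near. Qed.

Lemma bd_supp i s : 1 < `|s| -> bd i.+1 s = 0.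
Proof.
move=> s1; have r0 : 0 < `|s| - 1 by rewrite subr_gt0.
elim: i s s1 r0 => [|i IH] s s1 r0; apply: (is_derive_locally_cst (bd_deriv _ s) r0) => h hh.
  case: hbeta => _ _ bm bp; rewrite derive1n0.
  have [s0|s0] := leP 0 s.
    rewrite (ger0_norm s0) in s1 hh.
    by move: hh; rewrite ltr_norml => /andP[? ?]; rewrite !bp//; lra.
  rewrite (ltr0_norm s0) in s1 hh.
  by move: hh; rewrite ltr_norml => /andP[? ?]; rewrite !bm//; lra.
have sh : 1 < `|s + h|.
  by have := ler_normB (s + h) h; rewrite addrK; lra.
by rewrite !IH// subr_gt0.
Qed.

Lemma bounded_of_supp (f : R -> R) : continuous f -> (forall s, 1 < `|s| -> f s = 0) ->
  exists2 C, 0 <= C & forall s, `|f s| <= C.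
Proof.
move=> cf f0; have cn : continuous (fun s => `|f s|).
  by move=> s; apply: continuous_comp; [exact: cf|exact: norm_continuous].
have M0 : - 1 <= 1 :> R by lra.
have [t0 _ ht0] := EVT_max M0 (@continuous_subspaceT _ _ _ _ cn).
exists `|f t0| => // s; have [s1|s1] := ltP 1 `|s|; first by rewrite f0 ?normr0.
by apply: ht0; rewrite in_itv/= -ler_norml.
Qed.

Lemma bd_bounded i : exists2 C, 0 <= C & forall s, `|bd i s| <= C.
Proof.
case: i => [|i].
  exists 1 => // s; case: hbeta => _ mono bm bp; rewrite derive1n0 ler_norml.
  have [s1|s1] := leP s (-1); first by rewrite bm// lexx; lra.
  have [s2|s2] := leP 1 s; first by rewrite bp// lexx; lra.
  have h1 := mono _ _ (ltW s1); have h2 := mono _ _ (ltW s2).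
  by rewrite (bm _ (lexx _)) in h1; rewrite (bp _ (lexx _)) in h2; rewrite h1 h2.
apply: bounded_of_supp; last exact: bd_supp.
exact: is_derive_continuous (bd_deriv i.+1).
Qed.

Lemma bd_scaled i (a N : R) (t : R) :
  is_derive t (1 : R) (fun t => bd i ((t - a) * N)) (bd i.+1 ((t - a) * N) * N).
Proof.
have dg : is_derive t (1 : R) (fun t : R => (t - a) * N) N.
  have -> : (fun t : R => (t - a) * N) = (fun t => N * t + - (a * N)).
    by apply/funext => s; ring.
  by apply: is_derive_eq; rewrite subr0 -[N *: 1]/(N * 1) mulr1.
have h : is_derive ((t - a) * N) (1 : R) (bd i) (bd i.+1 ((t - a) * N)) := bd_deriv i _.
exact (@is_derive1_comp R (bd i) (fun s => (s - a) * N) t _ _ h dg).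
Qed.

End cutoff_theory.

Section local_integrals.
Context (R : realType).
Local Notation mu := (@lebesgue_measure R).

Lemma locint_mul (f k : R -> R) (M C : R) : locally_integrable setT f ->
  measurable_fun setT k -> (forall t, `|k t| <= C) -> (forall t, M < `|t| -> k t = 0) ->
  mu.-integrable setT (EFin \o (fun t => f t * k t)).
Proof.
move=> [mf _ lf] mk kC k0; have C0 : 0 <= C := le_trans (normr_ge0 _) (kC 0).
pose J : set (measurableTypeR R) := `[- M, M]%classic.
have mJ : measurable J by exact: measurable_itv.
have iJ : mu.-integrable J (EFin \o f).
  apply/integrableP; split; last exact: (lf J (@subsetT _ _) (@segment_compact _ _ _)).
  by apply/measurable_EFinP; apply: measurable_funTS.
have iJ' := (integrable_mkcond _ mJ).1 iJ.
apply: le_integrable (integrableZl measurableT C (integrable_abse iJ')) => //.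
  by apply/measurable_EFinP; exact: measurable_funM.
move=> t _ /=; rewrite patchE; have [tM|tM] := ltP M `|t|.
  by rewrite k0// mulr0 normr0 abse_ge0.
have Jt : J t by rewrite /J /= in_itv /= -ler_norml.
rewrite (mem_set Jt) /= lee_fin normrM mulrC [leRHS]ger0_norm ?mulr_ge0//.
by rewrite ler_wpM2r.
Qed.

Lemma locint_itv (f : R -> R) (a b : R) : locally_integrable setT f ->
  mu.-integrable `[a, b]%classic (EFin \o f).
Proof.
move=> [mf _ lf]; apply/integrableP; split.
  by apply/measurable_EFinP; apply: measurable_funTS.
exact: (lf _ (@subsetT _ _) (@segment_compact _ _ _)).
Qed.

Lemma ae_neq (a : R) : {ae mu, forall t, t <> a}.
Proof.
exists [set a]; split; [exact: measurable_set1|exact: lebesgue_measure_set1|].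
by move=> t /= h; apply: contrapT => ta; apply: h.
Qed.

End local_integrals.

Section mollification.
Context (R : realType) (beta : R -> R) (hbeta : cutoff beta).
Local Notation bd i := (derive1n i beta).
Local Notation mu := (@lebesgue_measure R).

(** A mollifier at [a]: the derivative of the rescaled cutoff
[beta ((t - a) * n.+1)], which has mass 2 as [beta] increases from -1 to 1. *)
Definition kernel (a : R) (n : nat) (t : R) : R :=
  bd 1 ((t - a) * n.+1%:R) * n.+1%:R.

Lemma kernel_continuous a n : continuous (kernel a n).
Proof. exact: is_derive_continuous (fun t => is_deriveM (bd_scaled hbeta 1 a n.+1%:R t) (is_derive_cst _ _ _)). Qed.

Lemma kernel_supp a n t : (n.+1%:R)^-1 < `|t - a| -> kernel a n t = 0.
Proof.
move=> h; rewrite /kernel (bd_supp hbeta) ?mul0r// normrM (ger0_norm (ler0n _ _)).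
by rewrite -ltr_pdivrMr ?ltr0n// div1r.
Qed.

Lemma kernel_bounded : exists2 C, 0 <= C & forall a n t, `|kernel a n t| <= C * n.+1%:R.
Proof.
have [C C0 hC] := bd_bounded hbeta 1; exists C => // a n t.
by rewrite /kernel normrM (ger0_norm (ler0n _ _)) ler_wpM2r.
Qed.

Lemma kernel_supp_itv a n t : 1 < `|t - a| -> kernel a n t = 0.
Proof.
by move=> h; apply: kernel_supp; apply: le_lt_trans h; rewrite invf_le1 ?ltr0n// ler1n.
Qed.

Lemma kernel_mass a n : \int[mu]_t kernel a n t = 2.
Proof.
have [_ _ bm bp] := hbeta.
pose F t := bd 0 ((t - a) * n.+1%:R).
have ab : a - 1 < a + 1 :> R by lra.
have dF t : is_derive t (1 : R) F (kernel a n t) by exact: bd_scaled.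
have cF : continuous F by exact: is_derive_continuous dF.
have : (\int[mu]_(t in `[(a - 1)%R, (a + 1)%R]) (kernel a n t)%:E = (F (a + 1))%:E - (F (a - 1))%:E)%E.
  apply: continuous_FTC2 => //.
  - by apply: continuous_subspaceT; exact: kernel_continuous.
  - split; first by move=> t _; have [] := dF t.
      by apply: cvg_at_right_filter; exact: cF.
    by apply: cvg_at_left_filter; exact: cF.
  - by move=> t _; rewrite derive1E; have [_] := dF t.
have Fp : F (a + 1) = 1 by rewrite /F derive1n0 (addrC a) addrK mul1r bp// ler1n.
have Fm : F (a - 1) = -1.
  by rewrite /F derive1n0 (addrC a) addrK mulN1r bm// lerN2 ler1n.
rewrite Fp Fm => hF.
rewrite /Rintegral (_ : \int[mu]_t (kernel a n t)%:E = (1 - -1)%:E)%E.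
  by rewrite /=; lra.
rewrite EFinB -hF [RHS]integral_mkcond; apply: eq_integral => t _.
rewrite patchE; case: ifPn => //; rewrite notin_setE /= in_itv/= => /negP ht.
rewrite kernel_supp_itv// ltNge; apply: contra ht; rewrite ler_norml => /andP[? ?].
by apply/andP; split; lra.
Qed.

(** At a Lebesgue point the error is bounded by the mean oscillation over a ball of
radius [2 / n.+1], which contains the support of the kernel. *)
Lemma kernel_cvg (u : R -> R) a : locally_integrable setT u -> lebesgue_pt u a ->
  \int[mu]_t (u t * kernel a n t) @[n --> \oo] --> 2 * u a.
Proof.
move=> lu ua; have [C C0 hC] := kernel_bounded.
have mk n : measurable_fun setT (kernel a n) by apply: continuous_measurable_fun; exact: kernel_continuous.
have ks n t : 1 + `|a| < `|t| -> kernel a n t = 0.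
  by move=> h; apply: kernel_supp_itv; have := lerB_dist t a; lra.
have lc : locally_integrable setT (fun=> u a : R).
  split; [exact: measurable_cst|exact: openT|move=> K _ cK].
  have mK : measurable (K : set (measurableTypeR R)) by exact: compact_measurable.
  rewrite integral_cst// lte_mul_pinfty ?lee_fin//; exact: compact_finite_measure.
have iu n := locint_mul lu (mk n) (hC a n) (ks n).
have ic n := locint_mul lc (mk n) (hC a n) (ks n).
pose r n : R := 2 / n.+1%:R.
have r0 n : 0 < r n by rewrite divr_gt0.
have cr : r n @[n --> \oo] --> (0 : R).
  rewrite /r -[X in _ --> X](mulr0 2); apply: cvgM; first exact: cvg_cst.
  exact: cvg_harmonic.
have dv : (davg u a (r n) @[n --> \oo] --> 0)%E.
  by move/cvge_at_rightP : ua; apply; split.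
have mu' : measurable_fun setT u by case: lu.
have est n : (`|(\int[mu]_t (u t * kernel a n t) - 2 * u a)%R%:E| <= (4 * C)%:E * davg u a (r n))%E.
  have -> : \int[mu]_t (u t * kernel a n t) - 2 * u a =
      \int[mu]_t ((u t - u a) * kernel a n t).
    rewrite -(kernel_mass a n) mulrC -RintegralZl//; last first.
      apply: le_integrable (locint_mul (f := fun=> 1) (M := 1 + `|a|) _ (mk n) (hC a n) (ks n)) => //.
        by apply/measurable_EFinP; exact: mk.
        by move=> t _ /=; rewrite mul1r.
      split; [exact: measurable_cst|exact: openT|move=> K _ cK].
      have mK : measurable (K : set (measurableTypeR R)) by exact: compact_measurable.
      rewrite integral_cst// lte_mul_pinfty ?lee_fin//; exact: compact_finite_measure.
    rewrite -RintegralB//; first by apply: eq_Rintegral => t _; ring.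
  have i3 : mu.-integrable setT (EFin \o (fun t => (u t - u a) * kernel a n t)).
    exact: locint_mul (locally_integrableB lu lc) (mk n) (hC a n) (ks n).
  rewrite /Rintegral fineK; last exact: (integrable_fin_num measurableT i3).
  apply: le_trans (le_abse_integral _ _ _) _ => //; first by case/integrableP: i3.
  pose A : R -> \bar R := (fun t => `|(u t - u a)%:E|%E) \_ (ball a (r n)).
  have mA : measurable_fun setT A.
    apply/(measurable_restrictT _ _).1; first exact: measurable_ball.
    apply: measurableT_comp => //; apply/measurable_EFinP; apply: measurable_funTS.
    exact: measurable_funB.
  have A0 t : (0 <= A t)%E by rewrite /A patchE; case: ifP.
  apply: (@le_trans _ _ (\int[mu]_t ((C * n.+1%:R)%:E * A t))%E).
    apply: le_integral_ae => [t|t|]; rewrite ?mule_ge0 ?lee_fin ?mulr_ge0//.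
    apply: aeW => t /=; rewrite /A patchE; case: ifPn => tB.
      by rewrite -EFinM lee_fin normrM mulrC ler_wpM2r.
    rewrite kernel_supp ?mulr0 ?normr0 ?mule0//.
    move: tB; rewrite notin_setE /ball /= => /negP; rewrite -leNgt distrC.
    apply: lt_le_trans; rewrite /r -[ltLHS]mul1r ltr_pM2r ?invr_gt0 ?ltr0n//; lra.
  rewrite ge0_integralZl ?lee_fin ?mulr_ge0//.
  rewrite /A -integral_mkcond /davg /iavg lebesgue_measure_ball ?(ltW (r0 n))//.
  have rr : r n *+ 2 != 0 by rewrite mulrn_eq0 /= gt_eqF.
  rewrite inver (negPf rr) muleA -EFinM.
  rewrite (_ : 4 * C * (r n *+ 2)^-1 = C * n.+1%:R)//.
  rewrite /r -mulr_natl; field.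
  by rewrite addrC natr1 gt_eqF.
have fin : (`|(\int[mu]_t (u t * kernel a n t) - 2 * u a)%R%:E|%E @[n --> \oo] --> 0)%E.
  apply: (@squeeze_cvge _ _ _ _ (fun=> 0%E) _ (fun n => (4 * C)%:E * davg u a (r n))%E).
  - by apply: nearW => n; rewrite abse_ge0 est.
  - exact: cvg_cst.
  - by rewrite -[X in _ --> X](mule0 (4 * C)%:E); apply: cvgeM => //; exact: cvg_cst.
apply/cvgrPdist_lt => eps eps0.
have /fine_cvgP[_ /cvgrPdist_lt /(_ _ eps0)] := fin; apply: filterS => n /=.
by rewrite sub0r normrN normr_id distrC.
Qed.

End mollification.

Section primitives.
Context (R : realType) (beta : R -> R) (hbeta : cutoff beta).
Local Notation bd i := (derive1n i beta).
Local Notation mu := (@lebesgue_measure R).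

(** A smooth approximation of twice the indicator of [[a, b]]. *)
Definition step (a b : R) (n : nat) (t : R) : R :=
  bd 0 ((t - a) * n.+1%:R) - bd 0 ((t - b) * n.+1%:R).

Lemma step_supp a b n t : `|a| + `|b| + 1 < `|t| -> step a b n t = 0.
Proof.
have [_ _ bm bp] := hbeta; rewrite /step derive1n0 => h.
have n1 : 1 <= n.+1%:R :> R by rewrite ler1n.
have ha := ler_norm a; have hb := ler_norm b.
have ha' := ler_norm (- a); have hb' := ler_norm (- b); rewrite !normrN in ha' hb'.
have [t0|t0] := leP 0 t.
  rewrite (ger0_norm t0) in h; have na := normr_ge0 a; have nb := normr_ge0 b.
  have big x : x <= t - 1 -> 1 <= (t - x) * n.+1%:R by move=> hx; apply: mulr_ege1 => //; lra.
  by rewrite !bp ?subrr//; apply: big; lra.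
rewrite (ltr0_norm t0) in h; have na := normr_ge0 a; have nb := normr_ge0 b.
have big x : t + 1 <= x -> (t - x) * n.+1%:R <= -1.
  by move=> hx; rewrite -(opprB x t) mulNr lerN2; apply: mulr_ege1 => //; lra.
by rewrite !bm ?subrr//; apply: big; lra.
Qed.

Lemma step_cvg_pt a b t : a < b -> t <> a -> t <> b ->
  step a b n t @[n --> \oo] --> (2 * \1_(`[a, b]%classic : set R) t : R).
Proof.
move=> ab ta tb; have [_ _ bm bp] := hbeta.
have arch (x : R) : 0 < x -> \forall n \near \oo, 1 <= x * n.+1%:R.
  move=> x0; exists (Num.truncn x^-1).+1 => // n /= hn.
  rewrite -ler_pdivrMl// mulr1; apply: ltW; apply: lt_le_trans (truncnS_gt _) _.
  by rewrite ler_nat (leq_trans hn).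
have lim (x : R) : t <> x -> \forall n \near \oo,
    bd 0 ((t - x) * n.+1%:R) = if x < t then 1 else -1.
  move=> tx; case: (ltgtP x t) => [xt|xt|/esym //].
    have h : 0 < t - x by rewrite subr_gt0.
    by apply: filterS (arch _ h) => n hn; rewrite derive1n0 bp.
  have h : 0 < x - t by rewrite subr_gt0.
  by apply: filterS (arch _ h) => n hn; rewrite derive1n0 bm// -(opprB x t) mulNr lerN2.
apply: cvg_near_cst; apply: filterS2 (lim _ ta) (lim _ tb) => n; rewrite /step => -> ->.
rewrite indicE; have [tin|tin] := pselect (`[a, b]%classic t).
  rewrite (mem_set tin); move: tin; rewrite /= in_itv /= => /andP[h1 h2].
  have -> : a < t by rewrite lt_neqAle h1 andbT; apply/eqP => /esym.
  by rewrite ltNge h2/=; lra.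
rewrite (memNset tin)/= mulr0; have [h1|h1] := ltP a t; have [h2|h2] := ltP b t; try lra.
by exfalso; apply: tin; rewrite /= in_itv /= (ltW h1).
Qed.

Lemma step_cvg (w : R -> R) a b : a < b -> locally_integrable setT w ->
  \int[mu]_t (w t * step a b n t) @[n --> \oo] --> 2 * \int[mu]_(t in `[a, b]) w t.
Proof.
move=> ab lw; have [C C0 hC] := bd_bounded hbeta 0.
have mw : measurable_fun setT w by case: lw.
pose M := `|a| + `|b| + 1.
pose J : set (measurableTypeR R) := `[- M, M]%classic.
have mJ : measurable J by exact: measurable_itv.
have iw := locint_itv a b lw.
have ms n : measurable_fun setT (step a b n).
  have cs x : continuous (fun t : R => bd 0 ((t - x) * n.+1%:R)).
    exact: is_derive_continuous (fun t => bd_scaled hbeta 0 x n.+1%:R t).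
  by apply: measurable_funB; apply: continuous_measurable_fun; exact: cs.
have mI : measurable (`[a, b]%classic : set (measurableTypeR R)) by exact: measurable_itv.
have sb n t : `|step a b n t| <= 2 * C.
  apply: le_trans (ler_normB _ _) _.
  by have := hC ((t - a) * n.+1%:R); have := hC ((t - b) * n.+1%:R); lra.
pose k t : R := 2 * C * \1_J t.
have ig : mu.-integrable setT (EFin \o (fun t => w t * k t)).
  apply: (locint_mul (M := M) (C := 2 * C)) => //.
  - by apply: measurable_funM => //; exact: measurable_indic.
  - move=> t; rewrite /k ger0_norm ?mulr_ge0// indicE.
    by case: (_ \in _); rewrite ?mulr1// mulr0 mulr_ge0.
  - move=> t ht; rewrite /k indicE memNset ?mulr0// /J /= in_itv /= -ler_norml.
    by apply/negP; rewrite -ltNge.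
have [] := @dominated_convergence _ _ R mu setT measurableT
  (fun n t => (w t * step a b n t)%:E) (fun t => (2 * (w \_ `[a, b]) t)%:E)
  (abse \o (EFin \o (fun t => w t * k t))).
- by move=> n; apply/measurable_EFinP; apply: measurable_funM; [exact: mw|exact: ms].
- apply/measurable_EFinP; apply: measurable_funM => //.
  apply/(measurable_restrictT _ _).1; first exact: measurable_itv.
  by apply: measurable_funTS; exact: mw.
- apply: filterS2 (ae_neq a) (ae_neq b) => t ta tb _.
  apply/fine_cvgP; split; first exact: nearW.
  have -> : 2 * (w \_ `[a, b]) t = w t * (2 * \1_(`[a, b]%classic : set R) t).
    rewrite patchE indicE; have [tin|tin] := pselect (`[a, b]%classic t).
      by rewrite !(mem_set tin) mulr1 mulrC.
    by rewrite !(memNset tin) !mulr0.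
  by apply: cvgM; [exact: cvg_cst|exact: step_cvg_pt].
- exact: integrable_abse.
- apply: aeW => t n _ /=; rewrite lee_fin /k indicE.
  have [tM|tM] := ltP M `|t|; first by rewrite step_supp// mulr0 normr0.
  have Jt : J t by rewrite /J /= in_itv /= -ler_norml.
  rewrite (mem_set Jt) mulr1 normrM [leRHS]normrM ler_wpM2l//.
  by rewrite [leRHS]ger0_norm ?mulr_ge0.
move=> i2 _ h.
have E : (\int[mu]_t (2 * (w \_ `[a, b]) t)%:E)%E = (2 * \int[mu]_(t in `[a, b]) w t)%:E.
  have i3 : mu.-integrable setT (EFin \o (w \_ `[a, b])).
    rewrite (_ : EFin \o _ = (EFin \o w) \_ `[a, b]).
      exact: ((integrable_mkcond _ mI).1 iw).
    by apply/funext => t /=; rewrite !patchE; case: ifP.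
  rewrite Rintegral_mkcond -RintegralZl// /Rintegral fineK//.
  exact: (integrable_fin_num measurableT i2).
by rewrite E in h; exact: fine_cvg h.
Qed.

(** A weak derivative, tested with compactly supported functions whose derivatives
are given as a sequence. *)
Definition weak_scalar (u w : R -> R) : Prop := forall (g : nat -> R -> R) M,
  (forall i (t : R), is_derive t (1 : R) (g i) (g i.+1 t)) ->
  (forall t, M < `|t| -> g 0%N t = 0) ->
  \int[mu]_t (u t * g 1%N t) = - \int[mu]_t (w t * g 0%N t).

(** Testing with smoothed indicators of [[a, b]], whose derivatives are the
difference of two mollifiers, gives the increment of [u] in the limit. *)
Lemma weak_scalar_increment (u w : R -> R) a b :
  locally_integrable setT u -> locally_integrable setT w -> weak_scalar u w ->
  a < b -> lebesgue_pt u a -> lebesgue_pt u b ->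
  u b - u a = \int[mu]_(t in `[a, b]) w t.
Proof.
move=> lu lw uw ab ua ub.
pose g n i t : R := n.+1%:R ^+ i * (bd i ((t - a) * n.+1%:R) - bd i ((t - b) * n.+1%:R)).
have dg n i (t : R) : is_derive t (1 : R) (g n i) (g n i.+1 t).
  have h : is_derive t (1 : R) (fun t => bd i ((t - a) * n.+1%:R) - bd i ((t - b) * n.+1%:R))
      (bd i.+1 ((t - a) * n.+1%:R) * n.+1%:R - bd i.+1 ((t - b) * n.+1%:R) * n.+1%:R).
    exact: is_deriveB (bd_scaled hbeta _ _ _ _) (bd_scaled hbeta _ _ _ _).
  have hZ := is_deriveZ (n.+1%:R ^+ i) h.
  have -> : g n i.+1 t = n.+1%:R ^+ i *: (bd i.+1 ((t - a) * n.+1%:R) * n.+1%:R -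
      bd i.+1 ((t - b) * n.+1%:R) * n.+1%:R).
    by rewrite /g -[_ *: _]/(_ * _) exprSr; ring.
  exact hZ.
have g0 n t : `|a| + `|b| + 1 < `|t| -> g n 0%N t = 0.
  by move=> h; rewrite /g -[X in _ * X]/(step a b n t) step_supp ?mulr0.
have E n := uw _ _ (dg n) (g0 n).
have E0 n : \int[mu]_t (w t * g n 0%N t) = \int[mu]_t (w t * step a b n t).
  by apply: eq_Rintegral => t _; rewrite /g expr0 mul1r.
have ik x n : mu.-integrable setT (EFin \o (fun t => u t * kernel beta x n t)).
  have [C C0 hC] := kernel_bounded hbeta.
  apply: (locint_mul (M := 1 + `|x|) (C := C * n.+1%:R)) => //.
    by apply: continuous_measurable_fun; exact: kernel_continuous.
  by move=> t h; apply: (kernel_supp_itv hbeta); have := lerB_dist t x; lra.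
have E1 n : \int[mu]_t (u t * g n 1%N t) =
    \int[mu]_t (u t * kernel beta a n t) - \int[mu]_t (u t * kernel beta b n t).
  rewrite -RintegralB//; apply: eq_Rintegral => t _.
  by rewrite /g /kernel expr1; ring.
have l1 : \int[mu]_t (u t * kernel beta a n t) - \int[mu]_t (u t * kernel beta b n t)
    @[n --> \oo] --> 2 * u a - 2 * u b.
  by apply: cvgB; exact: kernel_cvg.
have l2 : (- (\int[mu]_t (w t * step a b n t))) @[n --> \oo] -->
    - (2 * \int[mu]_(t in `[a, b]) w t).
  by apply: cvgN; exact: step_cvg.
have l3 : 2 * u a - 2 * u b = - (2 * \int[mu]_(t in `[a, b]) w t).
  apply: cvg_unique l1 _ => //; apply: cvg_trans l2; apply: near_eq_cvg.
  by apply: nearW => n; rewrite -E1 E E0.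
by lra.
Qed.

(** Almost every point is a Lebesgue point, and so is almost every translate. *)
Lemma weak_scalar_shift (u w : R -> R) h : locally_integrable setT u ->
  locally_integrable setT w -> weak_scalar u w -> 0 < h ->
  {ae mu, forall t, u (t + h) - u t = \int[mu]_(s in `[t, t + h]) w s}.
Proof.
move=> lu lw uw h0; have L := lebesgue_differentiation lu.
have Lh := ae_shift h (P := lebesgue_pt u) L.
apply: filterS2 L Lh => t ht hth.
by apply: weak_scalar_increment => //; rewrite ltrDl.
Qed.

End primitives.

Section primitive_unique.
Context (R : realType).
Local Notation mu := (@lebesgue_measure R).

Let E (x : R) (n : nat) : set R := `[x, x + n.+1%:R^-1]%classic.

Let itv_nicely_shrinking x : nicely_shrinking x (E x).
Proof.
have n0 n : 0 < n.+1%:R^-1 :> R by rewrite invr_gt0.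
split=> [n|]; first exact: measurable_itv.
have r0 n : 0 < 2 * n.+1%:R^-1 :> R by rewrite mulr_gt0.
exists (4, fun n => PosNum (r0 n)); split=> //=.
- rewrite -[X in _ --> X](mulr0 2); apply: cvgM; [exact: cvg_cst|exact: cvg_harmonic].
- move=> n y; rewrite /E /= in_itv /= /ball /= => /andP[h1 h2].
  have := n0 n; rewrite ler0_norm ?subr_le0// opprB => nn.
  rewrite -[ltRHS]/(2 * n.+1%:R^-1).
  by apply: (@le_lt_trans _ _ n.+1%:R^-1); [rewrite lerBlDl|rewrite ltr_pMl// ltr1n].
- move=> n; rewrite lebesgue_measure_ball ?(ltW (r0 n))//.
  rewrite /E lebesgue_measure_itv /= lte_fin ltrDl n0 -EFinB -EFinM lee_fin.
  rewrite addrAC subrr add0r -mulr_natl; move: (n.+1%:R^-1) => dl; rewrite [leLHS](_ : _ = 4 * dl)//; ring.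
Qed.

(** By Lebesgue's differentiation theorem along the intervals [[t, t + n.+1^-1]]. *)
Lemma primitive_unique (w w' : R -> R) : locally_integrable setT w ->
  locally_integrable setT w' ->
  (forall h, 0 < h -> {ae mu, forall t,
     \int[mu]_(s in `[t, t + h]) w s = \int[mu]_(s in `[t, t + h]) w' s}) ->
  {ae mu, forall t, w t = w' t}.
Proof.
move=> lw lw' hw.
have hn : {ae mu, forall t, forall n, \int[mu]_(s in E t n) w s = \int[mu]_(s in E t n) w' s}.
  by apply/ae_foralln => n; apply: hw; rewrite invr_gt0.
have L := lebesgue_differentiation lw; have L' := lebesgue_differentiation lw'.
apply: filterS2 hn (filterI L L') => t eq_t [lt lt'].
have c1 := nice_lebesgue_differentiation itv_nicely_shrinking lw lt.
have c2 := nice_lebesgue_differentiation itv_nicely_shrinking lw' lt'.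
apply: EFin_inj; apply: cvg_unique c1 _ => //.
apply: cvg_trans c2; apply: near_eq_cvg; apply: nearW => n.
congr (_ * _)%E; have i1 := locint_itv t (t + n.+1%:R^-1) lw.
have i2 := locint_itv t (t + n.+1%:R^-1) lw'.
have mE : measurable (E t n : set (measurableTypeR R)) by exact: measurable_itv.
rewrite -(fineK (integrable_fin_num mE i1)) -(fineK (integrable_fin_num mE i2)).
by congr EFin; apply/esym; exact: eq_t n.
Qed.

End primitive_unique.

Section coordinate_derivative.
Context (R : realType) (X : lmodType R) (c : nat -> X -> R).
Hypothesis cinj : forall x y, (forall nu, c nu x = c nu y) -> x = y.
Local Notation mu := (@lebesgue_measure R).
Implicit Types (v w : R -> X).

(** All the coordinates of [v] have increments given by integrating those of
[w]. Contrary to the weak derivative this does not mention any norm, so it gives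
one derivative for all the Hilbert spaces in which [v] takes its values. *)
Definition coord_deriv v w : Prop :=
  (forall nu, exists2 u, locally_integrable setT u & {ae mu, forall t, c nu (w t) = u t}) /\
  forall nu h, 0 < h -> {ae mu, forall t,
    c nu (v (t + h)) - c nu (v t) = \int[mu]_(s in `[t, t + h]) c nu (w s)}.

Lemma Rintegral_set_ae (f g : R -> R) (D : set R) : {ae mu, forall t, f t = g t} ->
  \int[mu]_(t in D) f t = \int[mu]_(t in D) g t.
Proof.
move=> fg; rewrite Rintegral_mkcond [RHS]Rintegral_mkcond; apply: Rintegral_ae.
by apply: filterS fg => t E; rewrite !patchE E.
Qed.

Lemma coord_deriv_ae v v' w w' : {ae mu, forall t, v t = v' t} ->
  {ae mu, forall t, w t = w' t} -> coord_deriv v w -> coord_deriv v' w'.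
Proof.
move=> vv ww [lw d]; split=> [nu|nu h h0].
  have [u lu wu] := lw nu; exists u => //.
  by apply: filterS2 ww wu => t <-.
have vvh := ae_shift h (P := fun t => v t = v' t) vv.
apply: filterS2 (d nu h h0) (filterI vv vvh) => t E [<- <-]; rewrite E.
by apply: Rintegral_set_ae; apply: filterS ww => s ->.
Qed.

Lemma coord_deriv_unique v w w' : coord_deriv v w -> coord_deriv v w' ->
  {ae mu, forall t, w t = w' t}.
Proof.
move=> [lw d] [lw' d'].
suff h : {ae mu, forall t, forall nu, c nu (w t) = c nu (w' t)}.
  by apply: filterS h => t ht; exact: cinj.
apply/ae_foralln => nu; have [u lu wu] := lw nu; have [u' lu' wu'] := lw' nu.
have uu : {ae mu, forall t, u t = u' t}.
  apply: primitive_unique => // h h0; apply: filterS2 (d nu h h0) (d' nu h h0) => t.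
  by rewrite (Rintegral_set_ae _ wu) (Rintegral_set_ae _ wu') => -> .
by apply: filterS3 wu wu' uu => t -> ->.
Qed.

(** Chosen once for all the Hilbert spaces, and total, so that it can serve as the
generator on every level of a scale. *)
Definition coord_derivative v : R -> X := xget (fun=> 0) [set w | coord_deriv v w].

Lemma coord_derivativeP v w : coord_deriv v w -> coord_deriv v (coord_derivative v) /\ {ae mu, forall t, coord_derivative v t = w t}.
Proof.
move=> d; have d' : coord_deriv v (coord_derivative v) by exact: (xgetPex (fun=> 0) (ex_intro _ w d)).
by split=> //; exact: coord_deriv_unique d' d.
Qed.

Lemma coord_derivative_ae v v' : {ae mu, forall t, v t = v' t} -> coord_derivative v = coord_derivative v'.
Proof.
move=> vv; congr (xget _ _); apply/seteqP; split => w; apply: coord_deriv_ae => //.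
- by apply: aeW.
- by apply: filterS vv => t ->.
- by apply: aeW.
Qed.

End coordinate_derivative.

Section weak_to_coord.
Context (R : realType) (X : lmodType R) (H : hilb X).
Context (c : nat -> X -> R) (wt : nat -> R) (e : nat -> X).
Hypothesis cH : coord_hilb H c wt e.
Context (p : R) (hp : 1 < p) (beta : R -> R) (hbeta : cutoff beta).
Local Notation mu := (@lebesgue_measure R).
Implicit Types (v w : R -> X).

(** Testing with the multiples of the unit vectors reduces weak derivatives to
those of real functions. *)
Lemma weak_deriv_coord v w : in_Lp H p v -> in_Lp H p w -> is_weak_deriv H v w ->
  coord_deriv c v w.
Proof.
move=> lv lw d; have [v' [nv vv lv']] := in_Lp_coord_measurable cH hp lv.
have [w' [nw ww lw']] := in_Lp_coord_measurable cH hp lw.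
have d' := weak_deriv_ae vv ww d.
have lcv nu := coord_locally_integrable cH hp nu nv lv'.
have lcw nu := coord_locally_integrable cH hp nu nw lw'.
suff : coord_deriv c v' w'.
  by apply: coord_deriv_ae; [apply: filterS vv => t ->|apply: filterS ww => t ->].
split=> [nu|nu h h0]; first by exists (fun t => c nu (w' t)) => //; exact: aeW.
apply: (weak_scalar_shift hbeta) => // g M dg g0.
have wn : wt nu != 0 by rewrite gt_eqF// (ch_wt cH).
have dg' i (t : R) : is_derive t (1 : R) (fun t => (wt nu)^-1 * g i t) ((wt nu)^-1 * g i.+1 t).
  exact: (is_deriveZ (wt nu)^-1 (dg i t)).
have g0' t : M < `|t| -> (wt nu)^-1 * g 0%N t = 0 by move=> /g0 ->; rewrite mulr0.
have E (x : X) (r : R) : hset H x -> hip H x ((wt nu)^-1 * r *: e nu) = c nu x * r.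
  move=> hx; rewrite (hipZr cH) ?(hip_e cH)//; last exact (hset_e cH nu).
  by rewrite mulrACA mulVf// mul1r mulrC.
transitivity (\int[mu]_t hip H (v' t) ((wt nu)^-1 * g 1%N t *: e nu)).
  by apply: eq_Rintegral => t _; rewrite E//; exact: nv.1.
rewrite (d' _ (test_fun_e cH nu dg' g0')); congr (- _).
by apply: eq_Rintegral => t _; rewrite E//; exact: nw.1.
Qed.

End weak_to_coord.

Section difference_quotient.
Context (R : realType) (X : lmodType R) (H : hilb X).
Context (c : nat -> X -> R) (wt : nat -> R) (e : nat -> X).
Hypothesis cH : coord_hilb H c wt e.
Context (p : R) (hp : 1 < p).
Local Notation mu := (@lebesgue_measure R).
Implicit Types (v w : R -> X).

Let p0 : 0 < p. Proof. exact: lt_trans ltr01 hp. Qed.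

Lemma hnorm_locally_integrable v : coord_measurable H c v -> in_Lp H p v ->
  locally_integrable setT (fun t => hnorm H (v t)).
Proof.
move=> nv lv; split; [exact (coord_measurable_hnorm cH nv)|exact: openT|move=> K _ cK].
have mK : measurable (K : set (measurableTypeR R)) by exact: compact_measurable.
have fK : (mu K < +oo)%E by exact: compact_finite_measure.
have i1 : mu.-integrable K (EFin \o (fun=> 1 : R)).
  apply: measurable_bounded_integrable => //; exists 1; split; first exact: num_real.
  by move=> x x1 t _ /=; rewrite normr1 ltW.
have i2 : mu.-integrable K (fun t => (hnorm H (v t) `^ p)%:E).
  apply: integrableS (hnorm_powR_integrable cH hp nv lv) => //; exact: measurableT.
suff : mu.-integrable K (EFin \o (fun t => hnorm H (v t))) by case/integrableP.
apply: le_integrable (integrableD mK i1 i2) => //.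
  by apply/measurable_EFinP; apply: measurable_funTS; exact (coord_measurable_hnorm cH nv).
move=> t _ /=; rewrite lee_fin [leRHS]ger0_norm ?addr_ge0 ?powR_ge0//.
rewrite ger0_norm ?hnorm_ge0//; exact: (le_one_powR hp (hnorm_ge0 _ _)).
Qed.

(** Minkowski's inequality for integrals, by duality with finite parts of [x]
itself. *)
Lemma hnorm_integral_le (x : X) (z : R -> X) (D : set (measurableTypeR R)) : hset H x ->
  measurable D -> (forall s, hset H (z s)) ->
  (forall nu, mu.-integrable D (EFin \o (fun s => c nu (z s)))) ->
  mu.-integrable D (EFin \o (fun s => hnorm H (z s))) ->
  (forall nu, c nu x = \int[mu]_(s in D) c nu (z s)) ->
  hnorm H x <= \int[mu]_(s in D) hnorm H (z s).
Proof.
move=> hx mD hz iz ih xz; set A := \int[mu]_(s in D) hnorm H (z s).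
have A0 : 0 <= A by apply: Rintegral_ge0 => s _; exact: hnorm_ge0.
apply: (hnorm_le cH) => // N.
set Q := psum c wt x x N; have Q0 : 0 <= Q by exact (psum_ge0 cH x N).
have iN : mu.-integrable D (EFin \o (fun s => psum c wt x (z s) N)).
  rewrite (_ : EFin \o _ = (fun s => \sum_(0 <= nu < N) ((wt nu * c nu x)%:E * (EFin \o (fun s => c nu (z s))) s))%E).
    apply: integrable_sum => // nu _; exact (integrableZl mD _ (iz nu)).
  by apply/funext => s /=; rewrite /psum -sumEFin; apply: eq_bigr => nu _; rewrite EFinM.
have QE : Q = \int[mu]_(s in D) psum c wt x (z s) N.
  rewrite /Rintegral (_ : (\int[mu]_(s in D) (psum c wt x (z s) N)%:E)%E =
    (\sum_(0 <= nu < N) ((wt nu * c nu x)%:E * \int[mu]_(s in D) (c nu (z s))%:E))%E).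
    rewrite /Q /psum; under [in RHS]eq_bigr => nu _.
      rewrite -(fineK (integrable_fin_num mD (iz nu))) -EFinM.
      over.
    by rewrite sumEFin /=; apply: eq_bigr => nu _; rewrite {2}xz.
  under eq_integral do rewrite /psum -sumEFin.
  rewrite integral_sum//; last first.
    move=> nu; rewrite (_ : (fun s => _) = (fun s => (wt nu * c nu x)%:E * (EFin \o (fun s => c nu (z s))) s))%E.
      exact (integrableZl mD _ (iz nu)).
    by apply/funext => s; rewrite /= EFinM.
  by apply: eq_bigr => nu _; rewrite -(integralZl mD (iz nu)); apply: eq_integral => s _; rewrite /= EFinM.
have Qle : Q <= Num.sqrt Q * A.
  rewrite {1}QE /A -RintegralZl//; apply: le_Rintegral => //.
    exact: (integrableZl mD (Num.sqrt Q) ih).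
  move=> s _; apply: le_trans (ler_norm _) _.
  rewrite -(ler_pXn2r (n := 2))// ?nnegrE ?mulr_ge0 ?sqrtr_ge0 ?hnorm_ge0//.
  rewrite real_normK ?num_real// exprMn sqr_sqrtr//.
  apply: le_trans (psum_CS cH _ _ _) _; rewrite ler_wpM2l//; exact (psum_le cH N (hz s)).
have [Qz|Qn] := eqVneq Q 0; first by rewrite Qz sqr_ge0.
have sQ : 0 < Num.sqrt Q by rewrite sqrtr_gt0 lt_neqAle eq_sym Qn.
have : Num.sqrt Q <= A by rewrite -(ler_pM2l sQ) -expr2 sqr_sqrtr.
move=> h; rewrite -(sqr_sqrtr Q0) ler_pXn2r ?nnegrE ?sqrtr_ge0//.
Qed.

End difference_quotient.

Section difference_quotient_estimate.
Context (R : realType) (X : lmodType R) (H : hilb X).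
Context (c : nat -> X -> R) (wt : nat -> R) (e : nat -> X).
Hypothesis cH : coord_hilb H c wt e.
Context (p : R) (hp : 1 < p).
Local Notation mu := (@lebesgue_measure R).
Implicit Types (v w : R -> X).

Let p0 : 0 < p. Proof. exact: lt_trans ltr01 hp. Qed.

(** Jensen's inequality on an interval of length [h]. *)
Lemma integral_powR_le (F : R -> R) (h : R) : measurable_fun setT F ->
  (forall t, 0 <= F t) -> 0 < h ->
  ((\int[mu]_(s in `[0%R, h]) (F s)%:E) `^ p <=
   (h `^ (p - 1))%:E * \int[mu]_(s in `[0%R, h]) (F s `^ p)%:E)%E.
Proof.
move=> mF F0 h0.
pose J : set (measurableTypeR R) := `[0, h]%classic.
have mJ : measurable J by exact: measurable_itv.
have muJ : mu J = h%:E by rewrite /J lebesgue_measure_itv/= lte_fin h0 sube0.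
pose q := p / (p - 1); have pm : 0 < p - 1 by rewrite subr_gt0.
have q0 : 0 < q by rewrite divr_gt0.
have pq : p^-1 + q^-1 = 1.
  by rewrite /q; field; rewrite !gt_eqF.
pose f := fun t : R => F t * \1_J t; pose g := fun t : R => \1_J t : R.
have mg : measurable_fun setT g by exact: measurable_indic.
have mf : measurable_fun setT f by exact: measurable_funM.
have := hoelder mu mf mg p0 q0 pq; rewrite Lnorm1.
have -> : (\int[mu]_x `|(EFin \o (f \* g)%R) x| = \int[mu]_(s in `[0%R, h]) (F s)%:E)%E.
  rewrite [RHS]integral_mkcond; apply: eq_integral => s _; rewrite patchE /f /g /= indicE.
  have [Js|Js] := pselect (J s).
    by rewrite !(mem_set Js) !mulr1 ger0_norm.
  by rewrite !(memNset Js) !mulr0 normr0.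
rewrite unlock.
have -> : (\int[mu]_x `|(EFin \o f) x| `^ p = \int[mu]_(s in `[0%R, h]) (F s `^ p)%:E)%E.
  rewrite [RHS]integral_mkcond; apply: eq_integral => s _; rewrite patchE /f /= indicE.
  have [Js|Js] := pselect (J s).
    by rewrite !(mem_set Js) !mulr1 ger0_norm.
  by rewrite !(memNset Js) !mulr0 normr0 powR0// gt_eqF.
have -> : (\int[mu]_x `|(EFin \o g) x| `^ q = h%:E)%E.
  transitivity (\int[mu]_s (\1_J s)%:E)%E; last first.
    by rewrite integral_indic// setIT -muJ.
  apply: eq_integral => s _.
  rewrite /g /= indicE; case: (s \in J); first by rewrite normr1 powR1.
  by rewrite normr0 powR0// gt_eqF.
set I := (\int[mu]_(s in _) (F s)%:E)%E; set Ip := (\int[mu]_(s in _) (F s `^ p)%:E)%E => hI.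
have I0 : (0 <= I)%E by apply: integral_ge0 => s _; rewrite lee_fin.
have Ip0 : (0 <= Ip)%E by apply: integral_ge0 => s _; rewrite lee_fin powR_ge0.
have : (I `^ p <= (Ip `^ p^-1 * h%:E `^ q^-1) `^ p)%E.
  by apply: (gt0_ler_poweR (ltW p0)) => //; rewrite in_itv/= leey andbT// mule_ge0 ?poweR_ge0 ?lee_fin ?powR_ge0.
rewrite poweRM ?poweR_ge0// -!poweRrM mulVf ?gt_eqF// poweRe1// muleC.
rewrite (_ : q^-1 * p = p - 1)// /q; field; rewrite !gt_eqF//.
Qed.

Lemma integral_itv_shift (f : R -> \bar R) (t h : R) :
  (\int[mu]_(s in `[t, (t + h)%R]) f s = \int[mu]_(s in `[0%R, h]) f (s + t)%R)%E.
Proof.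
rewrite [LHS]integral_mkcond [RHS]integral_mkcond -(integral_shift t).
apply: eq_integral => s _; rewrite !patchE.
have E : (`[t, t + h]%classic (s + t) : Prop) = `[0, h]%classic s.
  by rewrite /= !in_itv/= lerDr [t + h]addrC lerD2r.
have [Js|Js] := pselect (`[0, h]%classic s).
  by rewrite (mem_set Js) mem_set// E.
by rewrite (memNset Js) memNset// E.
Qed.

(** The vector [v (t + h) - v t - h *: w t] is the integral over [s] in [0, h] of
[w (t + s) - w t]. Minkowski's inequality bounds its norm by the integral of the
norms, Jensen's inequality the p-th power of this integral, and Tonelli's theorem
exchanges the integrals over [s] and [t]. *)
Lemma difference_quotient_le (G : R -> R) v w (h M : R) :
  measurable_fun setT G -> (forall t, 0 <= G t) ->
  in_Lp H p v -> in_Lp H p w -> coord_deriv c v w -> 0 < h -> 0 <= M ->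
  (forall s, 0 <= s <= h ->
     (Lp_integral H p (fun t => G t *: (w (t + s) - w t))%R <= (M `^ p)%:E)%E) ->
  (Lp_integral H p (fun t => G t *: (v (t + h) - v t - h *: w t))%R <= ((h * M) `^ p)%:E)%E.
Proof.
move=> mG G0 lv lw d h0 M0 hM.
have [w' [nw ww lw']] := in_Lp_coord_measurable cH hp lw.
have wwh s := ae_shift s (P := fun t => w t = w' t) ww.
have hv : {ae mu, forall t, hset H (v t)} := lv.1.1.
have hvh := ae_shift h (P := fun t => hset H (v t)) hv.
have d' : {ae mu, forall t, forall nu, c nu (v (t + h)) - c nu (v t) =
    \int[mu]_(s in `[t, t + h]) c nu (w' s)}.
  apply/ae_foralln => nu; apply: filterS (d.2 nu h h0) => t ->.
  by apply: Rintegral_set_ae; apply: filterS ww => s ->.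
pose F t s := hnorm H (w' (s + t) - w' t).
have F0 t s : 0 <= F t s by exact: hnorm_ge0.
have mF t : measurable_fun setT (F t).
  by apply: (coord_measurable_hnorm cH); apply: (coord_measurableB cH); [exact: coord_measurable_shift|split=> [s|nu]; [exact: nw.1|exact: measurable_cst]].
pose J : set (measurableTypeR R) := `[0, h]%classic.
have mJ : measurable J by exact: measurable_itv.
have key : {ae mu, forall t, ((hnorm H (v (t + h) - v t - h *: w t)%R)%:E <=
    \int[mu]_(s in `[0%R, h]) (F t s)%:E)%E}.
  apply: filterS3 d' (filterI hv hvh) ww => t dt [hvt hvth] wwt; rewrite wwt.
  pose K : set (measurableTypeR R) := `[t, t + h]%classic.
  have mK : measurable K by exact: measurable_itv.
  have muK : fine (mu K) = h.
    by rewrite /K lebesgue_measure_itv/= lte_fin ltrDl h0 -EFinB /= addrAC subrr add0r.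
  have fK : (mu K < +oo)%E by rewrite /K lebesgue_measure_itv/=; case: ifP => _; rewrite -?EFinB ltry.
  have icst (r : R) : mu.-integrable K (EFin \o (fun=> r)).
    apply: measurable_bounded_integrable => //; exists `|r|; split; first exact: num_real.
    by move=> x x1 s _ /=; exact: ltW.
  have hx : hset H (v (t + h) - v t - h *: w' t).
    by apply: (hsetB cH); [exact (hsetB cH hvth hvt)|exact: (hsetZ cH _ (nw.1 t))].
  have hz s : hset H (w' s - w' t) by exact: (hsetB cH (nw.1 s) (nw.1 t)).
  have iw nu := locint_itv t (t + h) (coord_locally_integrable cH hp nu nw lw').
  have ih : mu.-integrable K (EFin \o (fun s => hnorm H (w' s - w' t))).
    apply: le_integrable (integrableD mK (locint_itv t (t + h) (hnorm_locally_integrable cH hp nw lw')) (icst (hnorm H (w' t)))) => //.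
      apply/measurable_EFinP; apply: measurable_funTS; apply: (coord_measurable_hnorm cH); apply: (coord_measurableB cH) => //.
      by split=> [s|nu]; [exact: nw.1|exact: measurable_cst].
    move=> s _ /=; rewrite lee_fin !ger0_norm ?addr_ge0 ?hnorm_ge0//.
    have hN : hset H (- w' t) by rewrite -scaleN1r; exact: (hsetZ cH _ (nw.1 t)).
    by have := hnormD cH (nw.1 s) hN; rewrite (hnormN cH (nw.1 t)).
  have iz nu : mu.-integrable K (EFin \o (fun s => c nu (w' s - w' t))).
    rewrite (_ : EFin \o _ = (EFin \o (fun s => c nu (w' s))) \- (EFin \o (fun=> c nu (w' t))))%E.
      exact: integrableB.
    by apply/funext => s; rewrite /= (coordB cH) EFinB.
  have := hnorm_integral_le cH hx mK hz iz ih; rewrite -lee_fin => /(_ _)/le_trans; apply.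
    move=> nu; rewrite !(coordB cH) (coordZ cH) dt.
    under [RHS]eq_Rintegral do rewrite (coordB cH).
    by rewrite RintegralB// Rintegral_cst// muK mulrC.
  rewrite /Rintegral fineK; last exact: (integrable_fin_num mK ih).
  by rewrite /K integral_itv_shift.
apply: (@le_trans _ _ (\int[mu]_t ((h `^ (p - 1))%:E * \int[mu]_(s in `[0%R, h]) ((G t * F t s) `^ p)%:E))%E).
  apply: le_integral_ae => [t|t|]; first by rewrite lee_fin powR_ge0.
    rewrite mule_ge0 ?lee_fin ?powR_ge0//; apply: integral_ge0 => s _.
    by rewrite lee_fin powR_ge0.
  apply: filterS3 key (filterI hv hvh) lw.1.1 => t kt [hvt hvth] hwt.
  have hx : hset H (v (t + h) - v t - h *: w t).
    by apply: (hsetB cH); [exact (hsetB cH hvth hvt)|exact: (hsetZ cH _ hwt)].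
  rewrite (hnormZ cH)// ger0_norm// powRM ?hnorm_ge0// EFinM.
  have -> : (\int[mu]_(s in `[0%R, h]) ((G t * F t s) `^ p)%:E =
      (G t `^ p)%:E * \int[mu]_(s in `[0%R, h]) (F t s `^ p)%:E)%E.
    rewrite -ge0_integralZl_EFin ?powR_ge0//; last 2 first.
    - by move=> s _; rewrite lee_fin powR_ge0.
    - apply/measurable_EFinP; apply: measurable_funTS.
      by apply: (measurableT_comp (measurable_powR p)); exact: mF.
    by apply: eq_integral => s _; rewrite powRM// EFinM.
  rewrite muleCA; apply: lee_wpmul2l; first by rewrite lee_fin powR_ge0.
  apply: le_trans (integral_powR_le (mF t) (F0 t) h0).
  rewrite -poweR_EFin; apply: (gt0_ler_poweR (ltW p0)) => //; rewrite in_itv/= leey andbT ?lee_fin ?hnorm_ge0//.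
  by apply: integral_ge0 => s _; rewrite lee_fin.
pose f (z : measurableTypeR R * measurableTypeR R) : \bar R := (((G z.1 * F z.1 z.2) * \1_J z.2) `^ p)%:E.
have f0 z : (0 <= f z)%E by rewrite lee_fin powR_ge0.
have mf : measurable_fun setT f.
  apply/measurable_EFinP; apply: (measurableT_comp (measurable_powR p)).
  apply: measurable_funM; last exact: (measurableT_comp (measurable_indic mJ) measurable_snd).
  apply: measurable_funM; first exact: (measurableT_comp mG measurable_fst).
  apply: (measurable_hnorm cH).
    by move=> z; exact: (hsetB cH (nw.1 _) (nw.1 _)).
  move=> nu; under eq_fun do rewrite (coordB cH); apply: measurable_funB.
    apply: (measurableT_comp (nw.2 nu)).
    exact: (measurable_funD measurable_snd measurable_fst).
  exact: (measurableT_comp (nw.2 nu) measurable_fst).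
have fE t : (\int[mu]_(s in `[0%R, h]) ((G t * F t s) `^ p)%:E = \int[mu]_s f (t, s))%E.
  rewrite [LHS]integral_mkcond; apply: eq_integral => s _; rewrite patchE /f /= indicE.
  have [Js|Js] := pselect (J s); first by rewrite !(mem_set Js) mulr1.
  by rewrite !(memNset Js) mulr0 powR0// gt_eqF.
under eq_integral do rewrite fE.
rewrite ge0_integralZl//; last 3 first.
- exact: measurable_fun_fubini_tonelli_F.
- by move=> t _; apply: integral_ge0.
- by rewrite lee_fin powR_ge0.
rewrite (fubini_tonelli f mf f0).
apply: (@le_trans _ _ ((h `^ (p - 1))%:E * (\int[mu]_(s in `[0%R, h]) (M `^ p)%:E))%E).
  apply: lee_wpmul2l; first by rewrite lee_fin powR_ge0.
  rewrite [leRHS]integral_mkcond; apply: le_integral_ae => [s|s|].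
  - by apply: integral_ge0.
  - by rewrite patchE; case: ifP => _; rewrite ?lee_fin ?powR_ge0.
  apply: aeW => s; rewrite patchE; have [Js|Js] := pselect (J s).
    rewrite (mem_set Js); apply: le_trans (hM s _); last by move: Js; rewrite /J /= in_itv.
    rewrite le_eqVlt; apply/orP; left; apply/eqP; apply: integral_ae.
    apply: filterS2 ww (wwh s) => t wt1 wt2.
    rewrite /f /= indicE (mem_set Js) mulr1 wt1 wt2 (hnormZ cH) ?ger0_norm//.
      by rewrite /F (addrC s t).
    by exact: (hsetB cH (nw.1 _) (nw.1 _)).
  rewrite (memNset Js) le_eqVlt; apply/orP; left; apply/eqP; apply: integral0_eq => t _.
  by rewrite /f /= indicE (memNset Js) mulr0 powR0// gt_eqF.
have muJ : mu J = h%:E by rewrite /J lebesgue_measure_itv/= lte_fin h0 sube0.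
rewrite integral_cst// [X in (_ * (_ * X))%E](_ : _ = mu J)// muJ -!EFinM lee_fin.
rewrite powRM// ?(ltW h0)// mulrCA mulrC [h `^ (p - 1) * h]mulrC mulr_powRB1//.
exact: ltW.
Qed.

End difference_quotient_estimate.

(** * The exponential weights *)

Section smooth_families.
Context (R : realType).
Implicit Types (f g : R -> R).

(** Differentiability of order [k], stated by exhibiting derivatives. This is
stable under products and exponentials by induction on the order, and
[family_Ck] turns it into a sequence of successive derivatives. *)
Fixpoint Ck (k : nat) f : Prop :=
  if k is k'.+1 then exists2 f', (forall t : R, is_derive t (1 : R) f (f' t)) & Ck k' f'
  else True.

Lemma CkW k f : Ck k.+1 f -> Ck k f.
Proof.
elim: k f => // k IH f [f' df cf]; exists f' => //; exact: IH.
Qed.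

Lemma CkD k f g : Ck k f -> Ck k g -> Ck k (fun t => f t + g t).
Proof.
elim: k f g => // k IH f g [f' df cf] [g' dg cg].
exists (fun t => f' t + g' t); last exact: IH.
by move=> t; exact: is_deriveD (df t) (dg t).
Qed.

Lemma CkM k f g : Ck k f -> Ck k g -> Ck k (fun t => f t * g t).
Proof.
elim: k f g => // k IH f g cf0 cg0; have cf1 := CkW cf0; have cg1 := CkW cg0.
case: cf0 => f' df cf; case: cg0 => g' dg cg.
exists (fun t => f t * g' t + g t * f' t); last by apply: CkD; exact: IH.
by move=> t; exact: is_deriveM (df t) (dg t).
Qed.

Lemma Ck_expR b b' k : (forall t : R, is_derive t (1 : R) b (b' t)) ->
  (forall k, Ck k b') -> Ck k (fun t => expR (b t)).
Proof.
move=> db cb; elim: k => // k IH; exists (fun t => expR (b t) * b' t); last exact: CkM.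
by move=> t; exact: (@is_derive1_comp R expR b t _ _ (is_derive_expR _) (db t)).
Qed.

Lemma Ck_family (F : nat -> R -> R) k i : (forall i (t : R), is_derive t (1 : R) (F i) (F i.+1 t)) ->
  Ck k (F i).
Proof. by move=> dF; elim: k i => // k IH i; exists (F i.+1). Qed.

Lemma family_Ck f : (forall k, Ck k f) ->
  exists2 F : nat -> R -> R, F 0%N = f & forall i (t : R), is_derive t (1 : R) (F i) (F i.+1 t).
Proof.
move=> cf; exists (fun i => derive1n i f) => //.
have step g : (forall k, Ck k g) -> (forall t : R, is_derive t (1 : R) g (derive1 g t)) /\ forall k, Ck k ((derive1 g)).
  move=> cg; have E g' : (forall t : R, is_derive t (1 : R) g (g' t)) -> g' = (derive1 g).
    by move=> dg; apply/funext => t; rewrite derive1E; have [_ ->] := dg t.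
  split; first by have [g' dg _] := cg 1%N; rewrite -(E g' dg).
  by move=> k; have [g' dg cg'] := cg k.+1; rewrite -(E g' dg).
have all i : forall k, Ck k (derive1n i f).
  by elim: i => // i IH k; rewrite derive1nS; exact: (step _ IH).2.
by move=> i t; rewrite derive1nS; exact: (step _ (all i)).1.
Qed.

End smooth_families.

Section weights.
Context (R : realType) (beta : R -> R) (hbeta : cutoff beta).
Local Notation bd i := (derive1n i beta).
Local Notation G := (gamma_weight beta).

(** The [i]-th derivative of [delta * beta s * s]. *)
Definition exponent (delta : R) (i : nat) (s : R) : R :=
  delta * (bd i s * s + i%:R * bd i.-1 s).

Lemma exponent_deriv delta i (t : R) :
  is_derive t (1 : R) (exponent delta i) (exponent delta i.+1 t).
Proof.
have h1 : is_derive t (1 : R) (fun s => bd i s * s) (bd i t * 1 + t * bd i.+1 t).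
  exact: is_deriveM (bd_deriv hbeta i t) (is_derive_id _ _).
have h2 : is_derive t (1 : R) (fun s => i%:R * bd i.-1 s) (i%:R * bd i t).
  case: i {h1} => [|i].
    rewrite (_ : (fun s => _) = (fun=> 0)); last by apply/funext => s; rewrite mul0r.
    by rewrite mul0r; exact: is_derive_cst.
  exact (is_deriveZ i.+1%:R (bd_deriv hbeta i t)).
have := is_deriveZ delta (is_deriveD h1 h2).
rewrite [X in is_derive _ _ _ X -> _](_ : _ = exponent delta i.+1 t)//.
by rewrite /exponent -[_ *: _]/(_ * _) -natr1; ring.
Qed.

(** The derivatives of [beta] vanish outside [[-1, 1]], so the factor [s] does no
harm from the first derivative on. *)
Lemma exponent_bounded delta i : exists2 K, 0 <= K & forall t, `|exponent delta i.+1 t| <= K.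
Proof.
have [C C0 hC] := bd_bounded hbeta i.+1; have [C' C'0 hC'] := bd_bounded hbeta i.
exists (`|delta| * (C + i.+1%:R * C')) => [|t]; first by rewrite mulr_ge0// addr_ge0// mulr_ge0.
rewrite /exponent normrM ler_wpM2l//; apply: le_trans (ler_normD _ _) _; apply: lerD.
  have [t1|t1] := ltP 1 `|t|; first by rewrite (bd_supp hbeta)// mul0r normr0.
  by rewrite normrM; apply: le_trans (ler_piMr _ t1) (hC t).
by rewrite normrM ger0_norm// ler_wpM2l.
Qed.

Lemma weightE delta s : G delta s = expR (exponent delta 0 s).
Proof. by rewrite /gamma_weight /exponent mul0r addr0 derive1n0 mulrA. Qed.

Lemma weight_gt0 delta s : 0 < G delta s.
Proof. by rewrite weightE expR_gt0. Qed.

Lemma weight_family delta : exists2 F : nat -> R -> R, F 0%N = G delta &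
  (forall i (t : R), is_derive t (1 : R) (F i) (F i.+1 t)) /\
  forall t, F 1%N t = exponent delta 1 t * G delta t.
Proof.
have cb k : Ck k (exponent delta 1) by apply: Ck_family; exact: exponent_deriv.
have [F F0 dF] : exists2 F : nat -> R -> R, F 0%N = (fun s => expR (exponent delta 0 s)) &
    forall i (t : R), is_derive t (1 : R) (F i) (F i.+1 t).
  by apply: family_Ck => k; apply: Ck_expR cb; exact: exponent_deriv.
exists F; first by rewrite F0; apply/funext => s; rewrite weightE.
split=> // t; have := dF 0%N t; rewrite F0 => -[_ <-].
have := @is_derive1_comp R expR _ t _ _ (is_derive_expR _) (exponent_deriv delta 0 t).
by move=> [_ ->]; rewrite weightE mulrC.
Qed.

Lemma weight_continuous delta : continuous (G delta).
Proof.
by have [F <- [dF _]] := weight_family delta; exact: is_derive_continuous (dF 0%N).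
Qed.

Lemma weight_measurable delta : measurable_fun setT (G delta).
Proof. by apply: continuous_measurable_fun; exact: weight_continuous. Qed.

Lemma weightN delta s : G (- delta) s * G delta s = 1.
Proof. by rewrite !weightE -expRD /exponent mulNr addNr expR0. Qed.

Lemma exponent_ge delta s : 0 <= delta -> - delta <= exponent delta 0 s.
Proof.
move=> d0; rewrite /exponent mul0r addr0 derive1n0 -[leLHS]mulr1 mulNr -mulrN ler_wpM2l//.
have [_ mono bm bp] := hbeta; have [s1|s1] := leP s (-1); first by rewrite bm//; lra.
have [s2|s2] := leP 1 s; first by rewrite bp//; lra.
have h1 := mono _ _ (ltW s1); have h2 := mono _ _ (ltW s2).
rewrite (bm _ (lexx _)) in h1; rewrite (bp _ (lexx _)) in h2.
have : `|beta s * s| <= 1 * 1 by rewrite normrM ler_pM// ler_norml; apply/andP; split=> //; lra.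
by rewrite ler_norml mulr1 => /andP[].
Qed.

(** The product of [beta s] and [s] is at least -1. *)
Lemma weight_le d d' s : d <= d' -> G d s <= expR (d' - d) * G d' s.
Proof.
move=> dd; rewrite !weightE -expRD ler_expR.
have := @exponent_ge (d' - d) s; rewrite subr_ge0 => /(_ dd).
by rewrite /exponent !mul0r !addr0; lra.
Qed.

Lemma weightN_le delta s : 0 <= delta -> G (- delta) s <= expR delta.
Proof.
move=> d0; have := @weight_le (- delta) 0 s; rewrite oppr_le0 sub0r opprK => /(_ d0).
by rewrite [G 0 s]weightE /exponent mul0r expR0 mulr1.
Qed.

Lemma exponent_lipschitz delta : exists2 L, 0 <= L & forall s t,
  exponent delta 0 s - exponent delta 0 t <= L * `|s - t|.
Proof.
have [L L0 hL] := exponent_bounded delta 0; exists L => // s t.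
have mvt a b : a < b -> `|exponent delta 0 b - exponent delta 0 a| <= L * (b - a).
  move=> ab; have [||x _ ->] := @MVT R (exponent delta 0) (exponent delta 1) a b ab.
  - by move=> x _; exact: exponent_deriv.
  - apply: continuous_subspaceT; exact: is_derive_continuous (exponent_deriv delta 0).
  by rewrite normrM (gtr0_norm (_ : 0 < b - a)) ?subr_gt0// ler_wpM2r// subr_ge0 ltW.
have [st|st|<-] := ltgtP s t; last by rewrite !subrr normr0 mulr0.
  have E : `|s - t| = t - s by rewrite distrC gtr0_norm ?subr_gt0.
  by apply: le_trans (ler_norm _) _; rewrite E distrC; exact: mvt.
have E : `|s - t| = s - t by rewrite gtr0_norm ?subr_gt0.
by apply: le_trans (ler_norm _) _; rewrite E; exact: mvt.
Qed.

(** The exponent is Lipschitz continuous. *)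
Lemma weight_shift delta : exists2 L, 0 <= L & forall h t,
  expR (- (L * `|h|)) <= G delta t / G delta (t + h) <= expR (L * `|h|).
Proof.
have [L L0 hL] := exponent_lipschitz delta; exists L => // h t.
rewrite !weightE -expRN -expRD !ler_expR; apply/andP; split.
  have := hL (t + h) t; rewrite addrAC subrr add0r; lra.
by have := hL t (t + h); rewrite opprD addrA subrr add0r normrN.
Qed.

End weights.

(** * Sobolev spaces *)

Section coord_deriv_algebra.
Context (R : realType) (X : lmodType R) (H : hilb X).
Context (c : nat -> X -> R) (wt : nat -> R) (e : nat -> X).
Hypothesis cH : coord_hilb H c wt e.
Local Notation mu := (@lebesgue_measure R).
Local Notation D := (coord_derivative c).
Implicit Types (v w u : R -> X).

Lemma coord_derivative_eq v w : coord_deriv c v w -> {ae mu, forall t, D v t = w t}.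
Proof. by move=> /(coord_derivativeP (ch_inj cH)) []. Qed.

Lemma coord_deriv_lin a v v' w w' : coord_deriv c v w -> coord_deriv c v' w' ->
  coord_deriv c (fun t => a *: v t + v' t) (fun t => a *: w t + w' t).
Proof.
move=> [lw d] [lw' d'].
have lin (u u' : R -> R) : locally_integrable setT u -> locally_integrable setT u' ->
    locally_integrable setT (fun t => a * u t + u' t).
  move=> lu lu'; apply: (@locally_integrableD _ setT (fun t => a * u t)) => //.
  case: lu => [mu1 _ iu]; split; [exact: measurable_funM|exact: openT|move=> K KD cK].
  under eq_integral do rewrite normrM EFinM.
  have mK : measurable (K : set (measurableTypeR R)) by exact: compact_measurable.
  have mn : measurable_fun (K : set (measurableTypeR R)) (EFin \o (fun t => `|u t|)).
    by apply/measurable_EFinP; apply: measurable_funTS; exact: measurableT_comp.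
  rewrite (ge0_integralZl (k := `|a|%:E) mu mK mn) ?lee_fin//; last first.
    by move=> x _; rewrite lee_fin.
  by apply: lte_mul_pinfty => //; exact: iu.
split=> [nu|nu h h0].
  have [u lu wu] := lw nu; have [u' lu' wu'] := lw' nu.
  exists (fun t => a * u t + u' t); first exact: lin.
  by apply: filterS2 wu wu' => t e1 e2; rewrite (coordD cH) (coordZ cH) e1 e2.
have [u lu wu] := lw nu; have [u' lu' wu'] := lw' nu.
apply: filterS2 (d nu h h0) (d' nu h h0) => t e1 e2.
have i1 := locint_itv t (t + h) lu; have i2 := locint_itv t (t + h) lu'.
have mK : measurable (`[t, t + h]%classic : set (measurableTypeR R)) by exact: measurable_itv.
rewrite (Rintegral_set_ae _ (g := fun s => a * u s + u' s)); last first.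
  by apply: filterS2 wu wu' => s E1 E2; rewrite (coordD cH) (coordZ cH) E1 E2.
rewrite RintegralD// ?RintegralZl//; last exact: (integrableZl mK a i1).
rewrite -(Rintegral_set_ae _ wu) -(Rintegral_set_ae _ wu') -e1 -e2.
by rewrite !(coordD cH, coordZ cH); ring.
Qed.

End coord_deriv_algebra.

Section sobolev_theory.
Context (R : realType) (X : lmodType R) (H : hilb X).
Context (c : nat -> X -> R) (wt : nat -> R) (e : nat -> X).
Hypothesis cH : coord_hilb H c wt e.
Context (p : R) (hp : 1 < p) (beta : R -> R) (hbeta : cutoff beta).
Local Notation mu := (@lebesgue_measure R).
Local Notation D := (coord_derivative c).
Local Notation Lp := (in_Lp H p).
Local Notation W := (in_sobolev H p).
Local Notation nW := (sobolev_norm H p).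
Implicit Types (v w u : R -> X).

Lemma Lp_weak_deriv_ae v v' w w' : {ae mu, forall t, v t = v' t} ->
  {ae mu, forall t, w t = w' t} -> Lp_weak_deriv H p v w -> Lp_weak_deriv H p v' w'.
Proof.
by move=> vv ww [lw d]; split; [exact: in_Lp_ae ww lw|exact: weak_deriv_ae vv ww d].
Qed.

Lemma sobolev_ae k v v' : {ae mu, forall t, v t = v' t} ->
  (W k v -> W k v') /\ nW k v = nW k v'.
Proof.
move=> vv; have v'v : {ae mu, forall t, v' t = v t} by apply: filterS vv => t ->.
have wE : weak_deriv H p v = weak_deriv H p v'.
  rewrite /weak_deriv; congr (xget _ _); apply/seteqP; split => w /=;
    by apply: Lp_weak_deriv_ae => //; exact: aeW.
case: k => [|k] /=; first by split; [exact: in_Lp_ae|exact: Lp_norm_ae].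
split; last by rewrite wE (Lp_norm_ae H p vv).
move=> [lv [w [dw Ww]]]; split; first exact: in_Lp_ae vv lv.
by exists w; split=> //; apply: Lp_weak_deriv_ae dw => //; exact: aeW.
Qed.

Lemma weak_deriv_D v w : Lp v -> Lp_weak_deriv H p v w ->
  {ae mu, forall t, D v t = w t} /\ Lp_weak_deriv H p v (D v).
Proof.
move=> lv [lw d]; have cd := weak_deriv_coord cH hp hbeta lv lw d.
have Dw := coord_derivative_eq cH cd; split=> //.
apply: Lp_weak_deriv_ae (conj lw d); first exact: aeW.
by apply: filterS Dw => t ->.
Qed.

Lemma sobolev_succ k v : W k.+1 v <-> [/\ Lp v, Lp_weak_deriv H p v (D v) & W k (D v)].
Proof.
split=> [[lv [w [dw Ww]]]|[lv dv Wv]]; last by split=> //; exists (D v).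
have [Dw dD] := weak_deriv_D lv dw; split=> //.
have wD : {ae mu, forall t, w t = D v t} by apply: filterS Dw => t ->.
exact: (sobolev_ae k wD).1.
Qed.

Lemma sobolev_norm_succ k v : W k.+1 v -> nW k.+1 v = Lp_norm H p v + nW k (D v).
Proof.
move=> /sobolev_succ [lv dv _] /=; congr (_ + _).
have dx : Lp_weak_deriv H p v (weak_deriv H p v).
  exact: (xgetPex (fun=> 0) (ex_intro _ (D v) dv)).
have [Dw _] := weak_deriv_D lv dx.
by apply/esym; exact: (sobolev_ae k Dw).2.
Qed.

Lemma sobolev_Lp k v : W k v -> Lp v.
Proof. by case: k => [//|k] []. Qed.

Lemma sobolev_norm_ge0 k v : 0 <= nW k v.
Proof. by elim: k v => [|k IH] v /=; rewrite ?addr_ge0// Lp_norm_ge0. Qed.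

Lemma sobolev_coord_deriv k v : W k.+1 v -> coord_deriv c v (D v).
Proof.
by move=> /sobolev_succ [lv [lD d] _]; exact: (weak_deriv_coord cH hp hbeta lv lD d).
Qed.

Lemma sobolev_weaken k v : W k.+1 v -> W k v /\ nW k v <= nW k.+1 v.
Proof.
elim: k v => [|k IH] v Wv.
  have [lv dv _] := (sobolev_succ 0 v).1 Wv.
  by split=> //=; rewrite lerDl Lp_norm_ge0.
have [lv dv WD] := (sobolev_succ k.+1 v).1 Wv; have [h1 h2] := IH _ WD.
have W1 : W k.+1 v by apply/sobolev_succ.
by split=> //; rewrite (sobolev_norm_succ W1) (sobolev_norm_succ Wv) lerD2l.
Qed.

(** As weak derivatives are unique, the norm may be computed with any of them. *)
Lemma sobolev_intro k v w : Lp v -> is_weak_deriv H v w -> W k w ->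
  [/\ W k.+1 v, {ae mu, forall t, D v t = w t} & nW k.+1 v = Lp_norm H p v + nW k w].
Proof.
move=> lv d Ww; have dw : Lp_weak_deriv H p v w by split=> //; exact: sobolev_Lp Ww.
have [Dw _] := weak_deriv_D lv dw.
have W1 : W k.+1 v by split=> //; exists w.
by split=> //; rewrite (sobolev_norm_succ W1) (sobolev_ae k Dw).2.
Qed.

Lemma sobolev_lin k a u v : W k u -> W k v ->
  W k (fun t => a *: u t + v t) /\ nW k (fun t => a *: u t + v t) <= `|a| * nW k u + nW k v.
Proof.
have LpL u' v' : Lp u' -> Lp v' -> Lp (fun t => a *: u' t + v' t) /\
    Lp_norm H p (fun t => a *: u' t + v' t) <= `|a| * Lp_norm H p u' + Lp_norm H p v'.
  move=> lu lv; have [l1 n1] := in_LpZ cH hp a lu; have [l2 n2] := in_LpD cH hp l1 lv.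
  by split=> //; apply: le_trans n2 _; rewrite lerD2r.
elim: k u v => [|k IH] u v; first exact: LpL.
move=> Wu Wv; have [lu [lDu du] WDu] := (sobolev_succ k u).1 Wu.
have [lv [lDv dv] WDv] := (sobolev_succ k v).1 Wv.
have [l1 n1] := LpL _ _ lu lv; have [W2 n2] := IH _ _ WDu WDv.
have [W1 _ ->] := sobolev_intro l1 (weak_deriv_lin cH hp a lu lv lDu lDv du dv) W2.
split=> //; rewrite (sobolev_norm_succ Wu) (sobolev_norm_succ Wv) mulrDr addrACA.
exact: lerD.
Qed.

Lemma sobolev0 k : W k (fun=> 0) /\ nW k (fun=> 0) = 0.
Proof.
have n0 : Lp_norm H p (fun=> 0) = 0.
  have [_] := in_LpZ cH hp 0 (in_Lp0 cH hp); under eq_fun do rewrite scaler0.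
  by rewrite normr0 mul0r => h; apply/eqP; rewrite eq_le h Lp_norm_ge0.
elim: k => [|k [W0 nk0]]; first by split=> //=; exact (in_Lp0 cH hp).
have d0 : is_weak_deriv H (fun=> 0) (fun=> 0 : X).
  move=> phi tphi; have hphi i t : hset H (phi i t) by case: tphi.
  have E i : \int[mu]_t hip H 0 (phi i t) = 0.
    transitivity (\int[mu]_(t in setT) (0 : R)); last by rewrite /Rintegral integral0.
    apply: eq_Rintegral => t _; rewrite -(scale0r (0 : X)).
    by rewrite (hipZl cH _ (hset0 cH) (hphi i t)) mul0r.
  by rewrite !E oppr0.
have [W1 _ ->] := sobolev_intro (in_Lp0 cH hp) d0 W0.
by rewrite n0 nk0 addr0.
Qed.

Lemma sobolev_add k u v : W k u -> W k v ->
  W k (fun t => u t + v t) /\ nW k (fun t => u t + v t) <= nW k u + nW k v.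
Proof.
move=> Wu Wv; have := sobolev_lin 1 Wu Wv; rewrite normr1 mul1r.
suff -> : (fun t => 1 *: u t + v t) = (fun t => u t + v t) by [].
by apply/funext => t; rewrite scale1r.
Qed.

(** The derivative of [g 0 u] is [g 1 u + g 0 u'], and both families [g] and
[g 1, g 2, ...] are of the same kind. *)
Lemma sobolev_multiplier k (g : nat -> R -> R) :
  (forall i (t : R), is_derive t (1 : R) (g i) (g i.+1 t)) ->
  (forall i, exists2 K, 0 <= K & forall t, `|g i t| <= K) ->
  exists2 C, 0 <= C & forall u, W k u ->
    W k (fun t => g 0%N t *: u t) /\ nW k (fun t => g 0%N t *: u t) <= C * nW k u.
Proof.
elim: k g => [|k IH] g dg bg.
  have [K K0 hK] := bg 0%N; exists K => // u lu; apply: (in_LpM cH hp) => //.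
  exact: continuous_measurable_fun (is_derive_continuous (dg 0%N)).
have [K K0 hK] := bg 0%N.
have mg : measurable_fun setT (g 0%N) by exact: continuous_measurable_fun (is_derive_continuous (dg 0%N)).
have [C C0 hC] := IH g dg bg.
have [C' C'0 hC'] := IH (fun i => g i.+1) (fun i => dg i.+1) (fun i => bg i.+1).
exists (K + C + C') => [|u Wu]; first by rewrite !addr_ge0.
have [lu [lD d] WD] := (sobolev_succ k u).1 Wu.
have [Wu' nu'] := sobolev_weaken Wu.
have [l1 n1] := in_LpM cH hp mg hK lu.
have [W1 m1] := hC' _ Wu'; have [W2 m2] := hC _ WD.
have [W3 m3] := sobolev_add W1 W2.
have [W4 _ ->] := sobolev_intro l1 (weak_deriv_mul cH hp dg lu lD d) W3; split=> //.
apply: le_trans (lerD n1 (le_trans m3 (lerD m1 m2))) _.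
have a1 : C' * nW k u <= C' * nW k.+1 u by rewrite ler_wpM2l.
have a2 : C * nW k (D u) <= C * nW k.+1 u.
  by rewrite ler_wpM2l// (sobolev_norm_succ Wu) lerDr Lp_norm_ge0.
have a3 : K * Lp_norm H p u <= K * nW k.+1 u.
  by rewrite ler_wpM2l// (sobolev_norm_succ Wu) lerDl sobolev_norm_ge0.
by rewrite !mulrDl; lra.
Qed.

End sobolev_theory.

(** * Weighted Sobolev spaces *)

Section weighted_Lp.
Context (R : realType) (X : lmodType R) (H : hilb X).
Context (c : nat -> X -> R) (wt : nat -> R) (e : nat -> X).
Hypothesis cH : coord_hilb H c wt e.
Context (p : R) (hp : 1 < p) (beta : R -> R) (hbeta : cutoff beta) (delta : R).
Local Notation mu := (@lebesgue_measure R).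
Local Notation G := (gamma_weight beta delta).
Local Notation Lp := (in_Lp H p).
Implicit Types (v w u : R -> X).

(** The case of order zero of [in_wsobolev]. *)
Definition wLp v : Prop := Lp v /\ Lp (weighted beta delta v).
Definition wLp_norm v : R := Lp_norm H p (weighted beta delta v).

Lemma weighted_lin a u v :
  weighted beta delta (fun t => a *: u t + v t) =
  (fun t => a *: weighted beta delta u t + weighted beta delta v t).
Proof.
by apply/funext => t; rewrite /weighted scalerDr !scalerA mulrC.
Qed.

Lemma weighted_ae v v' : {ae mu, forall t, v t = v' t} ->
  {ae mu, forall t, weighted beta delta v t = weighted beta delta v' t}.
Proof. by apply: filterS => t; rewrite /weighted => ->. Qed.

Lemma Lp_lin a u v : Lp u -> Lp v -> Lp (fun t => a *: u t + v t) /\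
  Lp_norm H p (fun t => a *: u t + v t) <= `|a| * Lp_norm H p u + Lp_norm H p v.
Proof.
move=> lu lv; have [l1 n1] := in_LpZ cH hp a lu; have [l2 n2] := in_LpD cH hp l1 lv.
by split=> //; apply: le_trans n2 _; rewrite lerD2r.
Qed.

Lemma wLp_ae v v' : {ae mu, forall t, v t = v' t} -> wLp v -> wLp v'.
Proof.
by move=> vv [l1 l2]; split; [exact: in_Lp_ae vv l1|exact: in_Lp_ae (weighted_ae vv) l2].
Qed.

Lemma wLp_norm_ae v v' : {ae mu, forall t, v t = v' t} -> wLp_norm v = wLp_norm v'.
Proof. by move=> vv; exact: (Lp_norm_ae H p (weighted_ae vv)). Qed.

Lemma wLp_lin a u v : wLp u -> wLp v -> wLp (fun t => a *: u t + v t) /\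
  wLp_norm (fun t => a *: u t + v t) <= `|a| * wLp_norm u + wLp_norm v.
Proof.
move=> [u1 u2] [v1 v2]; rewrite /wLp /wLp_norm weighted_lin.
have [h1 _] := Lp_lin a u1 v1; have [h2 n2] := Lp_lin a u2 v2.
by split.
Qed.

Lemma weight_ratio_measurable h : measurable_fun setT (fun t => G t / G (t + h)).
Proof.
apply: continuous_measurable_fun => t; apply: cvgM; first exact: weight_continuous.
apply: cvgV; first by rewrite gt_eqF// weight_gt0.
have cs : s + h @[s --> t] --> t + h by apply: cvgD; [exact: cvg_id|exact: cvg_cst].
exact: (@cvg_comp _ _ _ (fun s => s + h) G _ _ _ cs (@weight_continuous _ _ hbeta delta (t + h))).
Qed.

Lemma wLp_shift : exists2 L, 0 <= L & forall tau v, wLp v ->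
  wLp (fun t => v (t + tau)) /\ wLp_norm (fun t => v (t + tau)) <= expR (L * `|tau|) * wLp_norm v.
Proof.
have [L L0 hL] := weight_shift hbeta delta; exists L => // tau v [l1 l2].
pose m t := G t / G (t + tau).
have E : weighted beta delta (fun t => v (t + tau)) =
    (fun t => m t *: weighted beta delta v (t + tau)).
  by apply/funext => t; rewrite /weighted scalerA divfK// gt_eqF// weight_gt0.
have mm : forall t, `|m t| <= expR (L * `|tau|).
  move=> t; have /andP[_ mt] := hL tau t.
  by rewrite (ger0_norm (x := m t))// divr_ge0// ltW// weight_gt0.
have [l3 n3] := in_LpM cH hp (weight_ratio_measurable tau) mm (in_Lp_shift cH hp tau l2).
rewrite /wLp /wLp_norm E; split; first by split=> //; exact (in_Lp_shift cH hp tau l1).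
by apply: le_trans n3 _; rewrite (Lp_norm_shift H p tau (weighted beta delta v)).
Qed.

(** With [u = G v] the difference [G (v (. + h) - v)] is
    [m (u (. + h) - u) + (m - 1) u], where [m = G / G (. + h)] tends to 1
    uniformly as [h] tends to 0. *)
Lemma wLp_continuous v : wLp v -> forall eps, 0 < eps -> exists2 d, 0 < d &
  forall h, `|h| < d -> wLp_norm (fun t => v (t + h) - v t) < eps.
Proof.
move=> [l1 l2] eps eps0; have [L L0 hL] := weight_shift hbeta delta.
pose u := weighted beta delta v; pose B := Lp_norm H p u + 1.
have B0 : 0 < B by rewrite ltr_wpDl// Lp_norm_ge0.
have e4 : 0 < eps / 4 by rewrite divr_gt0.
have [d1 d10 hd1] := Lp_translation_continuous cH hp l2 e4.
(* With [m <= 1 + eta <= 2] and [`|m - 1| <= eta] each term is at most [eps / 2]. *)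
pose eta := Num.min 1 (eps / (2 * B)).
have eta0 : 0 < eta by rewrite lt_min ltr01 divr_gt0// mulr_gt0.
have [d2 d20 hd2] : exists2 d : R, 0 < d & forall h : R, `|h| < d -> expR (L * `|h|) < 1 + eta.
  have : (fun x : R => expR x) @ 0 --> (1 : R) by rewrite -expR0; exact: continuous_expR.
  have eta1 : 1 < 1 + eta by rewrite ltrDl.
  move=> /cvgr_lt /(_ (1 + eta) eta1) /nbhs_ballP [d /= d0 hd].
  have L1 : 0 < L + 1 by rewrite ltr_wpDl.
  exists (d / (L + 1)) => [|h]; first by rewrite divr_gt0.
  rewrite ltr_pdivlMr// => hh; apply: hd.
  rewrite /ball/= sub0r normrN ger0_norm ?mulr_ge0//.
  by apply: le_lt_trans hh; rewrite mulrDr mulr1 mulrC lerDl.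
exists (Num.min d1 d2) => [|h]; first by rewrite lt_min d10.
rewrite lt_min => /andP[h1 h2]; pose m t := G t / G (t + h).
have := hd2 _ h2; set x := expR _ => xe.
have x1 : 1 <= x by rewrite -expR0 ler_expR mulr_ge0.
have mb t : x^-1 <= m t <= x by rewrite -expRN; exact: hL.
have m0 t : 0 <= m t by have /andP[+ _] := mb t; apply: le_trans; rewrite invr_ge0 (le_trans ler01).
have hm1 t : `|m t| <= x by rewrite ger0_norm//; have /andP[] := mb t.
have hm2 t : `|m t - 1| <= x - 1.
  have /andP[a b] := mb t; rewrite ler_norml lerB// andbT.
  (* From [x + x^-1 >= 2]. *)
  suff : 2 - x <= x^-1 by lra.
  have x0 : 0 < x by exact: lt_le_trans x1.
  rewrite -(@ler_pM2r _ x)// mulVf ?gt_eqF//.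
  have : 0 <= (x - 1) * (x - 1) by rewrite -expr2 sqr_ge0.
  by lra.
have E : weighted beta delta (fun t => v (t + h) - v t) =
    (fun t => m t *: (u (t + h) - u t) + (m t - 1) *: u t).
  apply/funext => t; rewrite /= scalerBl scale1r !scalerBr addrA subrK /u /weighted scalerA divfK ?scalerBr//.
  by rewrite gt_eqF// weight_gt0.
have mm : measurable_fun setT m by exact: weight_ratio_measurable.
have lh : Lp (fun t => u (t + h)) by exact (in_Lp_shift cH hp h l2).
have [l3 _] := in_LpB cH hp lh l2.
have [l4 n4] := in_LpM cH hp mm hm1 l3.
have mm1 : measurable_fun setT (fun t => m t - 1).
  by apply: measurable_funB => //; exact: measurable_cst.
have [l5 n5] := in_LpM cH hp mm1 hm2 l2.
have [_ n6] := in_LpD cH hp l4 l5; rewrite /wLp_norm E; apply: le_lt_trans n6 _.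
apply: le_lt_trans (lerD n4 n5) _.
have a1 : x * Lp_norm H p (fun t => u (t + h) - u t) <= 2 * (eps / 4).
  apply: ler_pM; rewrite ?Lp_norm_ge0 ?(le_trans ler01)//; last exact: ltW (hd1 _ h1).
  by apply: le_trans (ltW xe) _; rewrite -[leRHS]/(1 + 1) lerD2l ge_min lexx.
have a2 : (x - 1) * Lp_norm H p u < eps / 2.
  apply: (@le_lt_trans _ _ ((x - 1) * B)); first by rewrite ler_wpM2l ?subr_ge0// lerDl.
  apply: (@lt_le_trans _ _ (eta * B)); first by rewrite ltr_pM2r// ltrBlDl.
  apply: (@le_trans _ _ (eps / (2 * B) * B)); last by rewrite invfM mulrA divfK ?gt_eqF.
  by rewrite ler_pM2r// ge_min lexx orbT.
by apply: lt_le_trans (ler_ltD a1 a2) _; lra.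
Qed.

Lemma wLp_difference_quotient v w : wLp v -> wLp w -> coord_deriv c v w ->
  forall eps, 0 < eps -> exists2 d, 0 < d & forall h, 0 < h < d ->
    wLp_norm (fun t => v (t + h) - v t - h *: w t) <= eps * h.
Proof.
move=> lv lw cd eps eps0; have [d d0 hd] := wLp_continuous lw eps0.
exists d => // h /andP[h0 hh]; have [L L0 hL] := wLp_shift.
have wB v1 v2 : wLp v1 -> wLp v2 -> wLp (fun t => v1 t - v2 t).
  move=> l1 l2; have [l3 _] := wLp_lin (-1) l2 l1.
  by apply: wLp_ae l3; apply: aeW => t; rewrite scaleN1r addrC.
have fin v1 : wLp v1 -> (Lp_integral H p (weighted beta delta v1) < +oo)%E.
  by move=> [_ [_ l]]; apply/eLp_norm_lty.
have lq : wLp (fun t => v (t + h) - v t - h *: w t).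
  apply: (wB _ _ (wB _ _ (hL h v lv).1 lv)).
  have [l3 _] := wLp_lin (h - 1) lw lw; apply: wLp_ae l3; apply: aeW => t.
  by rewrite -{2}[w t]scale1r -scalerDl subrK.
have M0 : 0 <= h * eps by rewrite mulr_ge0// ltW.
rewrite mulrC /wLp_norm; have [+ _] := Lp_norm_le hp (fin _ lq) M0; apply.
apply: (difference_quotient_le cH hp _ _ lv.1 lw.1 cd h0 (ltW eps0)).
- exact: weight_measurable.
- by move=> t; exact: ltW (weight_gt0 _ _ _).
move=> s /andP[s0 sh].
have ls : wLp (fun t => w (t + s) - w t) by exact: (wB _ _ (hL s w lw).1 lw).
have [_] := Lp_norm_le hp (fin _ ls) (ltW eps0); apply.
by apply: ltW; apply: hd; rewrite ger0_norm// (le_lt_trans sh).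
Qed.

End weighted_Lp.

Section weighted_sobolev.
Context (R : realType) (X : lmodType R) (H : hilb X).
Context (c : nat -> X -> R) (wt : nat -> R) (e : nat -> X).
Hypothesis cH : coord_hilb H c wt e.
Context (p : R) (hp : 1 < p) (beta : R -> R) (hbeta : cutoff beta).
Local Notation mu := (@lebesgue_measure R).
Local Notation G := (gamma_weight beta).
Local Notation D := (coord_derivative c).
Local Notation Lp := (in_Lp H p).
Local Notation W := (in_sobolev H p).
Local Notation nW := (sobolev_norm H p).
Local Notation wW := (in_wsobolev H beta p).
Local Notation nwW := (wsobolev_norm H beta p).
Implicit Types (v w u : R -> X).

(** The same space, described by the sizes of the weighted derivatives instead of
the derivatives of the weighted function. In this form the statements about
translations can be proved one derivative at a time. *)
Fixpoint wderiv delta i v : Prop :=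
  wLp H p beta delta v /\
  if i is i'.+1 then is_weak_deriv H v (D v) /\ wderiv delta i' (D v) else True.

Fixpoint wderiv_norm delta i v : R :=
  wLp_norm H p beta delta v + if i is i'.+1 then wderiv_norm delta i' (D v) else 0.

Local Notation Wd := wderiv.
Local Notation N := wderiv_norm.

Lemma wderiv_norm_ge0 delta i v : 0 <= N delta i v.
Proof. by elim: i v => [|i IH] v /=; rewrite ?addr0 ?addr_ge0 ?Lp_norm_ge0//. Qed.

Lemma wderiv_wLp delta i v : Wd delta i v -> wLp H p beta delta v.
Proof. by case: i => [|i] []. Qed.

Lemma wderiv_ae delta i v v' : {ae mu, forall t, v t = v' t} -> Wd delta i v ->
  Wd delta i v' /\ N delta i v' = N delta i v.
Proof.
move=> vv; have v'v : {ae mu, forall t, v' t = v t} by apply: filterS vv => t ->.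
have Dv := coord_derivative_ae c vv.
case: i => [|i] /= [lv]; rewrite (wLp_norm_ae H p beta delta v'v); first by have := wLp_ae hp vv lv.
rewrite -Dv => -[dv Wv]; split=> //; split; first exact (wLp_ae hp vv lv).
by split=> //; apply: weak_deriv_ae dv => //; exact: aeW.
Qed.

Lemma wderiv_intro delta i v w : wLp H p beta delta v -> is_weak_deriv H v w ->
  Wd delta i w -> [/\ Wd delta i.+1 v, {ae mu, forall t, D v t = w t} &
    N delta i.+1 v = wLp_norm H p beta delta v + N delta i w].
Proof.
move=> lv dv Ww; have lw : Lp w := (wderiv_wLp Ww).1.
have [Dw [_ dD]] := weak_deriv_D cH hp hbeta lv.1 (conj lw dv).
have wD : {ae mu, forall t, w t = D v t} by apply: filterS Dw => t ->.
by have [h1 h2] := wderiv_ae wD Ww; split=> //=; rewrite h2.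
Qed.

Lemma wderiv_weaken delta i v : Wd delta i.+1 v ->
  Wd delta i v /\ N delta i v <= N delta i.+1 v.
Proof.
elim: i v => [|i IH] v; first by move=> [lv [_ Wv]]; split=> //=; rewrite lerD2l addr0 Lp_norm_ge0.
move=> [lv [dv Wv]]; have [h1 h2] := IH _ Wv.
by split; [split|rewrite lerD2l].
Qed.

Lemma wderiv_lin delta i a u v : Wd delta i u -> Wd delta i v ->
  Wd delta i (fun t => a *: u t + v t) /\
  N delta i (fun t => a *: u t + v t) <= `|a| * N delta i u + N delta i v.
Proof.
elim: i u v => [|i IH] u v /=.
  move=> [lu _] [lv _]; have [l n] := wLp_lin cH hp a lu lv.
  by split=> //; rewrite !addr0.
move=> [lu [du Wu]] [lv [dv Wv]]; have [l n] := wLp_lin cH hp a lu lv.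
have [W1 n1] := IH _ _ Wu Wv.
have d := weak_deriv_lin cH hp a lu.1 lv.1 (wderiv_wLp Wu).1 (wderiv_wLp Wv).1 du dv.
have [W2 _ /= ->] := wderiv_intro l d W1; split=> //.
by rewrite mulrDr addrACA lerD.
Qed.

Lemma wderiv_sub delta i u v : Wd delta i u -> Wd delta i v ->
  Wd delta i (fun t => u t - v t).
Proof.
move=> Wu Wv; have [W1 _] := wderiv_lin (-1) Wv Wu; apply: (wderiv_ae _ W1).1.
by apply: aeW => t; rewrite scaleN1r addrC.
Qed.

Lemma wderiv_shift delta : exists2 L, 0 <= L & forall i tau v, Wd delta i v ->
  Wd delta i (fun t => v (t + tau)) /\
  N delta i (fun t => v (t + tau)) <= expR (L * `|tau|) * N delta i v.
Proof.
have [L L0 hL] := wLp_shift cH hp hbeta delta; exists L => // i tau.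
elim: i => [|i IH] v /=.
  by move=> [lv _]; have [l n] := hL tau v lv; rewrite !addr0.
move=> [lv [dv Wv]]; have [l n] := hL tau v lv; have [W1 n1] := IH _ Wv.
by have [W2 _ /= ->] := wderiv_intro l (weak_deriv_shift tau dv) W1; rewrite mulrDr lerD.
Qed.

Lemma wderiv_continuous delta i v : Wd delta i v -> forall eps, 0 < eps ->
  exists2 d, 0 < d & forall h, `|h| < d -> N delta i (fun t => v (t + h) - v t) < eps.
Proof.
have [L L0 hL] := wderiv_shift delta.
elim: i v => [|i IH] v /= [lv].
  move=> _ eps eps0; have [d d0 hd] := wLp_continuous cH hp hbeta lv eps0.
  by exists d => // h hh; rewrite addr0 hd.
move=> [dv Wv] eps eps0; have e2 : 0 < eps / 2 by rewrite divr_gt0.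
have [d d0 hd] := wLp_continuous cH hp hbeta lv e2; have [d' d'0 hd'] := IH _ Wv _ e2.
exists (Num.min d d') => [|h]; first by rewrite lt_min d0.
rewrite lt_min => /andP[h1 h2].
have W1 : Wd delta i.+1 v by split.
have [Ws _] := hL _ h _ W1; have [WDs _] := hL _ h _ Wv.
have dB : is_weak_deriv H (fun t => v (t + h) - v t) (fun t => D v (t + h) - D v t).
  have := weak_deriv_lin cH hp (-1) lv.1 (wderiv_wLp Ws).1 (wderiv_wLp Wv).1 (wderiv_wLp WDs).1
    dv (weak_deriv_shift h dv).
  by apply: weak_deriv_ae; apply: aeW => t; rewrite scaleN1r addrC.
have [_ _ /= ->] := wderiv_intro (wderiv_wLp (wderiv_sub Ws W1)) dB (wderiv_sub WDs Wv).
by have := ltrD (hd _ h1) (hd' _ h2); rewrite -splitr.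
Qed.

Lemma wderiv_coord delta i v : Wd delta i.+1 v -> coord_deriv c v (D v).
Proof.
by move=> [lv [dv Wv]]; exact: (weak_deriv_coord cH hp hbeta lv.1 (wderiv_wLp Wv).1 dv).
Qed.

Lemma wderiv_difference_quotient delta i v : Wd delta i.+1 v -> forall eps, 0 < eps ->
  exists2 d, 0 < d & forall h, 0 < h < d ->
    N delta i (fun t => v (t + h) - v t - h *: D v t) <= eps * h.
Proof.
have [L L0 hL] := wderiv_shift delta.
elim: i v => [|i IH] v Wv1 eps eps0.
  have cd := wderiv_coord Wv1; move: Wv1 => [lv [dv [lD _]]].
  have [d d0 hd] := wLp_difference_quotient cH hp hbeta lv lD cd eps0.
  by exists d => // h hh /=; rewrite addr0; exact: hd.
have e2 : 0 < eps / 2 by rewrite divr_gt0.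
have cd := wderiv_coord Wv1; have [lv [dv Wv0]] := Wv1.
have Wv : Wd delta i.+1 (D v) := Wv0.
have lD := wderiv_wLp Wv.
have [d d0 hd] := wLp_difference_quotient cH hp hbeta lv lD cd e2.
have [d' d'0 hd'] := IH _ Wv _ e2.
exists (Num.min d d') => [|h /andP[h0]]; first by rewrite lt_min d0.
rewrite lt_min => /andP[h1 h2].
have [Wv' _] := wderiv_weaken Wv1; have [WD' _] := wderiv_weaken Wv.
have [WDD dD] : Wd delta i (D (D v)) /\ is_weak_deriv H (D v) (D (D v)) by case: Wv => _ [].
have [Ws _] := hL _ h _ Wv'; have [WDs _] := hL _ h _ WD'.
have cmb j u1 u2 u3 : Wd delta j u1 -> Wd delta j u2 -> Wd delta j u3 ->
    Wd delta j (fun t => u1 t - u2 t - h *: u3 t).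
  move=> w1 w2 w3; have [w4 _] := wderiv_lin (- h) w3 (wderiv_sub w1 w2).
  by apply: (wderiv_ae _ w4).1; apply: aeW => t; rewrite scaleNr addrC.
have dB : is_weak_deriv H (fun t => v (t + h) - v t - h *: D v t)
    (fun t => D v (t + h) - D v t - h *: D (D v) t).
  have ls := (wderiv_wLp Ws).1; have lDs := (wderiv_wLp WDs).1.
  have lDD := (wderiv_wLp WDD).1.
  have d1 := weak_deriv_lin cH hp (-1) lv.1 ls lD.1 lDs dv (weak_deriv_shift h dv).
  have [l1 _] := Lp_lin cH hp (-1) lv.1 ls; have [l2 _] := Lp_lin cH hp (-1) lD.1 lDs.
  have := weak_deriv_lin cH hp (- h) lD.1 l1 lDD l2 dD d1.
  by apply: weak_deriv_ae; apply: aeW => t; rewrite scaleN1r scaleNr addrC [- _ + _]addrC.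
have W3 := cmb _ _ _ _ WDs WD' WDD.
have [_ _ ->] := wderiv_intro (wderiv_wLp (cmb _ _ _ _ (wderiv_weaken Ws).1 (wderiv_weaken Wv').1 WD')) dB W3.
rewrite (splitr eps) mulrDl; apply: lerD; first by apply: hd; rewrite h0.
by apply: hd'; rewrite h0.
Qed.

(** The product rule is applied to [v = G (- delta) (G delta v)]: as
[0 <= delta], the factor [G (- delta)] is bounded, so that the candidate for the
derivative is in L^p and uniqueness applies. *)
Lemma weighted_deriv_ae delta v : 0 <= delta -> W 1 v -> W 1 (weighted beta delta v) ->
  {ae mu, forall t, weighted beta delta (D v) t =
    D (weighted beta delta v) t - exponent beta delta 1 t *: weighted beta delta v t}.
Proof.
move=> d0 /(sobolev_succ cH hp hbeta 0 v) [lv _ _].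
set u := weighted beta delta v => /(sobolev_succ cH hp hbeta 0 u) [lu [lDu du] _].
have [F F0 [dF F1]] := weight_family hbeta (- delta).
have d := weak_deriv_mul cH hp dF lu lDu du.
have [K K0 hK] := exponent_bounded hbeta delta 0.
have gb t : `|G (- delta) t| <= expR delta.
  by rewrite ger0_norm ?weightN_le// ltW// weight_gt0.
have F1E t : F 1%N t = - (exponent beta delta 1 t * G (- delta) t).
  by rewrite F1 /exponent !mulNr.
have mE : measurable_fun setT (exponent beta delta 1).
  exact: continuous_measurable_fun (is_derive_continuous (exponent_deriv hbeta delta 1)).
have lw : Lp (fun t => F 1%N t *: u t + F 0%N t *: D u t).
  have b1 t : `|F 1%N t| <= K * expR delta.
    by rewrite F1E normrN normrM ler_pM.
  have m1 : measurable_fun setT (F 1%N).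
    exact: continuous_measurable_fun (is_derive_continuous (dF 1%N)).
  have [l1 _] := in_LpM cH hp m1 b1 lu.
  have [l2 _] := in_LpM cH hp (weight_measurable hbeta (- delta)) gb lDu.
  by rewrite F0; exact: (in_LpD cH hp l1 l2).1.
have uE t : F 0%N t *: u t = v t by rewrite F0 scalerA weightN scale1r.
have d' : is_weak_deriv H v (fun t => F 1%N t *: u t + F 0%N t *: D u t).
  by apply: weak_deriv_ae d; apply: aeW => t.
have [Dw _] := weak_deriv_D cH hp hbeta lv (conj lw d').
apply: filterS Dw => t; rewrite /weighted => ->.
rewrite F1E F0 scalerDr !scalerA mulrN mulrCA [G delta t * _]mulrC weightN mulr1.
by rewrite mulNr scaleNr scale1r addrC.
Qed.

Lemma exponent_multiplier delta i : exists2 C, 0 <= C & forall u, W i u ->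
  W i (fun t => exponent beta delta 1 t *: u t) /\
  nW i (fun t => exponent beta delta 1 t *: u t) <= C * nW i u.
Proof.
exact: (sobolev_multiplier cH hp hbeta (g := fun i => exponent beta delta i.+1)
  i (fun i => exponent_deriv hbeta delta i.+1) (exponent_bounded hbeta delta)).
Qed.

(** [G v] and [v = G^-1 (G v)] differ by a factor that can be differentiated,
    and [G' / G] is a bounded function with bounded derivatives. *)
Lemma wsobolev_wderiv delta i : 0 <= delta -> exists2 C, 0 <= C & forall v, wW delta i v ->
  Wd delta i v /\ N delta i v <= C * nwW delta i v.
Proof.
move=> d0; elim: i => [|i [C C0 IH]].
  by exists 1 => // v [lv lGv]; rewrite mul1r /= addr0.
have [C' C'0 hC'] := exponent_multiplier delta i.
exists (1 + C * (1 + C')) => [|v [Wv WGv]]; first by rewrite addr_ge0// mulr_ge0// addr_ge0.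
have toW1 j w : W j.+1 w -> W 1 w.
  by elim: j => // j IHj /(sobolev_weaken cH hp hbeta) [/IHj].
have Dae := weighted_deriv_ae d0 (toW1 _ _ Wv) (toW1 _ _ WGv).
have [lv [lDv dv] WDv] := (sobolev_succ cH hp hbeta i v).1 Wv.
have [lGv _ WDGv] := (sobolev_succ cH hp hbeta i _).1 WGv.
have [WGv' nGv'] := sobolev_weaken cH hp hbeta WGv.
have [W1 n1] := hC' _ WGv'.
have [W2 n2] := sobolev_lin cH hp hbeta (-1) W1 WDGv.
have Dae' : {ae mu, forall t, -1 *: (exponent beta delta 1 t *: weighted beta delta v t)
    + D (weighted beta delta v) t = weighted beta delta (D v) t}.
  by apply: filterS Dae => t ->; rewrite scaleN1r addrC.
have [W3 n3] := sobolev_ae H hp i Dae'; have WGD := W3 W2.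
have [W4 n4] := IH (D v) (conj WDv WGD); split; first by split.
rewrite /= mulrDl mul1r; apply: lerD.
  by rewrite /wsobolev_norm (sobolev_norm_succ cH hp hbeta WGv) lerDl sobolev_norm_ge0.
apply: le_trans n4 _; rewrite -mulrA ler_wpM2l// /wsobolev_norm -n3.
apply: le_trans n2 _; rewrite normrN1 mul1r mulrDl mul1r addrC; apply: lerD.
  by rewrite (sobolev_norm_succ cH hp hbeta WGv) lerDr Lp_norm_ge0.
by apply: le_trans n1 _; rewrite ler_wpM2l.
Qed.

(** In this direction the product rule for [G v] gives a candidate that is in L^p
because [G D v] is. *)
Lemma wderiv_wsobolev delta i : exists2 C, 0 <= C & forall v, Wd delta i v ->
  wW delta i v /\ nwW delta i v <= C * N delta i v.
Proof.
elim: i => [|i [C C0 IH]].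
  by exists 1 => // v [[lv lGv] _]; rewrite mul1r /= addr0.
have [C' C'0 hC'] := exponent_multiplier delta i.
exists (1 + (C' * C + C)) => [|v Wv]; first by rewrite !addr_ge0// mulr_ge0.
have [Wv' nv'] := wderiv_weaken Wv; have [lv [dv WDv]] := Wv.
have [[W1 W2] n2] := IH _ Wv'; have [[W3 W4] n4] := IH _ WDv.
have [W5 n5] := hC' _ W2; have [W6 n6] := sobolev_add cH hp hbeta W5 W4.
have [F F0 [dF F1]] := weight_family hbeta delta.
have d := weak_deriv_mul cH hp dF lv.1 (wderiv_wLp WDv).1 dv.
have d' : is_weak_deriv H (weighted beta delta v)
    (fun t => exponent beta delta 1 t *: weighted beta delta v t + weighted beta delta (D v) t).
  by apply: weak_deriv_ae d; apply: aeW => t; rewrite F0 ?F1 /weighted ?scalerA.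
have [W7 _ n7] := sobolev_intro cH hp hbeta lv.2 d' W6.
have W8 : W i.+1 v by apply/(sobolev_succ cH hp hbeta); split=> //; [exact: lv.1|split=> //; exact: (wderiv_wLp WDv).1].
split=> //; rewrite /wsobolev_norm n7 mulrDl mul1r; apply: lerD.
  by rewrite /= lerDl wderiv_norm_ge0.
apply: le_trans n6 _; rewrite mulrDl; apply: lerD.
  by apply: le_trans n5 _; rewrite -mulrA ler_wpM2l// (le_trans n2)// ler_wpM2l.
apply: le_trans n4 _; rewrite ler_wpM2l//=.
by rewrite lerDr Lp_norm_ge0.
Qed.

Lemma wderiv_le delta delta' i v : delta <= delta' -> Wd delta' i v ->
  Wd delta i v /\ N delta i v <= expR (delta' - delta) * N delta' i v.
Proof.
move=> dd; have base w : wLp H p beta delta' w -> wLp H p beta delta w /\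
    wLp_norm H p beta delta w <= expR (delta' - delta) * wLp_norm H p beta delta' w.
  move=> [lw lGw]; pose m t := G delta t / G delta' t.
  have mm : measurable_fun setT m.
    apply: continuous_measurable_fun => t; apply: cvgM; first exact: weight_continuous.
    by apply: cvgV; [rewrite gt_eqF// weight_gt0|exact: weight_continuous].
  have mb t : `|m t| <= expR (delta' - delta).
    rewrite ger0_norm ?divr_ge0 ?(ltW (weight_gt0 _ _ _))//.
    by rewrite ler_pdivrMr ?weight_gt0// weight_le.
  have [l n] := in_LpM cH hp mm mb lGw.
  have E : weighted beta delta w = (fun t => m t *: weighted beta delta' w t).
    by apply/funext => t; rewrite /weighted scalerA divfK// gt_eqF// weight_gt0.
  by rewrite /wLp /wLp_norm E.
elim: i v => [|i IH] v /=.
  by move=> [/base [l n] _]; rewrite !addr0.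
move=> [/base [l n] [dv /IH [W1 n1]]]; split=> //.
by rewrite mulrDr lerD.
Qed.

End weighted_sobolev.

Section weighted_sobolev_facts.
Context (R : realType) (X : lmodType R) (H : hilb X).
Context (c : nat -> X -> R) (wt : nat -> R) (e : nat -> X).
Hypothesis cH : coord_hilb H c wt e.
Context (p : R) (hp : 1 < p) (beta : R -> R) (hbeta : cutoff beta).
Local Notation mu := (@lebesgue_measure R).
Local Notation D := (coord_derivative c).
Local Notation wW := (in_wsobolev H beta p).
Local Notation nwW := (wsobolev_norm H beta p).
Implicit Types (v w u : R -> X).

Lemma wsobolev_ae delta i v v' : {ae mu, forall t, v t = v' t} ->
  (wW delta i v -> wW delta i v') /\ nwW delta i v = nwW delta i v'.
Proof.
move=> vv; have [h1 _] := sobolev_ae H hp i vv.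
have [h2 n2] := sobolev_ae H hp i (weighted_ae beta delta vv).
by split=> // -[w1 w2]; split; auto.
Qed.

Lemma wsobolev_lin delta i a u v : wW delta i u -> wW delta i v ->
  wW delta i (fun t => a *: u t + v t) /\
  nwW delta i (fun t => a *: u t + v t) <= `|a| * nwW delta i u + nwW delta i v.
Proof.
move=> [u1 u2] [v1 v2]; have [h1 _] := sobolev_lin cH hp hbeta a u1 v1.
have [h2 n2] := sobolev_lin cH hp hbeta a u2 v2.
by rewrite /in_wsobolev /wsobolev_norm weighted_lin.
Qed.

Lemma wsobolev0 delta i : wW delta i (fun=> 0) /\ nwW delta i (fun=> 0) = 0.
Proof.
rewrite /in_wsobolev /wsobolev_norm.
have -> : weighted beta delta (fun=> 0 : X) = (fun=> 0).
  by apply/funext => t; rewrite /weighted scaler0.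
by have [] := sobolev0 cH hp hbeta i.
Qed.

Lemma wsobolev_shift delta i r : 0 <= delta -> exists2 C, 0 <= C & forall tau v,
  `|tau| <= r -> wW delta i v ->
  wW delta i (fun t => v (t + tau)) /\ nwW delta i (fun t => v (t + tau)) <= C * nwW delta i v.
Proof.
move=> d0; have [C1 C10 h1] := wsobolev_wderiv cH hp hbeta i d0.
have [C2 C20 h2] := wderiv_wsobolev cH hp hbeta delta i.
have [L L0 hL] := wderiv_shift cH hp hbeta delta.
exists (C2 * (expR (L * r) * C1)) => [|tau v tr Wv]; first by rewrite !mulr_ge0// expR_ge0.
have [W1 n1] := h1 _ Wv; have [W2 n2] := hL _ tau _ W1; have [W3 n3] := h2 _ W2.
split=> //; apply: le_trans n3 _; rewrite -!mulrA ler_wpM2l//.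
apply: le_trans n2 _; apply: ler_pM => //; first exact: wderiv_norm_ge0.
by rewrite ler_expR ler_wpM2l.
Qed.

Lemma wsobolev_continuous delta i v : 0 <= delta -> wW delta i v -> forall eps, 0 < eps ->
  exists2 d, 0 < d & forall h, `|h| < d -> nwW delta i (fun t => v (t + h) - v t) <= eps.
Proof.
move=> d0 Wv eps eps0; have [C1 C10 h1] := wsobolev_wderiv cH hp hbeta i d0.
have [C2 C20 h2] := wderiv_wsobolev cH hp hbeta delta i.
have C2p : 0 < C2 + 1 by rewrite ltr_wpDl.
have [W1 n1] := h1 _ Wv.
have [d dp hd] := wderiv_continuous cH hp hbeta W1 (divr_gt0 eps0 C2p).
have [L L0 hL] := wderiv_shift cH hp hbeta delta.
exists d => // h hh; have [W2 _] := hL _ h _ W1.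
have [_ n3] := h2 _ (wderiv_sub cH hp hbeta W2 W1); apply: le_trans n3 _.
have := ltW (hd _ hh); rewrite ler_pdivlMr// mulrC; apply: le_trans.
by rewrite ler_wpM2r ?wderiv_norm_ge0// lerDl.
Qed.

Lemma wsobolev_embed delta delta' i : 0 <= delta <= delta' -> exists2 C, 0 <= C & forall v,
  wW delta' i.+1 v -> wW delta i v /\ nwW delta i v <= C * nwW delta' i.+1 v.
Proof.
move=> /andP[d0 dd]; have d'0 := le_trans d0 dd.
have [C1 C10 h1] := wsobolev_wderiv cH hp hbeta i.+1 d'0.
have [C2 C20 h2] := wderiv_wsobolev cH hp hbeta delta i.
exists (C2 * (expR (delta' - delta) * C1)) => [|v Wv]; first by rewrite !mulr_ge0// expR_ge0.
have [W1 n1] := h1 _ Wv; have [W2 n2] := wderiv_weaken W1.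
have [W3 n3] := wderiv_le cH hp hbeta dd W2; have [W4 n4] := h2 _ W3.
split=> //; apply: le_trans n4 _; rewrite -!mulrA ler_wpM2l//.
apply: le_trans n3 _; rewrite ler_wpM2l ?expR_ge0//; exact: le_trans n2 n1.
Qed.

Lemma wsobolev_deriv delta delta' i : 0 <= delta <= delta' -> exists2 C, 0 <= C & forall v,
  wW delta' i.+1 v -> wW delta i (D v) /\ nwW delta i (D v) <= C * nwW delta' i.+1 v.
Proof.
move=> /andP[d0 dd]; have d'0 := le_trans d0 dd.
have [C1 C10 h1] := wsobolev_wderiv cH hp hbeta i.+1 d'0.
have [C2 C20 h2] := wderiv_wsobolev cH hp hbeta delta i.
exists (C2 * (expR (delta' - delta) * C1)) => [|v Wv]; first by rewrite !mulr_ge0// expR_ge0.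
have [W1 n1] := h1 _ Wv; have [_ [_ W2]] := W1.
have [W3 n3] := wderiv_le cH hp hbeta dd W2; have [W4 n4] := h2 _ W3.
split=> //; apply: le_trans n4 _; rewrite -!mulrA ler_wpM2l//.
apply: le_trans n3 _; rewrite ler_wpM2l ?expR_ge0//; apply: le_trans n1.
by rewrite /= lerDr Lp_norm_ge0.
Qed.

Lemma wsobolev_coord delta i v : wW delta i.+1 v -> coord_deriv c v (D v).
Proof. by move=> [Wv _]; exact (sobolev_coord_deriv cH hp hbeta Wv). Qed.

Lemma wsobolev_difference_quotient delta delta' i v : 0 <= delta <= delta' ->
  wW delta' i.+1 v -> forall eps, 0 < eps -> exists2 d, 0 < d & forall h, 0 < h < d ->
    nwW delta i (fun t => v (t + h) - v t - h *: D v t) <= eps * h.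
Proof.
move=> /andP[d0 dd] Wv eps eps0; have d'0 := le_trans d0 dd.
have [C1 C10 h1] := wsobolev_wderiv cH hp hbeta i.+1 d'0.
have [C2 C20 h2] := wderiv_wsobolev cH hp hbeta delta i.
have C2p : 0 < C2 + 1 by rewrite ltr_wpDl.
have [W1 _] := h1 _ Wv; have [W2 _] := wderiv_le cH hp hbeta dd W1.
have [d dp hd] := wderiv_difference_quotient cH hp hbeta W2 (divr_gt0 eps0 C2p).
have [L L0 hL] := wderiv_shift cH hp hbeta delta.
exists d => // h hh; have [W3 _] := wderiv_weaken W2; have [W4 _] := hL _ h _ W3.
have [_ [_ WD]] := W2.
have W5 : wderiv H c p beta delta i (fun t => v (t + h) - v t - h *: D v t).
  have [W6 _] := wderiv_lin cH hp hbeta (- h) WD (wderiv_sub cH hp hbeta W4 W3).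
  by apply: (wderiv_ae hp _ W6).1; apply: aeW => t; rewrite scaleNr addrC.
have [_ n] := h2 _ W5; apply: le_trans n _.
have := hd _ hh; rewrite mulrAC ler_pdivlMr// mulrC; apply: le_trans.
by rewrite ler_wpM2r ?wderiv_norm_ge0// lerDl.
Qed.

End weighted_sobolev_facts.

(** * The scale of weighted Sobolev spaces *)

Lemma seq_upper_bound (R : realType) (s : seq nat) (P : nat -> R -> Prop) :
  (forall i C C', C <= C' -> P i C -> P i C') ->
  (forall i, i \in s -> exists2 C, 0 <= C & P i C) ->
  exists2 C, 0 <= C & forall i, i \in s -> P i C.
Proof.
move=> mono; elim: s => [|j s IH] hs; first by exists 0.
have [C C0 hC] := IH (fun i si => hs i (mem_behead (s := j :: s) si)).
have [C' C'0 hC'] := hs j (mem_head _ _).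
exists (C + C') => [|i]; first exact: addr_ge0.
rewrite inE => /orP[/eqP ->|si]; [apply: mono hC'|apply: mono (hC _ si)];
  by rewrite ?lerDl ?lerDr.
Qed.

Lemma seq_lower_bound (R : realType) (s : seq nat) (P : nat -> R -> Prop) :
  (forall i d d', d' <= d -> P i d -> P i d') ->
  (forall i, i \in s -> exists2 d, 0 < d & P i d) ->
  exists2 d, 0 < d & forall i, i \in s -> P i d.
Proof.
move=> mono; elim: s => [|j s IH] hs; first by exists 1.
have [d d0 hd] := IH (fun i si => hs i (mem_behead (s := j :: s) si)).
have [d' d'0 hd'] := hs j (mem_head _ _).
exists (Num.min d d') => [|i]; first by rewrite lt_min d0.
rewrite inE => /orP[/eqP ->|si]; [apply: mono hd'|apply: mono (hd _ si)];
  by rewrite ge_min lexx ?orbT.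
Qed.

Section ae_class_calculus.
Context (R : realType) (X : lmodType R).
Local Notation mu := (@lebesgue_measure R).
Implicit Types (a b : aeFun X).

Lemma repr_lin x a b : {ae mu, forall t, repr (x *: a + b) t = x *: repr a t + repr b t}.
Proof.
apply: filterS2 (repr_ae_class (fun t => repr (x *: a) t + repr b t))
  (repr_ae_class (fun t => x *: repr a t)) => t e1 e2.
by rewrite [LHS]e1 [repr (x *: a) t]e2.
Qed.

Lemma repr0 : {ae mu, forall t, repr (0 : aeFun X) t = 0}.
Proof. exact: (repr_ae_class (fun=> 0 : X)). Qed.

Lemma repr_sub a b : {ae mu, forall t, repr (a - b) t = repr a t - repr b t}.
Proof.
apply: filterS (repr_lin (-1) b a) => t.
by rewrite !scaleN1r addrC => ->; rewrite addrC.
Qed.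

Lemma repr_shift tau a : {ae mu, forall t, repr (shift_class tau a) t = repr a (t + tau)}.
Proof. exact: repr_ae_class. Qed.

Lemma shift_class0 a : shift_class 0 a = a.
Proof. by apply: ae_ext; apply: filterS (repr_shift 0 a) => t ->; rewrite addr0. Qed.

Lemma shift_classD s t a : shift_class (s + t) a = shift_class s (shift_class t a).
Proof.
apply/ae_classP; have := ae_shift s (repr_shift t a).
by apply: filterS => u /= ->; rewrite addrA.
Qed.

Lemma shift_class_lin tau x a b :
  shift_class tau (x *: a + b) = x *: shift_class tau a + shift_class tau b.
Proof.
apply: ae_ext.
have h1 : {ae mu, forall t, repr (shift_class tau (x *: a + b)) t =
    x *: repr a (t + tau) + repr b (t + tau)}.
  by apply: filterS2 (repr_shift tau (x *: a + b)) (ae_shift tau (repr_lin x a b)) => t -> ->.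
have h2 : {ae mu, forall t, x *: repr (shift_class tau a) t + repr (shift_class tau b) t =
    x *: repr a (t + tau) + repr b (t + tau)}.
  by apply: filterS2 (repr_shift tau a) (repr_shift tau b) => t -> ->.
apply: filterS3 h1 h2 (repr_lin x (shift_class tau a) (shift_class tau b)) => t.
by move=> -> <- ->.
Qed.

End ae_class_calculus.

(** A scale whose level [k] is an intersection of the weighted spaces of order [i]
with values in [Hs k i], for [i] in [s k]. By [HsS] and [sS] the component [i] of
level [k] comes back one order higher on level [k.+1], so a function of level
[k.+1] has a derivative to spend in every component of level [k]. *)
Section sobolev_scale.
Context (R : realType) (X : lmodType R) (Hs : nat -> nat -> hilb X).
Context (c : nat -> X -> R) (e : nat -> X).
Hypothesis cHs : forall k i, exists wt, coord_hilb (Hs k i) c wt e.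
Hypothesis HsS : forall k i, Hs k.+1 i.+1 = Hs k i.
Context (p : R) (hp : 1 < p) (beta : R -> R) (hbeta : cutoff beta).
Context (delta : nat -> R) (delta_ge0 : forall k, 0 <= delta k)
  (deltaS : forall k, delta k <= delta k.+1).
Context (s : nat -> seq nat) (sS : forall k i, i \in s k -> i.+1 \in s k.+1)
  (s1 : 1%N \in s 1%N).
Local Notation mu := (@lebesgue_measure R).
Local Notation D := (coord_derivative c).
Local Notation wW k i := (in_wsobolev (Hs k i) beta p (delta k) i).
Local Notation nwW k i := (wsobolev_norm (Hs k i) beta p (delta k) i).
Context (lev : nat -> set (aeFun X)) (nrm : nat -> aeFun X -> R).
Hypothesis levE : forall k a, lev k a <-> forall i, i \in s k -> wW k i (repr a).
Hypothesis nrm_ge0 : forall k a, 0 <= nrm k a.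
Hypothesis nrmE : forall k a M, 0 <= M ->
  (nrm k a <= M <-> forall i, i \in s k -> nwW k i (repr a) <= M).

Definition ae_deriv (a : aeFun X) : aeFun X := ae_class (D (repr a)).

Let nrm_ge k a i : i \in s k -> nwW k i (repr a) <= nrm k a.
Proof. exact: ((@nrmE k a _ (nrm_ge0 k a)).1 (lexx _)). Qed.

Let dS k : 0 <= delta k <= delta k.+1.
Proof. by rewrite deltaS andbT. Qed.

Let wWS k i a : lev k.+1 a -> i \in s k ->
  in_wsobolev (Hs k i) beta p (delta k.+1) i.+1 (repr a) /\
  wsobolev_norm (Hs k i) beta p (delta k.+1) i.+1 (repr a) <= nrm k.+1 a.
Proof.
move=> /levE la si; have := la _ (sS si); have := nrm_ge a (sS si).
by rewrite HsS.
Qed.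

Let bound k (T : Type) (P : T -> Prop) (F : T -> aeFun X) (B : T -> R) :
  (forall x, P x -> 0 <= B x) ->
  (forall i, i \in s k -> exists2 C, 0 <= C & forall x, P x -> nwW k i (repr (F x)) <= C * B x) ->
  exists2 C, 0 <= C & forall x, P x -> nrm k (F x) <= C * B x.
Proof.
move=> B0 hi.
have [i C C' CC h x Px|C C0 hC] := seq_upper_bound
  (P := fun i C => forall x, P x -> nwW k i (repr (F x)) <= C * B x) _ hi.
  by apply: le_trans (h x Px) _; rewrite ler_wpM2r// B0.
exists C => // x Px; have M0 : 0 <= C * B x by rewrite mulr_ge0// B0.
by apply: ((@nrmE k (F x) _ M0).2) => i si; exact: hC.
Qed.

Lemma sobolev_translation_scale :
  translation_scale (E := @Scale R (aeFun X) lev nrm) (@shift_class R X) ae_deriv.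
Proof.
have linr k i x (a b : aeFun X) : wW k i (repr a) -> wW k i (repr b) ->
    wW k i (repr (x *: a + b)) /\
    nwW k i (repr (x *: a + b)) <= `|x| * nwW k i (repr a) + nwW k i (repr b).
  move=> wa wb; have [wt cH] := cHs k i.
  have ab : {ae mu, forall t, x *: repr a t + repr b t = repr (x *: a + b) t}.
    by apply: filterS (repr_lin x a b) => t ->.
  have [w1 <-] := wsobolev_ae (Hs k i) hp (beta) (delta k) i ab.
  by have [w2 n2] := wsobolev_lin cH hp hbeta x wa wb; split=> //; exact: w1.
have lev0 k i : wW k i (repr (0 : aeFun X)) /\ nwW k i (repr (0 : aeFun X)) = 0.
  have [wt cH] := cHs k i.
  have h : {ae mu, forall t, 0 = repr (0 : aeFun X) t} by apply: filterS (@repr0 R X) => t ->.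
  have [w0 n0] := wsobolev0 cH hp hbeta (delta k) i.
  by have [w1 <-] := wsobolev_ae (Hs k i) hp beta (delta k) i h; split=> //; exact: w1.
have levL k x (a b : aeFun X) : lev k a -> lev k b -> lev k (x *: a + b).
  move=> /levE la /levE lb; apply/levE => i si.
  by have [] := linr k i x a b (la _ si) (lb _ si).
have nE : normed_scale (@Scale R (aeFun X) lev nrm).
  split=> //=.
  - by move=> k; apply/levE => i _; have [] := lev0 k i.
  - move=> k a la; apply/levE => i si; have [wt cH] := cHs k i.
    have [C C0 h] := wsobolev_embed cH hp hbeta i (dS k).
    by have [w _] := wWS la si; have [] := h _ w.
  - move=> k x a la; 
    have M0 : 0 <= `|x| * nrm k a by rewrite mulr_ge0.
    apply: ((@nrmE k _ _ M0).2) => i si.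
    have [w0 n0] := lev0 k i; have [_ n] := linr k i x a 0 ((levE _ _).1 la _ si) w0.
    move: n; rewrite addr0 n0 addr0; move/le_trans; apply.
    by rewrite ler_wpM2l// nrm_ge.
  - move=> k a b la lb; 
    have M0 : 0 <= nrm k a + nrm k b by rewrite addr_ge0.
    apply: ((@nrmE k _ _ M0).2) => i si.
    have [_] := linr k i 1 a b ((levE _ _).1 la _ si) ((levE _ _).1 lb _ si).
    rewrite scale1r normr1 mul1r => n; apply: le_trans n _; apply: lerD; exact: nrm_ge.
  - move=> k; apply: (bound (k := k) (P := lev k.+1) (F := id) (B := nrm k.+1)) => // i si.
    have [wt cH] := cHs k i; have [C C0 h] := wsobolev_embed cH hp hbeta i (dS k).
    exists C => // a la; have [w n] := wWS la si; have [_ n'] := h _ w.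
    by apply: le_trans n' _; rewrite ler_wpM2l.
have levB k (a b : aeFun X) : lev k a -> lev k b -> lev k (a - b).
  by move=> la lb; have := levL k (-1) b a lb la; rewrite scaleN1r addrC.
have shiftP k i tau (a : aeFun X) C : wW k i (fun t => repr a (t + tau)) /\
    nwW k i (fun t => repr a (t + tau)) <= C ->
    wW k i (repr (shift_class tau a)) /\ nwW k i (repr (shift_class tau a)) <= C.
  have h : {ae mu, forall t, repr a (t + tau) = repr (shift_class tau a) t}.
    by apply: filterS (repr_shift tau a) => t ->.
  by have [w1 ->] := wsobolev_ae (Hs k i) hp beta (delta k) i h => -[/w1].
have levS k t (a : aeFun X) : lev k a -> lev k (shift_class t a).
  move=> /levE la; apply/levE => i si; have [wt cH] := cHs k i.
  have [C C0 h] := wsobolev_shift cH hp hbeta i `|t| (delta_ge0 k).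
  by have [] := shiftP k i t a _ (h _ _ (lexx _) (la _ si)).
have derivP k i (a : aeFun X) C : wW k i (D (repr a)) /\ nwW k i (D (repr a)) <= C ->
    wW k i (repr (ae_deriv a)) /\ nwW k i (repr (ae_deriv a)) <= C.
  have h : {ae mu, forall t, D (repr a) t = repr (ae_deriv a) t}.
    by apply: filterS (repr_ae_class (D (repr a))) => t ->.
  by have [w1 ->] := wsobolev_ae (Hs k i) hp beta (delta k) i h => -[/w1].
split=> //=.
- exact: shift_class0.
- exact: shift_classD.
- exact: shift_class_lin.
- move=> k r; have [||C C0 h] := bound (k := k) (T := (R * aeFun X)%type)
    (P := fun x => `|x.1| <= r /\ lev k x.2) (F := fun x => shift_class x.1 x.2)
    (B := fun x => nrm k x.2).
  + by [].
  + move=> i si; have [wt cH] := cHs k i.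
    have [C C0 h] := wsobolev_shift cH hp hbeta i r (delta_ge0 k).
    exists C => // -[t a] /= [tr /levE la].
    have [_ n] := shiftP k i t a _ (h _ _ tr (la _ si)).
    by apply: le_trans n _; rewrite ler_wpM2l// nrm_ge.
  + by exists C => // t a tr la; exact: (h (t, a)).
- move=> k a la eps eps0; have e2 : 0 < eps / 2 by rewrite divr_gt0.
  have [i d d' dd h t td|i si|d d0 hd] := seq_lower_bound (s := s k)
    (P := fun i d => forall h : R, `|h| < d -> nwW k i (repr (shift_class h a - a)) <= eps / 2).
  + by apply: h; exact: lt_le_trans td dd.
  + have [wt cH] := cHs k i; have wa := (levE _ _).1 la _ si.
    have [d d0 hd] := wsobolev_continuous cH hp hbeta (delta_ge0 k) wa e2.
    exists d => // h /hd; congr (_ <= _); apply: (wsobolev_ae (Hs k i) hp beta (delta k) i _).2.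
    apply: filterS2 (repr_sub (shift_class h a) a) (repr_shift h a) => t -> ->.
    by [].
  + exists d => // h hh; apply: (@le_lt_trans _ _ (eps / 2)).
      by apply: ((@nrmE k _ _ (ltW e2)).2) => i si; exact: hd.
    by rewrite ltr_pdivrMr// mulr_natr mulr2n ltrDl.
- move=> k a la; apply/levE => i si; have [wt cH] := cHs k i.
  have [C C0 h] := wsobolev_deriv cH hp hbeta i (dS k); have [w _] := wWS la si.
  by have [] := derivP k i a _ (h _ w).
- move=> x a b la lb; have [wt cH] := cHs 0 0.
  have cd a' : lev 1 a' -> coord_deriv c (repr a') (D (repr a')).
    move=> /levE /(_ _ s1); rewrite HsS => w; exact (wsobolev_coord cH hp hbeta w).
  have h := coord_derivative_eq cH (coord_deriv_lin cH x (cd _ la) (cd _ lb)).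
  apply: ae_ext; rewrite /ae_deriv (coord_derivative_ae c (repr_lin x a b)).
  have h1 : {ae mu, forall t, repr (x *: ae_deriv a + ae_deriv b) t =
      x *: D (repr a) t + D (repr b) t}.
    apply: filterS3 (repr_lin x (ae_deriv a) (ae_deriv b)) (repr_ae_class (D (repr a)))
      (repr_ae_class (D (repr b))) => t.
    by rewrite /ae_deriv => -> -> ->.
  apply: filterS3 (repr_ae_class (D (fun t => x *: repr a t + repr b t))) h h1 => t.
  by move=> -> -> ->.
- move=> k; apply: (bound (k := k) (P := lev k.+1) (F := ae_deriv) (B := nrm k.+1)) => // i si.
  have [wt cH] := cHs k i; have [C C0 h] := wsobolev_deriv cH hp hbeta i (dS k).
  exists C => // a la; have [w n] := wWS la si; have [_ n'] := derivP k i a _ (h _ w).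
  by apply: le_trans n' _; rewrite ler_wpM2l.
- move=> k a la eps eps0.
  have [i d d' dd h t /andP[t0 td]|i si|d d0 hd] := seq_lower_bound (s := s k)
    (P := fun i d => forall h : R, 0 < h < d ->
      nwW k i (repr (shift_class h a - a - h *: ae_deriv a)) <= eps * h).
  + by apply: h; rewrite t0; exact: lt_le_trans td dd.
  + have [wt cH] := cHs k i; have [wa _] := wWS la si.
    have [d d0 hd] := wsobolev_difference_quotient cH hp hbeta (dS k) wa eps0.
    exists d => // h /hd; congr (_ <= _); apply: (wsobolev_ae (Hs k i) hp beta (delta k) i _).2.
    have h1 := repr_lin (- h) (ae_deriv a) (shift_class h a - a).
    have h2 : {ae mu, forall t, repr (shift_class h a - a) t = repr a (t + h) - repr a t}.
      by apply: filterS2 (repr_sub (shift_class h a) a) (repr_shift h a) => t -> ->.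
    apply: filterS3 h1 h2 (repr_ae_class (D (repr a))) => t.
    by rewrite !scaleNr addrC => -> -> ->; rewrite addrC.
  + exists d => // h hh; have M0 : 0 <= eps * h.
      by have /andP[h0 _] := hh; rewrite mulr_ge0// ltW.
    by apply: ((@nrmE k _ _ M0).2) => i si; exact: hd.
Qed.

End sobolev_scale.

(** * The coordinates of the Hilbert spaces *)

Section coordinates.
Context (R : realType).

Definition row_coord n (nu : nat) (x : 'rV[R]_n) : R :=
  if insub nu is Some i then x ord0 i else 0.

Lemma row_coord_ord n (i : 'I_n) x : row_coord i x = x ord0 i.
Proof. by rewrite /row_coord valK. Qed.

Lemma row_coord_out n nu (x : 'rV[R]_n) : (n <= nu)%N -> row_coord nu x = 0.
Proof. by move=> h; rewrite /row_coord insubF// ltnNge h. Qed.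

Lemma cvg_series_finite n (u : nat -> R) : (forall nu, (n <= nu)%N -> u nu = 0) ->
  series u @ \oo --> \sum_(i < n) u i.
Proof.
move=> u0; apply: cvg_near_cst; exists n => // N /= nN.
rewrite /series/= -(big_mkord xpredT u) (big_cat_nat _ nN)//=.
rewrite -[RHS]addr0; congr (_ + _); rewrite big_nat_cond big1//.
by move=> i /andP[/andP[ni _] _]; exact: u0.
Qed.

Lemma euclidean_coord n : coord_hilb (euclidean R n) (@row_coord n) (fun=> 1)
  (fun nu => \row_(j < n) ((j : nat) == nu)%:R).
Proof.
have fin u : (forall nu, (n <= nu)%N -> u nu = 0) -> _ := @cvg_series_finite n u.
split=> //.
- by move=> nu a x y; rewrite /row_coord; case: insub => [i|]; rewrite ?mxE// mulr0 addr0.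
- by move=> x y xy; apply/rowP => i; rewrite -!row_coord_ord.
- move=> nu m mnu; rewrite /row_coord; case: insubP => // i _ im.
  by rewrite mxE im (negPf mnu).
- move=> nu x; rewrite /row_coord; case: insubP => [i _ inu|]; last by rewrite mulr0.
  by rewrite mxE inu eqxx mul1r.
- move=> x; split=> // _; apply: cvgP; apply: fin => nu h.
  by rewrite row_coord_out// expr0n mulr0.
- move=> x y _ _ /=; apply/esym/cvg_lim => //.
  rewrite (eq_bigr (fun i : 'I_n => 1 * row_coord i x * row_coord i y)); last first.
    by move=> i _; rewrite !row_coord_ord mul1r.
  apply: (fin (fun nu => 1 * row_coord nu x * row_coord nu y)) => nu h.
  by rewrite row_coord_out// mulr0 mul0r.
Qed.

Lemma l2pow_coord (f : nat -> R) j : (forall nu, 0 < f nu) ->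
  {homo f : m n / (m <= n)%N >-> m <= n} ->
  coord_hilb (l2pow f j) (fun nu x => x nu) (fun nu => f nu ^+ j)
    (fun nu m => (m == nu)%:R).
Proof.
move=> f0 fm; split=> //.
- by move=> x y xy; apply/funext.
- by move=> nu; rewrite exprn_gt0.
- by move=> nu m /negPf ->.
- by move=> nu x; rewrite eqxx mul1r.
- move=> x; split=> [[]//|h]; split=> //; rewrite /summable_seq.
  (* Monotonicity bounds [x nu ^+ 2] by a multiple of the weighted term. *)
  apply: (@series_le_cvg _ _ (fun nu => (f 0%N ^+ j)^-1 * (f nu ^+ j * x nu ^+ 2))).
  + by move=> nu; exact: sqr_ge0.
  + move=> nu; apply: mulr_ge0; first by rewrite invr_ge0 exprn_ge0// ltW.
    by rewrite mulr_ge0 ?sqr_ge0// exprn_ge0// ltW.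
  + move=> nu; rewrite mulrA ler_peMl ?sqr_ge0//.
    by rewrite mulrC ler_pdivlMr ?exprn_gt0// mul1r lerXn2r ?nnegrE ?fm// (ltW (f0 _)).
  + exact: is_cvg_seriesZ h.
Qed.

End coordinates.

(** * Smoothness of the shift map *)

Theorem theorem6p2 (R : realType) (beta : R -> R) (p : R) (delta : nat -> R)
    (hbeta : cutoff beta) (hp : 1 < p) (hdelta0 : delta 0%N = 0)
    (hdelta : forall k : nat, delta k < delta k.+1) :
  (forall n : nat, (0 < n)%N ->
    let E := morse_scale beta p delta n in
    let RE := scale_sum (scale_const R) E in
    @sc_smooth R RE E (@level R RE 0) (@shift_map R _)) /\
  (forall f : nat -> R,
    (forall nu, 0 < f nu) ->
    {homo f : m n / (m <= n)%N >-> m <= n} ->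
    (forall M : R, exists nu, M < f nu) ->
    let E := floer_scale beta p delta f in
    let RE := scale_sum (scale_const R) E in
    @sc_smooth R RE E (@level R RE 0) (@shift_map R _)).
Proof.
have deltaS k : delta k <= delta k.+1 by exact: ltW.
have delta_ge0 k : 0 <= delta k.
  by elim: k => [|k IH]; [rewrite hdelta0|exact: le_trans IH (deltaS k)].
split=> [n _|f f0 fm _] E RE.
  have ts : translation_scale (E := E) (@shift_class R _) (ae_deriv (@row_coord R n)).
    apply: (@sobolev_translation_scale R _ (fun _ _ => euclidean R n) (@row_coord R n)
      (fun nu => \row_(j < n) ((j : nat) == nu)%:R) _ _ p hp beta hbeta delta delta_ge0 deltaS
      (fun k => [:: k])).
    - by move=> _ _; exists (fun=> 1); exact: euclidean_coord.
    - by [].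
    - by move=> k i; rewrite !inE => /eqP ->.
    - by rewrite inE.
    - move=> k a; split=> [h i|h]; last by apply: h; rewrite inE.
      by rewrite inE => /eqP ->.
    - by move=> k a; exact: sobolev_norm_ge0.
    - move=> k a M _; split=> [h i|h]; last by apply: h; rewrite inE.
      by rewrite inE => /eqP ->.
  exact: (translation_sc_smooth ts (@level R RE 0)).
have ts : translation_scale (E := E) (@shift_class R _)
    (ae_deriv (fun nu (x : nat -> R : lmodType R) => x nu)).
  apply: (@sobolev_translation_scale R _ (fun k i => l2pow f (k - i)) (fun nu x => x nu)
    (fun nu m => (m == nu)%:R) _ _ p hp beta hbeta delta delta_ge0 deltaS
    (fun k => iota 0 k.+1)).
  - by move=> k i; exists (fun nu => f nu ^+ (k - i)); exact: l2pow_coord.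
  - by move=> k i; rewrite subSS.
  - by move=> k i; rewrite !mem_iota.
  - by [].
  - move=> k a; split=> h i; first by rewrite mem_iota => /h.
    by move=> ik; apply: h; rewrite mem_iota.
  - move=> k a; rewrite /=; elim/big_ind: _ => // [x y x0 y0|i _].
      by rewrite le_max x0.
    exact: sobolev_norm_ge0.
  - move=> k a M M0; split=> [/bigmax_leP [_ h] i|h].
      by rewrite mem_iota => /= ik; exact: (h (Ordinal (ik : (i < k.+1)%N))).
    by apply/bigmax_leP; split=> // i _; apply: h; rewrite mem_iota/=.
exact: (translation_sc_smooth ts (@level R RE 0)).
Qed.
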